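(* Let $X\sim\mathcal N(0,\Sigma_X)$ and let $H^{(0)},\dots,H^{(L)}$ be any sequence of representations with $H^{(\ell+1)}$ generated from $(H^{(\ell)},Z)$. Assume that for each $\ell=0,\dots,L-1$ the Markov chain $X-(H^{(\ell)},Z)-H^{(\ell+1)}$ holds and $$I\big(Z;H^{(\ell+1)}\mid H^{(\ell)}\big)\le R_\ell.$$ Then $$\log\det K_X^{(L)}\ \ge\ \log\det\Sigma_X-2\sum_{\ell=0}^{L-1}R_\ell.$$
   Context: $X$ takes values in $\mathbb R^k$ and $\Sigma_X\succ0$. $Z$ denotes the available data, a random variable correlated with $X$. ''Generated from $(H^{(\ell)},Z)$'' means $H^{(\ell+1)}\sim p_\ell(\cdot\mid H^{(\ell)},Z)$ for some (possibly randomized) update rule $p_\ell$. $K_X^{(\ell)}=\Sigma_{X\mid H^{(\ell)}}$ is the posterior error covariance after step $\ell$, where $\Sigma_{X\mid U}=\mathbb E[(X-\mathbb E[X\mid U])(X-\mathbb E[X\mid U])^\top]$ is the average MMSE error covariance, and it is assumed that $K_X^{(0)}=\Sigma_X$. Logarithms are natural and mutual information is in nats.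
   Formalization: The formal theorem additionally assumes X is independent of H^(0); with only K_X^(0)=Σ_X the claim fails, e.g. X~N(0,1), H^(0)=|X|, Z=sign X, H^(1)=X, R_0=log 2, where K_X^(1)=0. *)

(* Defs.v *)
From HB Require Import structures.
From mathcomp Require Import all_boot all_order all_algebra.
From mathcomp Require Import all_classical all_reals all_analysis.
From mathcomp Require Import measurable_realfun.

Set Implicit Arguments.
Unset Strict Implicit.
Unset Printing Implicit Defensive.

Import Order.TTheory GRing.Theory Num.Theory.
Import numFieldNormedType.Exports.

Local Open Scope classical_set_scope.
Local Open Scope ring_scope.

Section ConditionalExpectation.
Context (d d' : measure_display) (T : measurableType d) (T' : measurableType d')
  (R : realType) (P : probability T R).

(** [g] is a version of [u |-> E[f | U = u]]; by the Doob-Dynkin lemma the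
    sigma(U)-measurable functions are exactly the [g \o U] with [g] measurable. *)
Definition is_cond_exp (U : T -> T') (f : T -> R) (g : T' -> R) : Prop :=
  [/\ measurable_fun setT g,
      P.-integrable setT (EFin \o (g \o U)) &
      forall B : set T', measurable B ->
        (\int[P]_(w in U @^-1` B) (f w)%:E =
         \int[P]_(w in U @^-1` B) (g (U w))%:E)%E].

(** The random variable E[f | U]: a chosen version, as a function on [T]. *)
Definition cond_exp (U : T -> T') (f : T -> R) : T -> R :=
  xget (cst 0) [set g | is_cond_exp U f g] \o U.

Definition cond_prob (U : T -> T') (A : set T) : T -> R := cond_exp U \1_A.

(** For integrable [f] a version exists, so [xget] never returns its default. *)
Lemma is_cond_exp_exists (U : {mfun T >-> T'}) (f : T -> R) :
  P.-integrable setT (EFin \o f) -> exists g, is_cond_exp U f g.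
Proof.
move=> intf.
have mU : measurable_fun setT (U : T -> T') by exact: measurable_funP.
have [nu nuE] : exists nu : charge T' R,
    forall A, nu A = (\int[P]_(w in U @^-1` A) (f w)%:E)%E.
  by exists (measure_function_pushforward__canonical__charge_Charge
    (charge_induced_charge__canonical__charge_Charge intf) mU).
have numu : nu `<< distribution P U.
  apply/null_content_dominatesP => A mA PA0.
  have mUA : measurable (U @^-1` A).
    by rewrite -[X in measurable X]setTI; exact: mU.
  rewrite nuE; apply: null_set_integral => //.
  exact: (measurable_funS measurableT _ (measurable_int _ intf)).
pose h := Radon_Nikodym nu (distribution P U).
have hE x : (fine (h x))%:E = h x by rewrite fineK// Radon_Nikodym_fin_num.
have inth := Radon_Nikodym_integrable numu.
have mh : measurable_fun setT h by exact: measurable_int inth.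
have inthU : P.-integrable setT (h \o U).
  apply/integrableP; split; first exact: measurableT_comp.
  move/integrableP: inth => [_]; rewrite ge0_integral_distribution//.
  exact: measurableT_comp.
exists (fine \o h); split.
- exact: measurableT_comp.
- by rewrite (_ : EFin \o _ = h \o U)//; apply/funext => w; exact: hE.
- move=> B mB; rewrite -nuE (Radon_Nikodym_integral numu mB).
  rewrite integral_pushforward//; last first.
    by apply: integrableS inthU => //; rewrite -[X in measurable X]setTI; exact: mU.
  by apply: eq_integral => w _; rewrite /= hE.
Qed.

Lemma cond_expP (U : {mfun T >-> T'}) (f : T -> R) :
  P.-integrable setT (EFin \o f) ->
  exists2 g, is_cond_exp U f g & cond_exp U f = g \o U.
Proof.
move=> /(is_cond_exp_exists U) -[g gP].
exists (xget (cst 0) [set g | is_cond_exp U f g]) => //.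
exact: (xgetI (cst 0) gP).
Qed.

End ConditionalExpectation.

Section ConditionalLaws.
Context (d dA dB dC : measure_display) (T : measurableType d)
  (TA : measurableType dA) (TB : measurableType dB) (TC : measurableType dC)
  (R : realType) (P : probability T R).

Definition indep_rv (A : T -> TA) (B : T -> TB) : Prop :=
  forall (a : set TA) (b : set TB), measurable a -> measurable b ->
    P (A @^-1` a `&` B @^-1` b) = (P (A @^-1` a) * P (B @^-1` b))%E.

Definition markov_chain (A : T -> TA) (C : T -> TC) (B : T -> TB) : Prop :=
  forall (a : set TA) (b : set TB), measurable a -> measurable b ->
    {ae P, forall w, cond_prob P C (A @^-1` a `&` B @^-1` b) w =
                     cond_prob P C (A @^-1` a) w * cond_prob P C (B @^-1` b) w}.

(** B ~ p(. | C). *)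
Definition generated_by (p : R.-pker TC ~> TB) (C : T -> TC) (B : T -> TB) :
    Prop :=
  forall b : set TB, measurable b ->
    {ae P, forall w, p (C w) b = (cond_prob P C (B @^-1` b) w)%:E}.

(** A_0, ..., A_(n-1) is a measurable partition (empty cells allowed). *)
Definition measurable_partition (d' : measure_display) (T' : measurableType d')
    (n : nat) (E : 'I_n -> set T') : Prop :=
  [/\ forall i, measurable (E i), trivIset setT E & \bigcup_i E i = setT].

(** I([A]; [B] | C) in nats for the quantizations of A and B by the partitions
    E and F: the expectation of the discrete mutual information of the
    conditional probability mass functions given C. The convention
    0 * log 0 = 0 is automatic, and a null product of the marginals forces a
    null joint probability almost surely. *)
Definition quantized_cond_mutual_info (A : T -> TA) (B : T -> TB) (C : T -> TC)
    (n m : nat) (E : 'I_n -> set TA) (F : 'I_m -> set TB) : \bar R :=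
  let info w := \sum_(i < n) \sum_(j < m)
    let pAB := cond_prob P C (A @^-1` E i `&` B @^-1` F j) w in
    let pA := cond_prob P C (A @^-1` E i) w in
    let pB := cond_prob P C (B @^-1` F j) w in
    pAB * ln (pAB / (pA * pB)) in
  'E_P[info]%E.

(** I(A; B | C) for arbitrary alphabets, after Dobrushin (no conditioning) and
    Wyner: the supremum over all finite quantizations of A and B. *)
Definition cond_mutual_info (A : T -> TA) (B : T -> TB) (C : T -> TC) :
    \bar R :=
  ereal_sup [set I | exists (n m : nat) (E : 'I_n -> set TA)
                            (F : 'I_m -> set TB),
    [/\ measurable_partition E, measurable_partition F &
        I = quantized_cond_mutual_info A B C E F]].

End ConditionalLaws.

Section GaussianVectors.
Context (d : measure_display) (T : measurableType d) (R : realType)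
  (P : probability T R) (k : nat).

Definition posdefmx (S : 'M[R]_k) : Prop :=
  S^T = S /\ forall a : 'rV[R]_k, a != 0 -> 0 < (a *m S *m a^T) 0 0.

(** X ~ N(mu, S) for positive definite S: every nonzero linear combination a X
    is N(a mu, a S a^T). The second parameter of [normal_prob] is the standard
    deviation, and [normal_prob _ 0] is not a Dirac mass, so this does not
    cover singular S. *)
Definition gaussian_vector (X : T -> k.-tuple R) (mu : 'cV[R]_k)
    (S : 'M[R]_k) : Prop :=
  forall a : 'rV[R]_k, a != 0 -> forall B : set R, measurable B ->
    P ((fun w => \sum_(i < k) a 0 i * tnth (X w) i) @^-1` B) =
    normal_prob ((a *m mu) 0 0) (Num.sqrt ((a *m S *m a^T) 0 0)) B.

(** Sigma_(X | U), the average MMSE error covariance. *)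
Definition mmse_cov (d' : measure_display) (T' : measurableType d')
    (X : T -> k.-tuple R) (U : T -> T') : 'M[R]_k :=
  let err i := fun w =>
    tnth (X w) i - cond_exp P U (fun w' => tnth (X w') i) w in
  \matrix_(i, j) fine 'E_P[err i \* err j]%E.

End GaussianVectors.

(* Main.v *)
(** Put [I(X; H) <= S] in its Gibbs form: [E t <= S + E' e^t - 1] for every test function [t] of
    [(H, X)], where under [E'] the variable [X] is replaced by an independent copy. Along the
    Markov chain [X - (H, Z) - H'] the bound [S] grows by at most [I(Z; H' | H)]: for quantized
    variables this is data processing, i.e. the convexity of [exp] against the conditional law of
    [X] given [(H, Z)], and quantized test functions are dense in L1. Hence
    [I(X; H_L) <= R_0 + ... + R_(L-1)].

    Next, diagonalize [Sigma] and [K = K_X^(L)] simultaneously and test with the logarithm of the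
    density of [N(E[X|H_L], K)] with respect to [N(0, Sigma)], which is a sum of functions of
    independent standard normal coordinates; this yields
    [log det Sigma - log det K <= 2 I(X; H_L)]. Gaussianity of [X] only gives the laws of its
    linear combinations, so the test density is integrated by writing each of its one-dimensional
    factors as a Gaussian mixture of cosines. *)

Require Import Defs.
From HB Require Import structures.
From mathcomp Require Import all_boot all_order all_algebra.
From mathcomp Require Import all_classical all_reals all_analysis.
From mathcomp Require Import measurable_realfun.
From mathcomp Require Import ring lra.

Set Implicit Arguments.
Unset Strict Implicit.
Unset Printing Implicit Defensive.

Import Order.TTheory GRing.Theory Num.Theory.
Import numFieldNormedType.Exports.

Local Open Scope classical_set_scope.
Local Open Scope ring_scope.

(** * Integrals of bounded measurable functions *)

(** The alphabets are arbitrary measurable spaces, so the conditional laws of [X] and [Z] need not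
    exist as kernels, and the bound on [cond_mutual_info] only speaks of conditional probabilities
    of finitely many events. This is why no entropy or density of [H] appears: the Gibbs form
    involves expectations only, and in it the chain rule for information becomes the splitting of a
    test function into its conditional log-normalizer given [H] and a normalized remainder. The
    conditioning variable [H] is never discretized; only the variables whose information is measured
    are.

    The matrix [K] is not known to be invertible, and the positivity of its determinant comes out of
    the final bound. Its error variances, which may be 0 or 1, are therefore replaced in the test
    density by numbers [v] strictly inside the unit interval: [0 < v] makes the density exist, and
    [v < 1] makes it bounded relative to the standard normal law and a mixture of cosines. *)

Notation Rintegrable mu f := (mu.-integrable setT (EFin \o f)).

Section Rintegrable.
Context d (T : measurableType d) (R : realType) (mu : {measure set T -> \bar R}).
Implicit Types f g : T -> R.

Lemma Rintegrable_meas f : Rintegrable mu f -> measurable_fun setT f.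
Proof. by move/measurable_int/measurable_EFinP. Qed.

Lemma RintegrableD f g : Rintegrable mu f -> Rintegrable mu g ->
  Rintegrable mu (fun x => f x + g x).
Proof. move=> hf hg; have := integrableD measurableT hf hg; exact: eq_integrable. Qed.

Lemma RintegrableB f g : Rintegrable mu f -> Rintegrable mu g ->
  Rintegrable mu (fun x => f x - g x).
Proof. move=> hf hg; have := integrableB measurableT hf hg; exact: eq_integrable. Qed.

Lemma RintegrableZl (c : R) f : Rintegrable mu f -> Rintegrable mu (fun x => c * f x).
Proof. move=> hf; have := integrableZl measurableT c hf; exact: eq_integrable. Qed.

Lemma Rintegrable0 : Rintegrable mu (fun=> 0 : R).
Proof. exact: integrable0. Qed.

Lemma Rintegrable_sum (I : Type) (s : seq I) (P : pred I) (F : I -> T -> R) :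
  (forall i, P i -> Rintegrable mu (F i)) -> Rintegrable mu (fun x => \sum_(i <- s | P i) F i x).
Proof.
move=> h; elim: s => [|i s IH].
  by under eq_fun do rewrite big_nil; exact: Rintegrable0.
have [Pi|/negbTE nPi] := boolP (P i); last by under eq_fun do rewrite big_cons nPi.
under eq_fun do rewrite big_cons Pi.
by apply: RintegrableD => //; exact: h.
Qed.

Lemma Rintegral_sum (I : Type) (s : seq I) (P : pred I) (F : I -> T -> R) :
  (forall i, P i -> Rintegrable mu (F i)) ->
  \int[mu]_x (\sum_(i <- s | P i) F i x) = \sum_(i <- s | P i) \int[mu]_x F i x.
Proof.
move=> h; elim: s => [|i s IH].
  rewrite big_nil; under eq_Rintegral do rewrite big_nil.
  by rewrite /Rintegral integral0.
have [Pi|/negbTE nPi] := boolP (P i); last first.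
  by under eq_Rintegral do rewrite big_cons nPi; rewrite big_cons nPi.
under eq_Rintegral do rewrite big_cons Pi; rewrite big_cons Pi.
rewrite RintegralD ?IH//; first exact: h.
exact: Rintegrable_sum.
Qed.

Lemma Rintegral_sum2 (I J : finType) (F : I -> J -> T -> R) :
  (forall i j, Rintegrable mu (F i j)) ->
  \int[mu]_x (\sum_i \sum_j F i j x) = \sum_i \sum_j \int[mu]_x F i j x.
Proof.
move=> iF; rewrite Rintegral_sum; last by move=> i _; exact: Rintegrable_sum.
by apply: eq_bigr => i _; rewrite Rintegral_sum.
Qed.

Lemma le_Rintegrable f g : measurable_fun setT f ->
  (forall x, `|f x| <= g x) -> Rintegrable mu g -> Rintegrable mu f.
Proof.
move=> mf fg; apply: le_integrable => //; first exact/measurable_EFinP.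
by move=> x _ /=; rewrite lee_fin (le_trans (fg x))// ler_norm.
Qed.

Lemma RintegralN f : Rintegrable mu f -> \int[mu]_x (- f x) = - \int[mu]_x f x.
Proof.
move=> intf; under eq_Rintegral do rewrite -mulN1r.
by rewrite RintegralZl// mulN1r.
Qed.

Lemma ae_eq_Rintegral f g : measurable_fun setT f -> measurable_fun setT g ->
  {ae mu, forall x, f x = g x} -> \int[mu]_x f x = \int[mu]_x g x.
Proof.
move=> mf mg fg; rewrite /Rintegral; congr fine.
apply: ae_eq_integral => //; [exact/measurable_EFinP..|].
by apply: filterS fg => x /= -> _.
Qed.

Lemma Rintegrable_ae f g : Rintegrable mu f -> measurable_fun setT g ->
  {ae mu, forall x, f x = g x} -> Rintegrable mu g.
Proof.
move=> /integrableP[mf intf] mg fg; apply/integrableP; split; first exact/measurable_EFinP.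
rewrite (_ : (\int[mu]_x `|(EFin \o g) x|)%E = (\int[mu]_x `|(EFin \o f) x|)%E)//.
apply: ae_eq_integral => //; [apply: measurableT_comp => //; exact/measurable_EFinP
 |exact: measurableT_comp|].
by apply: filterS fg => x /= -> _.
Qed.

(** Reduces to a pointwise comparison: [f] agrees almost everywhere with the minimum of [f] and [g],
    which lies below [g] everywhere. *)
Lemma ae_le_Rintegral f g : Rintegrable mu f -> Rintegrable mu g ->
  {ae mu, forall x, f x <= g x} -> \int[mu]_x f x <= \int[mu]_x g x.
Proof.
move=> intf intg fg.
have mf := Rintegrable_meas intf; have mg := Rintegrable_meas intg.
have mm : measurable_fun setT (fun x => Order.min (f x) (g x)) by exact: measurable_minr.
have e : {ae mu, forall x, f x = Order.min (f x) (g x)}.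
  by apply: filterS fg => x fg; rewrite min_l.
rewrite (ae_eq_Rintegral mf mm e); apply: le_Rintegral => //.
  exact: Rintegrable_ae e.
by move=> x _; rewrite ge_min lexx orbT.
Qed.

Lemma Rintegral_indic (A : set T) : measurable A -> \int[mu]_x (\1_A x) = fine (mu A).
Proof. by move=> mA; rewrite /Rintegral integral_indic// setIT. Qed.

End Rintegrable.

(** The class of test functions: stable under all the operations used below and integrable for every
    finite measure, so that integrability becomes a syntactic check. *)
Definition bmeas d (T : measurableType d) (R : realType) (f : T -> R) : Prop :=
  measurable_fun setT f /\ exists M, forall x, `|f x| <= M.

Section bmeas.
Context d (T : measurableType d) (R : realType).
Implicit Types f g : T -> R.

Lemma bmeas_cst (c : R) : bmeas (fun _ : T => c).
Proof. by split => //; exists `|c|. Qed.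

Lemma bmeasD f g : bmeas f -> bmeas g -> bmeas (fun x => f x + g x).
Proof.
move=> [mf [M hM]] [mg [N hN]]; split; first exact: measurable_funD.
by exists (M + N) => x; rewrite (le_trans (ler_normD _ _))// lerD.
Qed.

Lemma bmeasM f g : bmeas f -> bmeas g -> bmeas (fun x => f x * g x).
Proof.
move=> [mf [M hM]] [mg [N hN]]; split; first exact: measurable_funM.
by exists (M * N) => x; rewrite normrM ler_pM.
Qed.

Lemma bmeasN f : bmeas f -> bmeas (fun x => - f x).
Proof.
move=> [mf [M hM]]; split; first exact: measurable_funN.
by exists M => x; rewrite normrN.
Qed.

Lemma bmeasB f g : bmeas f -> bmeas g -> bmeas (fun x => f x - g x).
Proof. by move=> ? ?; apply: bmeasD => //; exact: bmeasN. Qed.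

Lemma bmeas_sum (I : Type) (s : seq I) (P : pred I) (F : I -> T -> R) :
  (forall i, P i -> bmeas (F i)) -> bmeas (fun x => \sum_(i <- s | P i) F i x).
Proof.
move=> h; elim: s => [|i s IH].
  by under eq_fun do rewrite big_nil; exact: bmeas_cst.
have [Pi|/negbTE nPi] := boolP (P i); last by under eq_fun do rewrite big_cons nPi.
under eq_fun do rewrite big_cons Pi.
by apply: bmeasD => //; exact: h.
Qed.

Lemma bmeas_prod (I : Type) (s : seq I) (P : pred I) (F : I -> T -> R) :
  (forall i, P i -> bmeas (F i)) -> bmeas (fun x => \prod_(i <- s | P i) F i x).
Proof.
move=> h; elim: s => [|i s IH].
  by under eq_fun do rewrite big_nil; exact: bmeas_cst.
have [Pi|/negbTE nPi] := boolP (P i); last by under eq_fun do rewrite big_cons nPi.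
under eq_fun do rewrite big_cons Pi.
by apply: bmeasM => //; exact: h.
Qed.

Lemma bmeas_indic (A : set T) : measurable A -> bmeas (\1_A : T -> R).
Proof.
move=> mA; split; first exact: measurable_indic.
by exists 1 => x; rewrite indicE; case: (_ \in _); rewrite ?normr1 ?normr0.
Qed.

Lemma bmeas_norm f : bmeas f -> bmeas (fun x => `|f x|).
Proof.
move=> [mf [M hM]]; split; first exact: measurableT_comp.
by exists M => x; rewrite normr_id.
Qed.

Lemma bmeas_expR f : bmeas f -> bmeas (fun x => expR (f x)).
Proof.
move=> [mf [M hM]]; split; first exact: measurableT_comp.
exists (expR M) => x; rewrite ger0_norm ?expR_ge0// ler_expR.
by rewrite (le_trans _ (hM x))// ler_norm.
Qed.

Lemma bmeas_cos f : measurable_fun setT f -> bmeas (fun x => cos (f x)).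
Proof.
move=> mf; split.
  by apply: measurableT_comp => //; apply: continuous_measurable_fun; exact: continuous_cos.
by exists 1 => x; rewrite ler_norml cos_geN1 cos_le1.
Qed.

Lemma bmeas_comp d' (T' : measurableType d') (U : T' -> T) f :
  measurable_fun setT U -> bmeas f -> bmeas (fun x => f (U x)).
Proof.
move=> mU [mf [M hM]]; split; first exact: measurableT_comp.
by exists M.
Qed.

Lemma bmeas_bound_fin (J : finType) (s : J -> T -> R) : (forall j, bmeas (s j)) ->
  exists2 M, 0 <= M & forall j x, `|s j x| <= M.
Proof.
move=> bs; have /choice[m hm] : forall j, exists m, forall x, `|s j x| <= m.
  by move=> j; case: (bs j).
exists (\sum_j `|m j|); first by apply: sumr_ge0.
move=> j x; apply: (le_trans (hm j x)); apply: (le_trans (ler_norm _)).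
by rewrite (bigD1 j)//= lerDl sumr_ge0.
Qed.

Lemma bmeas_integrable (mu : {finite_measure set T -> \bar R}) f :
  bmeas f -> Rintegrable mu f.
Proof.
move=> [mf [M hM]]; apply: measurable_bounded_integrable => //.
  by rewrite fin_num_fun_lty//; exact: fin_num_measure.
by exists M; split; [exact: num_real|move=> y My x _; rewrite /= (le_trans (hM x))// ltW].
Qed.

Lemma RintegrableM (mu : {measure set T -> \bar R}) f g : bmeas f -> Rintegrable mu g ->
  Rintegrable mu (fun x => f x * g x).
Proof.
move=> [mf [M hM]] intg; have mg := Rintegrable_meas intg.
apply: (@le_Rintegrable _ _ _ _ _ (fun x => M * `|g x|)).
- exact: measurable_funM.
- by move=> x; rewrite normrM ler_wpM2r.
- by apply: RintegrableZl; exact: integrable_norm.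
Qed.

End bmeas.

Lemma Rintegral_probability_cst d (T : measurableType d) (R : realType)
  (P : probability T R) (c : R) : \int[P]_x c = c.
Proof. by rewrite Rintegral_cst//= [X in fine X]probability_setT mulr1. Qed.

Section probability_integral.
Context d (T : measurableType d) (R : realType) (P : probability T R).


Lemma Rintegral_distribution d' (T' : measurableType d') (X : {RV P >-> T'}) (f : T' -> R) :
  bmeas f -> \int[distribution P X]_y f y = \int[P]_x f (X x).
Proof.
move=> bf; rewrite /Rintegral integral_distribution//.
exact/measurable_EFinP/bf.1.
by apply: (@bmeas_integrable _ _ _ P (fun x => f (X x))); exact: bmeas_comp.
Qed.

Section product.
Context d' (T' : measurableType d') (Q : probability T' R) (f : T * T' -> R).
Hypothesis bf : bmeas f.

Let intf : (P \x Q)%E.-integrable setT (EFin \o f).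
Proof. exact: (bmeas_integrable ((P \x Q)%E : probability _ R) bf). Qed.

Lemma bmeas_pair1 x : bmeas (fun y => f (x, y)).
Proof.
by case: bf => mf [M hM]; split; [exact: measurableT_comp|exists M].
Qed.

Lemma bmeas_pair2 y : bmeas (fun x => f (x, y)).
Proof.
by case: bf => mf [M hM]; split; [exact: measurableT_comp|exists M].
Qed.

Let fubini_FE : (fun x => (\int[Q]_y f (x, y))%:E) = fubini_F Q (EFin \o f).
Proof.
apply/funext => x; rewrite /fubini_F /Rintegral fineK//.
exact: (integrable_fin_num _ (bmeas_integrable _ (bmeas_pair1 x))).
Qed.

Let fubini_GE : (fun y => (\int[P]_x f (x, y))%:E) = fubini_G P (EFin \o f).
Proof.
apply/funext => x; rewrite /fubini_G /Rintegral fineK//.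
exact: (integrable_fin_num _ (bmeas_integrable _ (bmeas_pair2 x))).
Qed.

Lemma Rintegral_prod : \int[(P \x Q)%E]_z f z = \int[P]_x \int[Q]_y f (x, y).
Proof.
rewrite /Rintegral; congr fine.
by rewrite -(integral12_prod_meas1 intf) -fubini_FE.
Qed.

Lemma Rintegral_swap :
  \int[P]_x \int[Q]_y f (x, y) = \int[Q]_y \int[P]_x f (x, y).
Proof.
rewrite -Rintegral_prod /Rintegral; congr fine.
by rewrite -(integral21_prod_meas1 intf) -fubini_GE.
Qed.

Lemma bmeas_Rintegral : bmeas (fun x => \int[Q]_y f (x, y)).
Proof.
split.
  apply/measurable_EFinP; rewrite [X in measurable_fun _ X]fubini_FE.
  exact: (measurable_fubini_F intf).
case: bf => mf [M hM]; exists M => x.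
have b := bmeas_integrable Q (bmeas_pair1 x).
rewrite (le_trans (le_normr_Rintegral _ b))//.
rewrite -[leRHS](@Rintegral_probability_cst _ _ _ Q); apply: le_Rintegral => //.
- exact: integrable_norm.
- exact/(bmeas_integrable Q)/bmeas_cst.
Qed.

End product.

End probability_integral.

(** * Finite quantizations *)

(** A finite measurable partition, encoded by its labelling map: refinement is then pairing, and a
    function constant on the cells is a composition. *)
Definition quantizer d (T : measurableType d) (I : finType) (q : T -> I) : Prop :=
  forall i, measurable (q @^-1` [set i]).

Section quantizer.
Context d (T : measurableType d) (R : realType).

Lemma quantizer_comp d' (T' : measurableType d') (I : finType) (q : T -> I) (U : T' -> T) :
  measurable_fun setT U -> quantizer q -> quantizer (fun x => q (U x)).
Proof. by move=> mU mq i; rewrite -[X in measurable X]setTI; exact: mU (mq i). Qed.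

Lemma quantizer_pair (I J : finType) (p : T -> I) (q : T -> J) :
  quantizer p -> quantizer q -> quantizer (fun x => (p x, q x)).
Proof.
move=> mp mq [i j].
rewrite (_ : _ @^-1` _ = (p @^-1` [set i]) `&` (q @^-1` [set j])); first exact: measurableI.
by apply/seteqP; split => x /= [-> ->].
Qed.

Lemma quantizer_ffun (J : finType) (I : finType) (q : J -> T -> I) :
  (forall j, quantizer (q j)) -> quantizer (fun x => [ffun j => q j x]).
Proof.
move=> mq f.
rewrite (_ : _ @^-1` _ = \bigcap_(j in [set: J]) (q j @^-1` [set f j])).
  by apply: fin_bigcap_measurable => [|j _]; [exact: finite_finset|exact: mq].
apply/seteqP; split => x /= h; first by move=> j _; rewrite /= -h ffunE.
by apply/ffunP => j; rewrite ffunE; exact: h.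
Qed.

(** The form in which integrals are split along cells: the label is constant on a cell, while [f]
    may still vary with the point. *)
Lemma quantizer_sum (I : finType) (q : T -> I) (f : I -> T -> R) x :
  f (q x) x = \sum_i \1_(q @^-1` [set i]) x * f i x.
Proof.
rewrite (bigD1 (q x))//= indicE mem_set// mul1r big1 ?addr0// => i /eqP iq.
by rewrite indicE memNset ?mul0r// => /esym.
Qed.

Lemma quantizer_sum2 (I J : finType) (p : T -> I) (q : T -> J) (f : I -> J -> T -> R) x :
  f (p x) (q x) x = \sum_i \sum_j \1_(p @^-1` [set i] `&` q @^-1` [set j]) x * f i j x.
Proof.
rewrite (quantizer_sum p (fun i x => f i (q x) x)); apply: eq_bigr => i _.
rewrite (quantizer_sum q (f i)) mulr_sumr; apply: eq_bigr => j _.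
by rewrite indicI mulrA.
Qed.

Lemma bmeas_quantizer (I : finType) (q : T -> I) (f : I -> T -> R) :
  quantizer q -> (forall i, bmeas (f i)) -> bmeas (fun x => f (q x) x).
Proof.
move=> mq bf; under eq_fun do rewrite quantizer_sum.
by apply: bmeas_sum => i _; apply: bmeasM => //; exact: bmeas_indic.
Qed.

(** Needed because the partitions in [quantized_cond_mutual_info] are indexed by ordinals. *)
Lemma quantizer_rank (I : finType) (q : T -> I) :
  quantizer q -> quantizer (fun x => enum_rank (q x)).
Proof.
move=> mq i; rewrite (_ : _ @^-1` _ = q @^-1` [set enum_val i]); first exact: mq.
apply/seteqP; split => x /=; first by move=> <-; rewrite enum_rankK.
by move=> ->; rewrite enum_valK.
Qed.

End quantizer.

(* The levels [c] depend only on the bound [M], so they can be shared by a family of functions. *)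
Lemma bounded_quantize (R : realType) (M e : R) : 0 < e ->
  exists N (c : 'I_N.+1 -> R), forall d (T : measurableType d) (f : T -> R),
  measurable_fun setT f -> (forall x, `|f x| <= M) ->
  exists q : T -> 'I_N.+1, quantizer q /\ forall x, c (q x) <= f x <= c (q x) + e.
Proof.
(* The interval from [-M] to [M] is cut into steps of length [e]; the label of [x] is the integer
   part of [(f x + M) / e], which is at most that of [2 * M / e]. *)
move=> e0; pose N := Num.truncn (2 * M / e).
pose c (k : 'I_N.+1) := k%:R * e - M.
exists N, c => d T f mf hM.
pose y x := (f x + M) / e.
have y0 x : 0 <= y x.
  by rewrite divr_ge0 ?(ltW e0)// -lerBlDr sub0r; have := hM x; rewrite ler_norml => /andP[].
have yN x : (Num.truncn (y x) < N.+1)%N.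
  rewrite ltnS le_truncn// ler_wpM2r ?invr_ge0 ?(ltW e0)//.
  by have := hM x; rewrite ler_norml => /andP[_ h]; lra.
pose q x : 'I_N.+1 := Ordinal (yN x).
have E k x : (q x == k) = (c k <= f x < c k + e).
  rewrite -val_eqE/= truncn_eq// /y ler_pdivlMr// ltr_pdivrMr// /c lerBlDr.
  have -> : k.+1%:R = k%:R + 1 :> R by rewrite -natr1.
  by rewrite mulrDl mul1r; congr (_ && _); rewrite addrAC ltrBrDr.
exists q; split; last by move=> x; have := E (q x) x; rewrite eqxx => /esym/andP[-> /ltW ->].
move=> k; rewrite (_ : _ @^-1` _ = setT `&` f @^-1` `[c k, c k + e[%classic); last first.
  by rewrite setTI; apply/seteqP; split => x /=; rewrite in_itv/= -E => /eqP.
by apply: mf => //; exact: measurable_itv.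
Qed.

Lemma bmeas_quantize d (T : measurableType d) (R : realType) (f : T -> R) (e : R) :
  bmeas f -> 0 < e -> exists N (q : T -> 'I_N.+1) (c : 'I_N.+1 -> R),
    quantizer q /\ forall x, c (q x) <= f x <= c (q x) + e.
Proof.
move=> [mf [M hM]] /(bounded_quantize M)[N [c]] /(_ _ _ _ mf hM)[q qP].
by exists N, q, c.
Qed.



Lemma clamp_le (R : realDomainType) (x M : R) : 0 <= M -> `|Num.max (- M) (Num.min x M)| <= M.
Proof.
move=> M0; rewrite ler_norml le_max lexx/= ge_max ge_min lexx orbT andbT.
by rewrite (le_trans _ M0)// oppr_le0.
Qed.

Lemma bmeas_section d1 d2 (T1 : measurableType d1) (T2 : measurableType d2) (R : realType)
  (I : finType) (q : T2 -> I) (G : I -> T1 -> R) :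
  quantizer q -> (forall i, bmeas (G i)) -> bmeas (fun z : (T1 * T2)%type => G (q z.2) z.1).
Proof.
move=> mq bG; apply: (@bmeas_quantizer _ _ _ _ (fun z : (T1 * T2)%type => q z.2) (fun i z => G i z.1)).
  exact: (quantizer_comp (@measurable_snd _ _ T1 T2) mq).
by move=> i; exact: (bmeas_comp (@measurable_fst _ _ T1 T2) (bG i)).
Qed.

(** * L1 approximation by functions of one coordinate and a quantization of the other *)

Section approximation.
Context d1 d2 (T1 : measurableType d1) (T2 : measurableType d2) (R : realType).
Variable mu : {finite_measure set (T1 * T2)%type -> \bar R}.
Implicit Types s : (T1 * T2)%type -> R.

(** Only the second coordinate is discretized; the first one will carry the conditioning variable
    and stays whole. *)
Let approximable s := forall e, 0 < e -> exists (I : finType) (q : T2 -> I) (G : I -> T1 -> R),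
  [/\ quantizer q, forall i, bmeas (G i) & \int[mu]_z `|s z - G (q z.2) z.1| <= e].

Let dist s1 s2 := \int[mu]_z `|s1 z - s2 z|.

Let dist_triangle s1 s2 s3 : bmeas s1 -> bmeas s2 -> bmeas s3 ->
  dist s1 s3 <= dist s1 s2 + dist s2 s3.
Proof.
move=> b1 b2 b3; have ib s s' : bmeas s -> bmeas s' -> Rintegrable mu (fun z => `|s z - s' z|).
  by move=> ? ?; exact/bmeas_integrable/bmeas_norm/bmeasB.
rewrite /dist -RintegralD//; [|exact: ib..].
apply: le_Rintegral => //; [exact: ib|by apply: RintegrableD; exact: ib|].
by move=> z _; exact: ler_distD.
Qed.

Let approximable_lim s : bmeas s ->
  (forall e, 0 < e -> exists s', [/\ bmeas s', approximable s' & dist s s' <= e]) ->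
  approximable s.
Proof.
move=> bs H e e0; have e2 : 0 < e / 2 by rewrite divr_gt0.
have [s' [bs' /(_ _ e2)[I [q [G [mq bG le]]]] le']] := H _ e2.
exists I, q, G; split => //.
apply: le_trans (dist_triangle bs bs' (bmeas_section mq bG)) _.
by rewrite [leRHS]splitr lerD.
Qed.

Let approximable_eq s s' : s =1 s' -> approximable s -> approximable s'.
Proof. by move/funext->. Qed.

Let approximableD s1 s2 : bmeas s1 -> bmeas s2 -> approximable s1 -> approximable s2 ->
  approximable (fun z => s1 z + s2 z).
Proof.
move=> b1 b2 a1 a2 e e0; have e2 : 0 < e / 2 by rewrite divr_gt0.
have [I1 [q1 [G1 [mq1 bG1 le1]]]] := a1 _ e2.
have [I2 [q2 [G2 [mq2 bG2 le2]]]] := a2 _ e2.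
exists (I1 * I2)%type, (fun x => (q1 x, q2 x)), (fun i x => G1 i.1 x + G2 i.2 x); split.
- exact: quantizer_pair.
- by move=> i; exact: bmeasD.
- rewrite [leRHS]splitr; apply: le_trans (lerD le1 le2).
  have bs1 := bmeas_section mq1 bG1; have bs2 := bmeas_section mq2 bG2.
  have h1 : Rintegrable mu (fun z => `|s1 z - G1 (q1 z.2) z.1|).
    exact/bmeas_integrable/bmeas_norm/bmeasB.
  have h2 : Rintegrable mu (fun z => `|s2 z - G2 (q2 z.2) z.1|).
    exact/bmeas_integrable/bmeas_norm/bmeasB.
  rewrite -RintegralD//; apply: le_Rintegral => //.
  + apply/bmeas_integrable/bmeas_norm/bmeasB; first exact: bmeasD.
    exact: bmeasD.
  + exact: RintegrableD.
  + move=> z _ /=; rewrite opprD addrACA; exact: ler_normD.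
Qed.

Let approximableZ c s : bmeas s -> approximable s -> approximable (fun z => c * s z).
Proof.
(* The added 1 keeps the divisor positive when [c] is 0. *)
move=> bs a e e0; have c1 : 0 < `|c| + 1 by rewrite ltr_wpDl.
have [I [q [G [mq bG le]]]] := a (e / (`|c| + 1)) (divr_gt0 e0 c1).
exists I, q, (fun i x => c * G i x); split => //.
  by move=> i; apply: bmeasM => //; exact: bmeas_cst.
have h : Rintegrable mu (fun z => `|s z - G (q z.2) z.1|).
  exact/bmeas_integrable/bmeas_norm/(bmeasB bs)/(bmeas_section mq bG).
under eq_Rintegral do rewrite -mulrBr normrM.
rewrite RintegralZl//; apply: (@le_trans _ _ ((`|c| + 1) * (e / (`|c| + 1)))).
  by rewrite ler_pM ?lerDl// Rintegral_ge0.
by rewrite mulrC divfK// gt_eqF.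
Qed.

Let approximable_rectangle (A : set T1) (B : set T2) : measurable A -> measurable B ->
  approximable (\1_(A `*` B)).
Proof.
move=> mA mB e e0.
exists bool, (fun x => x \in B), (fun (b : bool) x => b%:R * \1_A x); split.
- move=> [] /=.
    rewrite (_ : _ @^-1` _ = B)//; apply/seteqP; split => x /=; first by move/set_mem.
    exact: mem_set.
  rewrite (_ : _ @^-1` _ = ~` B); first exact: measurableC.
  apply/seteqP; split => x /=; first by move=> /negbT/negP h xB; apply: h; exact: mem_set.
  by move=> h; apply/negbTE/negP => /set_mem.
- by move=> b; apply: bmeasM; [exact: bmeas_cst|exact: bmeas_indic].
- under eq_Rintegral => z _.
    rewrite !indicE in_setX -mulnb natrM mulrC subrr normr0; over.
  by rewrite /Rintegral integral0 ltW.
Qed.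

Let approximable_sum (J : Type) (r : seq J) (F : J -> T1 * T2 -> R) :
  (forall j, bmeas (F j)) -> (forall j, approximable (F j)) ->
  approximable (fun z => \sum_(j <- r) F j z).
Proof.
move=> bF aF; elim: r => [|j r IH].
  apply: (@approximable_eq (fun z => 0 * \1_(set0 `*` set0) z)).
    by move=> z; rewrite big_nil mul0r.
  apply: approximableZ; last exact: approximable_rectangle.
  by apply: bmeas_indic; exact: measurableX.
apply: (@approximable_eq (fun z => F j z + \sum_(j <- r) F j z)).
  by move=> z; rewrite big_cons.
by apply: approximableD => //; apply: bmeas_sum => k _; exact: bF.
Qed.

(** Rectangles are stable under intersection and generate the product sigma-algebra, so a Dynkin
    argument applies: complements are handled by linearity, and countable disjoint unions are L1
    limits of finite sums because [mu] is finite. *)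
Let approximable_indic (A : set (T1 * T2)%type) : measurable A -> approximable (\1_A).
Proof.
rewrite [measurable]measurable_prod_measurableType.
apply: (@dynkin_induction _ _ _ (fun A => approximable (\1_A)) (measurable_prod_measurableType _ _)).
- move=> _ _ [A1 mA1 [B1 mB1 <-]] [A2 mA2 [B2 mB2 <-]]; exists (A1 `&` A2); first exact: measurableI.
  by exists (B1 `&` B2); [exact: measurableI|rewrite setXI].
- by rewrite -setXTT; exact: approximable_rectangle.
- by move=> _ [A1 mA1 [B1 mB1 <-]]; exact: approximable_rectangle.
- move=> S mS aS.
  apply: (@approximable_eq (fun z => 1 + (-1) * \1_S z)).
    by move=> z; rewrite indicC indicE; case: (z \in S); rewrite /= ?mulr1 ?subrr ?mulr0 ?addr0.
  apply: approximableD => //.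
  + exact: bmeas_cst.
  + by apply: bmeasM; [exact: bmeas_cst|exact: bmeas_indic].
  + apply: (@approximable_eq (\1_([set: T1] `*` [set: T2]))).
      by move=> z; rewrite setXTT indicT.
    exact: approximable_rectangle.
  + by apply: approximableZ => //; exact: bmeas_indic.
- move=> F mF tF aF; have mU : measurable (\bigcup_k F k) by exact: bigcup_measurable.
  apply: approximable_lim; first exact: bmeas_indic.
  move=> e e0.
  have : (\sum_(0 <= k < n) fine (mu (F k))) @[n --> \oo] --> fine (mu (\bigcup_k F k)).
    have := @measure_semi_sigma_additive _ _ _ mu F mF tF mU => H.
    suff /fine_cvg : (\sum_(0 <= k < n) fine (mu (F k)))%:E @[n --> \oo] --> (fine (mu (\bigcup_k F k)))%:E by [].
    rewrite fineK ?fin_num_measure//; apply: cvg_trans H; apply: near_eq_cvg; near=> n.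
    rewrite /= -sumEFin; apply: eq_bigr => k _; rewrite fineK// fin_num_measure//.
  move=> /cvgrPdist_le/(_ _ e0)[N _ /(_ N (leqnn N))/= HN].
  have bF k : bmeas (\1_(F k) : _ -> R) by exact: bmeas_indic.
  exists (fun z => \sum_(0 <= k < N) \1_(F k) z); split.
  + by apply: bmeas_sum => k _; exact: bF.
  + exact: approximable_sum.
  + have le z : \sum_(0 <= k < N) \1_(F k) z <= \1_(\bigcup_k F k) z :> R.
      rewrite -lee_fin indic_bigcup// -sumEFin; apply: nneseries_lim_ge.
      by move=> k _ _; rewrite lee_fin.
    rewrite /dist; under eq_Rintegral do rewrite ger0_norm ?subr_ge0//.
    rewrite RintegralB//; [|exact/bmeas_integrable/bmeas_indic|
      by apply: bmeas_integrable; apply: bmeas_sum => k _; exact: bF].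
    rewrite Rintegral_indic// Rintegral_sum; last by move=> k _; exact/bmeas_integrable/bF.
    under eq_bigr do rewrite Rintegral_indic//.
    exact: le_trans (ler_norm _) HN.
Unshelve. all: by end_near. Qed.

(** A bounded function is a uniform limit of simple ones. The approximant has to keep the bound [M],
    since its exponential is later controlled by [expR M]. *)
Lemma quantizer_approx s e M : bmeas s -> 0 <= M -> (forall z, `|s z| <= M) -> 0 < e ->
  exists (I : finType) (q : T2 -> I) (G : I -> T1 -> R),
  [/\ quantizer q, forall i, bmeas (G i), forall i x, `|G i x| <= M &
      \int[mu]_z `|s z - G (q z.2) z.1| <= e].
Proof.
move=> bs M0 sM e0.
have : approximable s.
  apply: approximable_lim => // {}e {}e0.
  pose m := fine (mu setT).
  have m1 : 0 < m + 1 by rewrite ltr_wpDl// fine_ge0.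
  have [N [q [c [mq cq]]]] := bmeas_quantize bs (divr_gt0 e0 m1).
  have bi k : bmeas (\1_(q @^-1` [set k]) : _ -> R) by exact: bmeas_indic.
  have bc : bmeas (fun z => \sum_k c k * \1_(q @^-1` [set k]) z).
    by apply: bmeas_sum => k _; apply: bmeasM => //; exact: bmeas_cst.
  exists (fun z => \sum_k c k * \1_(q @^-1` [set k]) z); split => //.
    have : forall k, approximable (fun z => c k * \1_(q @^-1` [set k]) z).
      by move=> k; apply: approximableZ => //; exact: approximable_indic.
    by move=> ak; apply: approximable_sum => // k; apply: bmeasM => //; exact: bmeas_cst.
  rewrite /dist.
  apply: (@le_trans _ _ (\int[mu]_z (e / (m + 1)))).
    apply: le_Rintegral => //.
    - exact/bmeas_integrable/bmeas_norm/bmeasB.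
    - exact/bmeas_integrable/bmeas_cst.
    - move=> z _; under eq_bigr do rewrite mulrC.
      rewrite -(quantizer_sum q (fun i z => c i)).
      by have /andP[h1 h2] := cq z; rewrite ger0_norm ?subr_ge0// lerBlDl.
  rewrite Rintegral_cst// -mulrA ler_piMr ?(ltW e0)// mulrC ler_pdivrMr// mul1r.
  by rewrite lerDl.
move=> /(_ _ e0)[I [q [G [mq bG le]]]].
(* Clamping restores the bound and does not increase the distance to [s], whose values already lie
   between [-M] and [M]. *)
exists I, q, (fun i x => Num.max (- M) (Num.min (G i x) M)); split => //.
- move=> i; split.
    have [mG _] := bG i.
    by apply: measurable_maxr => //; exact: measurable_minr.
  by exists M => x; exact: clamp_le.
- by move=> i x; exact: clamp_le.
apply: le_trans le; apply: le_Rintegral => //.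
- apply/bmeas_integrable/bmeas_norm/bmeasB => //; split.
    have [mG _] := bmeas_section mq bG.
    by apply: measurable_maxr => //; exact: measurable_minr.
  by exists M => x; exact: clamp_le.
- exact/bmeas_integrable/bmeas_norm/(bmeasB bs)/(bmeas_section mq bG).
move=> z _; move: (G _ _) (s z) (sM z) => g x; rewrite ler_norml => /andP[h1 h2].
rewrite maxEle minEle; have [gM|gM] := leP g M; have [h|h] // := leP (- M) _.
- by rewrite !ger0_norm; lra.
- by rewrite !ler0_norm; lra.
- lra.
Qed.

(** Approximations of single functions are merged by pairing their quantizers, so that one quantizer
    serves the whole family. *)
Lemma quantizer_approx_fin (J : finType) (s : J -> T1 * T2 -> R) e M :
  (forall j, bmeas (s j)) -> 0 <= M -> (forall j z, `|s j z| <= M) -> 0 < e ->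
  exists n (q : T2 -> 'I_n) (G : J -> 'I_n -> T1 -> R),
  [/\ quantizer q, forall j i, bmeas (G j i), forall j i x, `|G j i x| <= M &
      forall j, \int[mu]_z `|s j z - G j (q z.2) z.1| <= e].
Proof.
move=> bs M0 sM e0.
suff H (r : seq J) : exists (I : finType) (q : T2 -> I) (G : J -> I -> T1 -> R),
  [/\ quantizer q, forall j i, bmeas (G j i), forall j i x, `|G j i x| <= M &
      forall j, j \in r -> \int[mu]_z `|s j z - G j (q z.2) z.1| <= e].
  have [I [q [G [mq bG GM le]]]] := H (enum J).
  exists #|I|, (fun x => enum_rank (q x)), (fun j i => G j (enum_val i)).
  split => //; first exact: quantizer_rank.
  move=> j; under eq_Rintegral do rewrite enum_rankK.
  by apply: le; rewrite mem_enum.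
elim: r => [|a r [I [q [G [mq bG GM le]]]]].
  exists unit, (fun=> tt), (fun _ _ _ => 0); split => //.
  - move=> []; rewrite (_ : _ @^-1` _ = setT)//; exact/seteqP.
  - by move=> _ _; exact: bmeas_cst.
  - by move=> _ _ _; rewrite normr0.
have [I' [q' [G' [mq' bG' GM' le']]]] := quantizer_approx (bs a) M0 (sM a) e0.
exists (I * I')%type, (fun x => (q x, q' x)), (fun j i x => if j == a then G' i.2 x else G j i.1 x).
split.
- exact: quantizer_pair.
- by move=> j i; case: (j == a).
- by move=> j i x; case: (j == a).
- move=> j; rewrite in_cons; have [->//|ja /=] := eqVneq j a.
  exact: le.
Qed.

End approximation.

(** * Bounded versions of conditional expectations *)

Lemma Rintegral_eq0_ae d (T : measurableType d) (R : realType) (mu : {measure set T -> \bar R})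
  (f : T -> R) : Rintegrable mu f -> (forall x, 0 <= f x) -> \int[mu]_x f x <= 0 ->
  {ae mu, forall x, f x = 0}.
Proof.
move=> intf f0 If.
have E : (\int[mu]_x `|(f x)%:E| = 0)%E.
  under eq_integral do rewrite /= ger0_norm//.
  have h : (\int[mu]_x (f x)%:E)%E \is a fin_num by exact: integrable_fin_num.
  rewrite -(fineK h); congr EFin; apply/eqP; rewrite eq_le If/=.
  exact: Rintegral_ge0.
have mf : measurable_fun setT (EFin \o f) by exact: measurable_int intf.
have := (ae_eq_integral_abs mu measurableT mf).1 E.
by apply: filterS => x /= /(_ Logic.I)[].
Qed.

Section cond_version.
Context d d' (T : measurableType d) (T' : measurableType d') (R : realType)
  (P : probability T R).
Implicit Types (U : {mfun T >-> T'}) (f : T -> R) (g h : T' -> R).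

(* For integrable [f] this amounts to [is_cond_exp] with [g] bounded. *)
Definition cond_version (U : T -> T') (f : T -> R) (g : T' -> R) :=
  bmeas g /\ forall h, bmeas h -> \int[P]_w (f w * h (U w)) = \int[P]_w (g (U w) * h (U w)).

(** [is_cond_exp] only tests against events of [U]. By linearity the identity holds for simple
    multipliers, and a bounded [h] is uniformly close to a simple one; the error is weighted by the
    integral [m] of the absolute value of [phi]. *)
Lemma is_cond_exp_mul U f g h : Rintegrable P f -> is_cond_exp P U f g -> bmeas h ->
  \int[P]_w (f w * h (U w)) = \int[P]_w (g (U w) * h (U w)).
Proof.
move=> intf [mg intg fg] bh.
have mU : measurable_fun setT U by exact: measurable_funP.
pose phi w := f w - g (U w).
have iphi : Rintegrable P phi by exact: RintegrableB.
have bM (h' : T' -> R) (f' : T -> R) : bmeas h' -> Rintegrable P f' -> Rintegrable P (fun w => f' w * h' (U w)).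
  move=> bh' if'; under eq_fun do rewrite mulrC.
  exact: (RintegrableM (bmeas_comp mU bh')).
apply/eqP; rewrite -subr_eq0 -RintegralB//; [|exact: bM..].
under eq_Rintegral do rewrite -mulrBl -/(phi _).
rewrite -normr_le0; apply/ler_addgt0Pr => e e0; rewrite add0r.
pose m := \int[P]_w `|phi w|.
have m1 : 0 < m + 1 by rewrite ltr_wpDl// Rintegral_ge0.
have [N [q [c [mq cq]]]] := bmeas_quantize bh (divr_gt0 e0 m1).
have bc : bmeas (fun x => c (q x)).
  by apply: (bmeas_quantizer mq (f := fun i _ => c i)) => i; exact: bmeas_cst.
have c0 : \int[P]_w (phi w * c (q (U w))) = 0.
  have ik k : Rintegrable P (fun w => phi w * \1_(q @^-1` [set k]) (U w)).
    by apply: bM => //; exact: bmeas_indic.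
  have E k : \int[P]_w (c k * (phi w * \1_(q @^-1` [set k]) (U w))) = 0.
    have bi : bmeas (\1_(q @^-1` [set k]) : _ -> R) by exact: bmeas_indic.
    rewrite RintegralZl//.
    have mB : measurable (U @^-1` (q @^-1` [set k])).
      by rewrite -[X in measurable X]setTI; exact: mU.
    under eq_Rintegral do rewrite mulrBl.
    rewrite RintegralB//; [|exact: bM..].
    have I f' : \int[P]_w (f' w * \1_(q @^-1` [set k]) (U w)) = \int[P]_(w in U @^-1` (q @^-1` [set k])) f' w.
      by rewrite [RHS]Rintegral_mkcond; apply: eq_Rintegral => w _; rewrite patch_indic.
    by rewrite !I {1 2}/Rintegral fg// subrr mulr0.
  transitivity (\int[P]_w \sum_k (c k * (phi w * \1_(q @^-1` [set k]) (U w)))).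
    apply: eq_Rintegral => w _; rewrite (quantizer_sum q (fun i _ => c i)) mulr_sumr.
    by apply: eq_bigr => k _; ring.
  rewrite Rintegral_sum; first by rewrite big1.
  by move=> k _; apply: RintegrableZl; exact: ik.
rewrite -[X in `|X|]subr0 -[X in _ - X]c0 -RintegralB//; [|exact: (bM _ _ bh)|exact: (bM _ _ bc)].
under eq_Rintegral do rewrite -mulrBr.
have b2 : bmeas (fun x => h x - c (q x)) by exact: bmeasB.
rewrite (le_trans (le_normr_Rintegral _ (bM _ _ b2 iphi)))//.
apply: (@le_trans _ _ (\int[P]_w (e / (m + 1) * `|phi w|))).
  apply: le_Rintegral => //.
  - by apply: integrable_norm; exact: (bM _ _ b2 iphi).
  - by apply: RintegrableZl; exact: integrable_norm.
  - move=> w _; rewrite normrM mulrC ler_wpM2r//.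
    by have /andP[h1 h2] := cq (U w); rewrite ger0_norm ?subr_ge0// lerBlDl.
rewrite RintegralZl//; last exact: integrable_norm.
by rewrite -/m mulrAC ler_pdivrMr// ler_pM2l// lerDl.
Qed.


(** Tested against the indicator of [g < 0], the left side is nonnegative and the right side is
    minus the integral of the negative part of [g], which must therefore vanish. *)
Let mul_ge0_ae U f g : Rintegrable P f -> (forall w, 0 <= f w) ->
  measurable_fun setT g -> Rintegrable P (fun w => g (U w)) ->
  (forall h, bmeas h -> \int[P]_w (f w * h (U w)) = \int[P]_w (g (U w) * h (U w))) ->
  {ae P, forall w, 0 <= g (U w)}.
Proof.
move=> bf f0 mg ig fg.
have mU : measurable_fun setT U by exact: measurable_funP.
have mA : measurable (g @^-1` `]-oo, 0[%classic).
  by rewrite -[X in measurable X]setTI; apply: mg => //; exact: measurable_itv.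
pose h : T' -> R := \1_(g @^-1` `]-oo, 0[%classic).
have bh : bmeas h by exact: bmeas_indic.
have ghE w : - (g (U w) * h (U w)) = Num.max 0 (- g (U w)).
  rewrite /h indicE; have [g0|g0] := ltP (g (U w)) 0.
    by rewrite mem_set ?mulr1 ?max_r ?oppr_ge0 ?ltW//= in_itv/=.
  by rewrite memNset/= ?in_itv/= ?ltNge ?g0// mulr0 oppr0 max_l// oppr_le0.
have bgh : Rintegrable P (fun w => g (U w) * h (U w)).
  under eq_fun do rewrite mulrC.
  exact: (RintegrableM (bmeas_comp mU bh)).
have ae0 : {ae P, forall w, - (g (U w) * h (U w)) = 0}.
  apply: Rintegral_eq0_ae.
  - have := RintegrableZl (-1) bgh.
    by under eq_fun do rewrite mulN1r.
  - by move=> w; rewrite ghE le_max lexx.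
  - rewrite RintegralN//.
    by rewrite oppr_le0 -fg// Rintegral_ge0// => w _; rewrite mulr_ge0.
by apply: filterS ae0 => w; rewrite ghE => /eqP; rewrite eq_maxl oppr_le0.
Qed.

Lemma cond_version_ge0 U f g : bmeas f -> (forall w, 0 <= f w) ->
  cond_version U f g -> {ae P, forall w, 0 <= g (U w)}.
Proof.
move=> bf f0 [bg fg]; apply: mul_ge0_ae fg => //; [exact: bmeas_integrable|exact: bg.1|].
by apply/bmeas_integrable/bmeas_comp => //; exact: measurable_funP.
Qed.

Lemma cond_version_cst U c : cond_version U (fun=> c) (fun=> c).
Proof. by split => //; exact: bmeas_cst. Qed.

Lemma cond_version_sub U f1 f2 g1 g2 : bmeas f1 -> bmeas f2 ->
  cond_version U f1 g1 -> cond_version U f2 g2 ->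
  cond_version U (fun w => f1 w - f2 w) (fun x => g1 x - g2 x).
Proof.
move=> bf1 bf2 [bg1 fg1] [bg2 fg2]; split; first exact: bmeasB.
have mU : measurable_fun setT U by exact: measurable_funP.
move=> h bh; have bhU := bmeas_comp mU bh.
under eq_Rintegral do rewrite mulrBl.
under [RHS]eq_Rintegral do rewrite mulrBl.
rewrite !RintegralB//; try by apply: bmeas_integrable; apply: bmeasM => //; exact: (bmeas_comp mU).
by rewrite fg1// fg2.
Qed.

Lemma cond_version_sum U (I : finType) f (g : I -> T' -> R) (F : I -> T -> R) :
  (forall i, bmeas (F i)) -> (forall i, cond_version U (F i) (g i)) ->
  (forall w, f w = \sum_i F i w) ->
  cond_version U f (fun x => \sum_i g i x).
Proof.
move=> bF Fg fE; split; first by apply: bmeas_sum => i _; case: (Fg i).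
have mU : measurable_fun setT U by exact: measurable_funP.
move=> h bh; have bhU := bmeas_comp mU bh.
under eq_Rintegral do rewrite fE mulr_suml.
under [RHS]eq_Rintegral do rewrite mulr_suml.
rewrite !Rintegral_sum; first by apply: eq_bigr => i _; case: (Fg i) => _ ->.
- move=> i _; apply/bmeas_integrable/bmeasM => //; apply: (bmeas_comp mU).
  by case: (Fg i).
- by move=> i _; exact/bmeas_integrable/bmeasM.
Qed.

Lemma cond_version_le U f1 f2 g1 g2 : bmeas f1 -> bmeas f2 -> (forall w, f1 w <= f2 w) ->
  cond_version U f1 g1 -> cond_version U f2 g2 -> {ae P, forall w, g1 (U w) <= g2 (U w)}.
Proof.
move=> bf1 bf2 f12 v1 v2.
have p w : 0 <= f2 w - f1 w by rewrite subr_ge0.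
have := cond_version_ge0 (bmeasB bf2 bf1) p (cond_version_sub bf2 bf1 v2 v1).
by apply: filterS => w; rewrite subr_ge0.
Qed.

Lemma cond_version_eq U f1 f2 g1 g2 : bmeas f1 -> bmeas f2 -> (forall w, f1 w = f2 w) ->
  cond_version U f1 g1 -> cond_version U f2 g2 -> {ae P, forall w, g1 (U w) = g2 (U w)}.
Proof.
move=> bf1 bf2 f12 v1 v2.
have eqW (x y : R) : x = y -> x <= y by move=> ->.
have h1 := cond_version_le bf1 bf2 (fun w => eqW _ _ (f12 w)) v1 v2.
have h2 := cond_version_le bf2 bf1 (fun w => eqW _ _ (esym (f12 w))) v2 v1.
by move: h1 h2; apply: filterS2 => w h1 h2; apply/eqP; rewrite eq_le h1.
Qed.

(** The version chosen by [cond_exp] lies between 0 and 1 only almost surely. Clamping gives one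
    that does so everywhere, hence is bounded and can serve as a multiplier. *)
Lemma cond_prob_version U (A : set T) : measurable A ->
  exists g, [/\ cond_version U \1_A g, forall x, 0 <= g x <= 1 &
    {ae P, forall w, cond_prob P U A w = g (U w)}].
Proof.
move=> mA; have bA : bmeas (\1_A : T -> R) by exact: bmeas_indic.
have mU : measurable_fun setT U by exact: measurable_funP.
have [g gP E] := cond_expP U (bmeas_integrable P bA).
pose g' x := Num.max 0 (Num.min (g x) 1).
have mg : measurable_fun setT g by case: gP.
have intg : Rintegrable P (g \o U) by case: gP.
have g'01 x : 0 <= g' x <= 1.
  by rewrite /g' le_max lexx/= ge_max ler01 ge_min lexx orbT.
have bg' : bmeas g'.
  split; first by apply: measurable_maxr => //; exact: measurable_minr.
  by exists 1 => x; have /andP[? ?] := g'01 x; rewrite ger0_norm.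
have mulE h := @is_cond_exp_mul U _ _ h (bmeas_integrable P bA) gP.
have sgn (h : T' -> R) (B : set R) : measurable B -> bmeas (\1_(g @^-1` B) : T' -> R).
  by move=> mB; apply: bmeas_indic; rewrite -[X in measurable X]setTI; exact: mg.
have ae1 : {ae P, forall w, 0 <= g (U w)}.
  by apply: (mul_ge0_ae _ _ mg intg mulE) => //; exact: bmeas_integrable.
have ae2 : {ae P, forall w, g (U w) <= 1}.
  have i1 : Rintegrable P (fun w => 1 - \1_A w).
    by apply/bmeas_integrable/bmeasB => //; exact: bmeas_cst.
  have i2 : Rintegrable P (fun w => 1 - g (U w)).
    by apply: RintegrableB => //; apply/bmeas_integrable/bmeas_cst.
  have m2 : measurable_fun setT (fun x => 1 - g x) by exact: measurable_funB.
  have p2 w : 0 <= 1 - \1_A w :> R.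
    by rewrite subr_ge0 indicE; case: (_ \in _).
  have mulE2 h : bmeas h ->
      \int[P]_w ((1 - \1_A w) * h (U w)) = \int[P]_w ((1 - g (U w)) * h (U w)).
    move=> bh; have bhU := bmeas_comp mU bh.
    have j1 : Rintegrable P (fun w => \1_A w * h (U w)) by apply/bmeas_integrable/bmeasM.
    have j2 : Rintegrable P (fun w => g (U w) * h (U w)).
      by under eq_fun do rewrite mulrC; exact: (RintegrableM bhU).
    have j3 : Rintegrable P (fun w => h (U w)) by exact/bmeas_integrable.
    under eq_Rintegral do rewrite mulrBl mul1r.
    under [RHS]eq_Rintegral do rewrite mulrBl mul1r.
    by rewrite !RintegralB// mulE.
  by have := mul_ge0_ae i1 p2 m2 i2 mulE2; apply: filterS => w; rewrite subr_ge0.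
have aeE : {ae P, forall w, g (U w) = g' (U w)}.
  by move: ae1 ae2; apply: filterS2 => w h1 h2; rewrite /g' min_l// max_r.
exists g'; split => //.
  split => // h bh; rewrite mulE//; apply: ae_eq_Rintegral.
  - by apply: measurable_funM; [exact: measurableT_comp|exact: (bmeas_comp mU bh).1].
  - by apply: measurable_funM; [exact: (bmeas_comp mU bg').1|exact: (bmeas_comp mU bh).1].
  - by apply: filterS aeE => w ->.
by rewrite /cond_prob E; exact: aeE.
Qed.

End cond_version.

(** * Gibbs' inequality for the conditional mutual information *)

(** Measurability is imported from the real power function; squaring makes its base nonnegative, and
    the factor [x] restores the sign and the value 0 at 0. *)
Lemma measurable_invr (R : realType) : measurable_fun setT (fun x : R => x^-1).
Proof.
rewrite (_ : (fun x => _) = (fun x : R => x * (x ^+ 2) `^ (-1))); last first.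
  apply/funext => x; rewrite powR_inv1 ?sqr_ge0//.
  by have [->|x0] := eqVneq x 0; rewrite ?invr0 ?mul0r//; field.
apply: measurable_funM => //.
have m2 : measurable_fun setT (fun x : R => x ^+ 2) by exact: measurable_funX.
by apply: (@measurableT_comp _ _ _ _ _ _ (fun y : R => y `^ (-1)) _ (fun x : R => x ^+ 2)).
Qed.

Section gibbs.
Context {R : realType}.
Implicit Types p a b s : R.

(* The logarithm is below its tangent: [ln x <= x - 1] at [x = a b e^s / p]. *)
Lemma gibbs_le p a b s : 0 <= p -> p <= a -> p <= b ->
  p * s <= p * ln (p / (a * b)) + a * b * expR s - p.
Proof.
move=> p0 pa pb; have a0 := le_trans p0 pa; have b0 := le_trans p0 pb.
have [->|pN0] := eqVneq p 0.
  by rewrite !mul0r add0r subr0 !mulr_ge0 ?expR_ge0.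
have pp : 0 < p by rewrite lt_def pN0.
have ap := lt_le_trans pp pa; have bp := lt_le_trans pp pb.
have q0 : 0 < p / (a * b) by rewrite divr_gt0// mulr_gt0.
have := expR_ge1Dx (s - ln (p / (a * b))).
rewrite expRD expRN lnK ?posrE// invf_div => h.
have : p * (1 + (s - ln (p / (a * b)))) <= p * (expR s * (a * b / p)) by rewrite ler_pM2l.
have -> : p * (expR s * (a * b / p)) = a * b * expR s by field.
by lra.
Qed.

(** Gives integrability of the information terms. The lower bound is [gibbs_le] at [s = 0]; the
    upper one follows from [1 + ln x <= x], since [p] is below both [a] and [b]. *)
Lemma info_bounded p a b : 0 <= p -> p <= a -> p <= b -> a <= 1 -> b <= 1 ->
  `|p * ln (p / (a * b))| <= 1.
Proof.
move=> p0 pa pb a1 b1; have a0 := le_trans p0 pa; have b0 := le_trans p0 pb.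
have := gibbs_le 0 p0 pa pb; rewrite mulr0 expR0 mulr1 => h1.
have ab1 : a * b <= 1 by rewrite mulr_ile1.
rewrite ler_norml; apply/andP; split; first lra.
have [->|pN0] := eqVneq p 0; first by rewrite mul0r.
have pp : 0 < p by rewrite lt_def pN0.
have ap := lt_le_trans pp pa; have bp := lt_le_trans pp pb.
have q0 : 0 < p / (a * b) by rewrite divr_gt0// mulr_gt0.
have := expR_ge1Dx (ln (p / (a * b))); rewrite lnK ?posrE// => h2.
have h3 : p * ln (p / (a * b)) <= p * (p / (a * b)).
  by rewrite ler_pM2l//; lra.
apply: le_trans h3 _.
by rewrite mulrA ler_pdivrMr ?mulr_gt0// mul1r ler_pM.
Qed.

End gibbs.

Section quantized_info.
Context d dA dB dC (T : measurableType d) (TA : measurableType dA)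
  (TB : measurableType dB) (TC : measurableType dC) (R : realType) (P : probability T R).
Context (A : {mfun T >-> TA}) (B : {mfun T >-> TB}) (C : {mfun T >-> TC}).
Context (n m : nat) (qa : TA -> 'I_n) (qb : TB -> 'I_m).
Hypotheses (mqa : quantizer qa) (mqb : quantizer qb).
Let ca i := A @^-1` (qa @^-1` [set i]).
Let cb j := B @^-1` (qb @^-1` [set j]).
Let mca i : measurable (ca i).
Proof. by rewrite -[X in measurable X]setTI; exact: (measurable_funP A). Qed.
Let mcb j : measurable (cb j).
Proof. by rewrite -[X in measurable X]setTI; exact: (measurable_funP B). Qed.
Let mC : measurable_fun setT C. Proof. exact: measurable_funP. Qed.

Lemma quantizer_partition d' (T' : measurableType d') N (q : T' -> 'I_N) :
  quantizer q -> measurable_partition (fun i => q @^-1` [set i]).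
Proof.
move=> mq; split => //.
- by apply/trivIsetP => i j _ _ ij; apply/seteqP; split => x //= -[xi xj]; move/eqP: ij; apply; rewrite -xi -xj.
- by apply/seteqP; split => x // _; exists (q x).
Qed.

(** [gibbs_le] is applied cell by cell to the conditional probabilities given [C] and then
    integrated. On the right, [B] is replaced by a copy that is conditionally independent of [A]
    given [C]. The versions [b] are supplied from outside, so that a test function may be normalized
    against them beforehand. *)
Lemma quantized_info_gibbs (b : 'I_m -> TC -> R) (s : 'I_n -> 'I_m -> TC -> R) (r : R) :
  (forall j x, 0 <= b j x <= 1) ->
  (forall j, cond_version P C \1_(cb j) (b j)) ->
  (forall j, {ae P, forall w, cond_prob P C (cb j) w = b j (C w)}) ->
  (forall i j, bmeas (s i j)) ->
  (cond_mutual_info P A B C <= r%:E)%E ->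
  \int[P]_w s (qa (A w)) (qb (B w)) (C w) <=
  r + \int[P]_w (\sum_j b j (C w) * expR (s (qa (A w)) j (C w))) - 1.
Proof.
move=> b01 bv bae bs cmi.
have /choice[a Ha] := fun i => cond_prob_version P C (mca i).
have mcab i j : measurable (ca i `&` cb j) by exact: measurableI.
have /choice[p Hp] := fun ij : 'I_n * 'I_m => cond_prob_version P C (mcab ij.1 ij.2).
have av i : cond_version P C \1_(ca i) (a i) by case: (Ha i).
have pv i j : cond_version P C \1_(ca i `&` cb j) (p (i, j)) by case: (Hp (i, j)).
have bi (D : set T) : measurable D -> bmeas (\1_D : T -> R) by exact: bmeas_indic.
have ba i : bmeas (fun w => a i (C w)) by apply: (bmeas_comp mC); case: (av i).
have bb j : bmeas (fun w => b j (C w)) by apply: (bmeas_comp mC); case: (bv j).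
have bp i j : bmeas (fun w => p (i, j) (C w)) by apply: (bmeas_comp mC); case: (pv i j).
have bsC i j : bmeas (fun w => s i j (C w)) by exact: (bmeas_comp mC).
have pa i j : {ae P, forall w, p (i, j) (C w) <= a i (C w)}.
  apply: cond_version_le (pv i j) (av i); [exact: bi|exact: bi|].
  by move=> w; rewrite !indicE in_setI; case: (_ \in ca _); case: (_ \in cb _); rewrite //= ler01.
have pb i j : {ae P, forall w, p (i, j) (C w) <= b j (C w)}.
  apply: cond_version_le (pv i j) (bv j); [exact: bi|exact: bi|].
  by move=> w; rewrite !indicE in_setI; case: (_ \in ca _); case: (_ \in cb _); rewrite //= ler01.
pose info i j w := p (i, j) (C w) * ln (p (i, j) (C w) / (a i (C w) * b j (C w))).
have minfo i j : measurable_fun setT (info i j).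
  apply: measurable_funM; first by case: (bp i j).
  apply: measurableT_comp => //; apply: measurable_funM; first by case: (bp i j).
  by apply: measurableT_comp; [exact: measurable_invr|case: (bmeasM (ba i) (bb j))].
have iinfo i j : Rintegrable P (info i j).
  (* The terms [info i j] are bounded by 1 only almost surely, because [p <= a] and [p <= b] hold
     only almost surely; hence the comparison with a truncation. *)
  pose f w := Num.max (- 1) (Num.min (info i j w) 1).
  apply: (@Rintegrable_ae _ _ _ _ f) => //.
    apply: bmeas_integrable; split.
      by apply: measurable_maxr => //; exact: measurable_minr.
    by exists 1 => w; exact: clamp_le.
  move: (pa i j) (pb i j); apply: filterS2 => w h1 h2.
  have [_ p01 _] := Hp (i, j); have /andP[p0 _] := p01 (C w).
  have [_ a01 _] := Ha i; have /andP[_ a1] := a01 (C w).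
  have /andP[_ b1] := b01 j (C w).
  have := info_bounded p0 h1 h2 a1 b1; rewrite -/(info i j w) ler_norml => /andP[l1 l2].
  by rewrite /f min_l// max_r.
have sum2 (f : 'I_n -> 'I_m -> T -> R) w :
    f (qa (A w)) (qb (B w)) w = \sum_i \sum_j \1_(ca i `&` cb j) w * f i j w.
  exact: (quantizer_sum2 (fun w => qa (A w)) (fun w => qb (B w))).
have E1 : \int[P]_w s (qa (A w)) (qb (B w)) (C w) =
    \int[P]_w (\sum_i \sum_j p (i, j) (C w) * s i j (C w)).
  under eq_Rintegral do rewrite (sum2 (fun i j w => s i j (C w))).
  rewrite !Rintegral_sum2; last 2 first.
  - by move=> i j; exact/bmeas_integrable/bmeasM.
  - by move=> i j; apply/bmeas_integrable/bmeasM => //; apply: bi; exact: mcab.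
  by apply: eq_bigr => i _; apply: eq_bigr => j _; case: (pv i j) => _ ->.
have E2 : \int[P]_w (\sum_j b j (C w) * expR (s (qa (A w)) j (C w))) =
    \int[P]_w (\sum_i \sum_j a i (C w) * b j (C w) * expR (s i j (C w))).
  under eq_Rintegral => w _.
    rewrite (quantizer_sum (fun w => qa (A w)) (fun i w => \sum_j b j (C w) * expR (s i j (C w)))).
    under eq_bigr do rewrite mulr_sumr. over.
  rewrite !Rintegral_sum2; last 2 first.
  - by move=> i j; apply/bmeas_integrable/bmeasM; [exact: bmeasM|exact: bmeas_expR].
  - move=> i j; apply/bmeas_integrable/bmeasM; first by apply: bi; exact: mca.
    by apply: bmeasM => //; exact: bmeas_expR.
  apply: eq_bigr => i _; apply: eq_bigr => j _; case: (av i) => _ /(_ (fun x => b j x * expR (s i j x))).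
  rewrite -/(ca i) => ->; first by apply: eq_Rintegral => w _; rewrite mulrA.
  by apply: bmeasM; [case: (bv j)|exact: bmeas_expR].
have E3 : 1 = \int[P]_w (\sum_i \sum_j p (i, j) (C w)).
  rewrite -[LHS](Rintegral_probability_cst P).
  transitivity (\int[P]_w (\sum_i \sum_j \1_(ca i `&` cb j) w * 1)).
    by apply: eq_Rintegral => w _; rewrite -(sum2 (fun _ _ _ => 1)).
  rewrite !Rintegral_sum2; last 2 first.
  - move=> i j; apply/bmeas_integrable/bmeasM; last exact: bmeas_cst.
    by apply: bi; exact: mcab.
  - by move=> i j; apply: bmeas_integrable; exact: bp.
  apply: eq_bigr => i _; apply: eq_bigr => j _; case: (pv i j) => _ /(_ _ (bmeas_cst _ 1)) ->.
  by apply: eq_Rintegral => w _; rewrite mulr1.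
(* The hypothesis on the mutual information enters here, through the partitions into cells of [qa]
   and [qb]. *)
have E4 : \int[P]_w (\sum_i \sum_j info i j w) <= r.
  have : (quantized_cond_mutual_info P A B C (fun i => qa @^-1` [set i]) (fun j => qb @^-1` [set j]) <= r%:E)%E.
    apply: le_trans cmi; apply: ereal_sup_ubound; exists n, m; eexists; eexists.
    by split; [exact: quantizer_partition mqa|exact: quantizer_partition mqb|].
  rewrite -lee_fin /quantized_cond_mutual_info/= unlock => /(le_trans _); apply.
  rewrite /Rintegral fineK; last first.
    by apply: integrable_fin_num => //; apply: Rintegrable_sum => i _; exact: Rintegrable_sum.
  rewrite le_eqVlt; apply/orP; left; apply/eqP.
  have mcp D : measurable D -> measurable_fun setT (cond_prob P C D).
    move=> mD; have [g [mg _ _] E] := cond_expP C (bmeas_integrable P (bi _ mD)).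
    by rewrite /cond_prob E; exact: measurableT_comp.
  apply: ae_eq_integral => //.
  - apply/measurable_EFinP; apply: measurable_sum => i; apply: measurable_sum => j; exact: minfo.
  - apply/measurable_EFinP; apply: measurable_sum => i; apply: measurable_sum => j.
    apply: measurable_funM; first by apply: mcp; exact: mcab.
    apply: measurableT_comp => //; apply: measurable_funM; first by apply: mcp; exact: mcab.
    apply: measurableT_comp; first exact: measurable_invr.
    by apply: measurable_funM; apply: mcp; [exact: mca|exact: mcb].
  - have aA : {ae P, forall w, forall i, cond_prob P C (ca i) w = a i (C w)}.
      by apply: filter_forall => i; case: (Ha i).
    have aB : {ae P, forall w, forall j, cond_prob P C (cb j) w = b j (C w)}.
      exact: filter_forall.
    have aP : {ae P, forall w, forall ij, cond_prob P C (ca ij.1 `&` cb ij.2) w = p ij (C w)}.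
      by apply: filter_forall => ij; case: (Hp ij).
    move: aA aB aP; apply: filterS3 => w hA hB hP _ /=; congr EFin.
    apply: eq_bigr => i _; apply: eq_bigr => j _.
    by rewrite /info -hA -hB -(hP (i, j)).
have iI : Rintegrable P (fun w => \sum_i \sum_j info i j w).
  by apply: Rintegrable_sum => i _; exact: Rintegrable_sum.
have b2 (f : 'I_n -> 'I_m -> T -> R) : (forall i j, bmeas (f i j)) ->
    Rintegrable P (fun w => \sum_i \sum_j f i j w).
  by move=> bf; apply/bmeas_integrable/bmeas_sum => i _; apply: bmeas_sum.
have iabe : Rintegrable P (fun w => \sum_i \sum_j a i (C w) * b j (C w) * expR (s i j (C w))).
  by apply: b2 => i j; apply: bmeasM; [exact: bmeasM|exact: bmeas_expR].
have ip := b2 _ bp.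
have ips : Rintegrable P (fun w => \sum_i \sum_j p (i, j) (C w) * s i j (C w)).
  by apply: b2 => i j; exact: bmeasM.
rewrite E1 E2 [X in _ - X]E3.
apply: (@le_trans _ _ (\int[P]_w (\sum_i \sum_j info i j w) +
  \int[P]_w (\sum_i \sum_j a i (C w) * b j (C w) * expR (s i j (C w))) -
  \int[P]_w (\sum_i \sum_j p (i, j) (C w)))); last by rewrite lerD2r lerD2r.
rewrite -RintegralD// -RintegralB//; last exact: RintegrableD.
apply: ae_le_Rintegral => //; first by apply: RintegrableB => //; exact: RintegrableD.
have aPA : {ae P, forall w, forall ij, p ij (C w) <= a ij.1 (C w)}.
  by apply: filter_forall => -[i j]; exact: pa.
have aPB : {ae P, forall w, forall ij, p ij (C w) <= b ij.2 (C w)}.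
  by apply: filter_forall => -[i j]; exact: pb.
move: aPA aPB; apply: filterS2 => w hA hB.
rewrite -big_split -sumrB; apply: ler_sum => i _.
rewrite -big_split -sumrB; apply: ler_sum => j _.
have [_ p01 _] := Hp (i, j); have /andP[p0 _] := p01 (C w).
exact: (gibbs_le _ p0 (hA (i, j)) (hB (i, j))).
Qed.

End quantized_info.

(** * Gaussian integrals *)

Section normal_integral.
Context {R : realType}.
Variables (m s : R).
Hypothesis s0 : s != 0.
Notation mu := (@lebesgue_measure R).
Notation nu := (normal_prob m s).

(** Both functions have the same integral over every measurable set. *)
Let normal_density :
  ae_eq mu setT (Radon_Nikodym_SigmaFinite.f nu mu) (EFin \o normal_pdf m s).
Proof.
apply: integral_ae_eq => //=.
- by apply: Radon_Nikodym_SigmaFinite.f_integrable; exact: normal_prob_dominates.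
- by apply/measurableT_comp => //; exact: measurable_normal_pdf.
- move=> E _ mE; rewrite -Radon_Nikodym_SigmaFinite.f_integral//.
  exact: normal_prob_dominates.
Qed.

Lemma ge0_integral_normal (f : R -> \bar R) : (forall x, 0 <= f x)%E ->
  measurable_fun setT f ->
  (\int[nu]_x f x = \int[mu]_x (f x * (normal_pdf m s x)%:E))%E.
Proof.
move=> f0 mf.
rewrite -(Radon_Nikodym_SigmaFinite.change_of_variables (@normal_prob_dominates R m s))//.
apply: ae_eq_integral => //.
- apply: emeasurable_funM => //; apply: (measurable_int mu).
  by apply: Radon_Nikodym_SigmaFinite.f_integrable; exact: normal_prob_dominates.
- apply: emeasurable_funM => //; apply/measurableT_comp => //.
  exact: measurable_normal_pdf.
- by apply: ae_eqe_mul2l; exact: normal_density.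
Qed.

Lemma Rintegrable_normal (f : R -> R) : measurable_fun setT f ->
  Rintegrable mu (fun x => f x * normal_pdf m s x) -> Rintegrable nu f.
Proof.
move=> mf /integrableP[mfp intfp]; apply/integrableP; split; first exact/measurable_EFinP.
rewrite ge0_integral_normal//; last by do 2 apply: measurableT_comp => //; exact/measurable_EFinP.
apply: le_lt_trans intfp; rewrite le_eqVlt; apply/orP; left; apply/eqP.
apply: eq_integral => x _ /=; rewrite normrM EFinM; congr (_ * _)%E.
by rewrite ger0_norm// normal_pdf_ge0.
Qed.

Lemma Rintegral_normal (f : R -> R) : Rintegrable nu f ->
  \int[nu]_x f x = \int[mu]_x (f x * normal_pdf m s x).
Proof.
move=> intf; rewrite /Rintegral; congr fine.
have mf := Rintegrable_meas intf.
rewrite integralE [RHS]integralE; congr (_ - _)%E.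
  rewrite ge0_integral_normal//; last exact/measurable_funepos/measurable_EFinP.
  apply: eq_integral => x _; rewrite !funeposE/=.
  by rewrite -!EFin_max -EFinM maxr_pMl ?mul0r// normal_pdf_ge0.
rewrite ge0_integral_normal//; last exact/measurable_funeneg/measurable_EFinP.
apply: eq_integral => x _; rewrite !funenegE/=.
by rewrite -!EFin_max -EFinM maxr_pMl ?mul0r ?mulNr// normal_pdf_ge0.
Qed.

End normal_integral.

(** The fundamental theorem of calculus on symmetric intervals of half-length [n.+1]: the boundary
    values vanish in the limit, and the integrals converge by domination by the absolute value of
    [f]. *)
Lemma Rintegral_derivative_eq0 (R : realType) (F f : R -> R) (e : nat -> R) :
  (forall x, is_derive x (1 : R) F (f x)) -> continuous f ->
  Rintegrable (@lebesgue_measure R) f ->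
  (forall n, `|F n.+1%:R| <= e n) -> (forall n, `|F (- n.+1%:R)| <= e n) ->
  e @ \oo --> 0 -> \int[@lebesgue_measure R]_x f x = 0.
Proof.
move=> dF cf intf Fe Fe' e0.
set mu := (@lebesgue_measure R).
have cF : continuous F.
  by move=> x; apply/differentiable_continuous/derivable1_diffP; case: (dF x).
pose D n := `[- n.+1%:R, n.+1%:R]%classic : set R.
have mf := measurable_int _ intf.
have DC := @dominated_convergence _ _ R mu setT measurableT
  (fun n x => (f x * \1_(D n) x)%:E) (EFin \o f) (abse \o (EFin \o f)).
have E n : (\int[mu]_x (f x * \1_(D n) x)%:E = (F n.+1%:R - F (- n.+1%:R))%:E)%E.
  transitivity (\int[mu]_(x in D n) (f x)%:E)%E.
    by rewrite [RHS]integral_mkcond; apply: eq_integral => x _; rewrite restrict_EFin patch_indic.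
  rewrite (@continuous_FTC2 _ f F)//.
  - by rewrite -subr_gt0 opprK addr_gt0.
  - exact: continuous_subspaceT.
  - split.
    + by move=> x _; case: (dF x).
    + by apply: cvg_at_right_filter; exact: cF.
    + by apply: cvg_at_left_filter; exact: cF.
  - by move=> x _; rewrite derive1E; apply: (@derive_val _ _ _ _ _ _ _ (dF x)).
have {DC}[|||||_ _ H] := DC.
- move=> n; apply/measurable_EFinP/measurable_funM; first exact/measurable_EFinP.
  by apply: measurable_indic; exact: measurable_itv.
- exact: mf.
- apply: aeW => x _; apply: cvg_near_cst.
  near=> n; rewrite indicE mem_set ?mulr1//.
  rewrite /D/= in_itv/= -ler_norml; near: n.
  exists (Num.truncn `|x|) => // n /= xn.
  rewrite (le_trans (ltW (truncnS_gt _)))// ler_nat ltnS//.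
- exact: integrable_abse.
- apply: aeW => x n _; rewrite lee_fin normrM ler_piMr// indicE.
  by case: (_ \in _); rewrite ?normr1 ?normr0.
have {}H : (F n.+1%:R - F (- n.+1%:R)) @[n --> \oo] --> \int[mu]_x f x.
  suff /fine_cvg : (F n.+1%:R - F (- n.+1%:R))%:E @[n --> \oo] --> (\int[mu]_x f x)%:E by [].
  rewrite /Rintegral fineK; last exact: integrable_fin_num.
  by apply: cvg_trans H; apply: near_eq_cvg; near=> n; rewrite /= E.
apply/esym; apply: (cvg_unique _ _ H) => //=.
apply: norm_cvg0.
apply: (@squeeze_cvgr _ _ _ _ (fun=> 0) (fun n => e n + e n)).
- near=> n; rewrite normr_ge0/= (le_trans (ler_normB _ _))// lerD//.
- exact: cvg_cst.
- by rewrite -(addr0 0); apply: cvgD.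
Unshelve. all: by end_near. Qed.

(** * The standard normal law: moments, integration by parts, characteristic function *)

Section standard_normal.
Context {R : realType}.
Notation mu := (@lebesgue_measure R).
Notation nu := (@normal_prob R 0 1).
Notation phi := (@normal_pdf R 0 1).

Let c : R := normal_peak (1 : R).

Lemma std_normal_pdfE x : phi x = c * expR (- (x ^+ 2 / 2)).
Proof. by rewrite normal_pdfE ?oner_eq0// /normal_fun subr0 expr1n mulNr. Qed.

Let c0 : 0 < c. Proof. by apply: normal_peak_gt0; rewrite oner_eq0. Qed.

(** The dominating function is a multiple of the normal density of variance 2. One half of the
    exponent absorbs the polynomial: [1 + x ^+ 2] is at most 4 times [1 + x ^+ 2 / 4], which is at
    most 4 times [expR (x ^+ 2 / 4)]. *)
Lemma Rintegrable_sqr_pdf : Rintegrable mu (fun x => (1 + x ^+ 2) * phi x).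
Proof.
pose k := normal_peak (Num.sqrt 2 : R).
have k0 : 0 < k by apply: normal_peak_gt0; rewrite gt_eqF// sqrtr_gt0.
apply: (@le_Rintegrable _ _ _ mu _ (fun x => (4 * c / k) * normal_pdf 0 (Num.sqrt 2) x)); last first.
- by apply: RintegrableZl; exact: integrable_normal_pdf.
- move=> x; rewrite ger0_norm; last by rewrite mulr_ge0 ?normal_pdf_ge0// addr_ge0// sqr_ge0.
  rewrite std_normal_pdfE normal_pdfE ?gt_eqF ?sqrtr_gt0// /normal_fun subr0 sqr_sqrtr//.
  rewrite -/k.
  have -> : 4 * c / k * (k * expR (- x ^+ 2 / (2 *+ 2))) = c * (4 * expR (- (x ^+ 2 / 4))).
    have -> : - x ^+ 2 / (2 *+ 2) = - (x ^+ 2 / 4) by field.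
    by field; rewrite gt_eqF.
  have -> : expR (- (x ^+ 2 / 2)) = expR (- (x ^+ 2 / 4)) * expR (- (x ^+ 2 / 4)).
    by rewrite -expRD; congr expR; field.
  have h : (1 + x ^+ 2 / 4) * expR (- (x ^+ 2 / 4)) <= 1.
    by rewrite expRN ler_pdivrMr ?expR_gt0// mul1r expR_ge1Dx.
  have e0 := expR_gt0 (- (x ^+ 2 / 4)).
  have x2 := sqr_ge0 x.
  move: (expR _) e0 h => E e0 h; move: c c0 => C C0.
  rewrite mulrCA ler_pM2l// mulrA ler_pM2r//.
  apply: le_trans (_ : 4 * ((1 + x ^+ 2 / 4) * E) <= _); last by lra.
  nra.
- apply: measurable_funM; last exact: measurable_normal_pdf.
  by apply: measurable_funD => //; exact: measurable_funX.
Qed.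

(** Shows that a function of linear growth times the density decays like the inverse of the distance
    to 0, which removes the boundary terms in [std_normal_ibp]. The exponential is split into two
    halves, one for each linear factor; the constant is not sharp. *)
Lemma std_normal_tail x : (1 + `|x|) * phi x * `|x| <= 8 * c.
Proof.
rewrite std_normal_pdfE.
have -> : expR (- (x ^+ 2 / 2)) = expR (- (x ^+ 2 / 4)) * expR (- (x ^+ 2 / 4)).
  by rewrite -expRD; congr expR; field.
have h : (1 + x ^+ 2 / 4) * expR (- (x ^+ 2 / 4)) <= 1.
  by rewrite expRN ler_pdivrMr ?expR_gt0// mul1r expR_ge1Dx.
have e0 := expR_gt0 (- (x ^+ 2 / 4)).
rewrite -(real_normK (num_real x)) in e0 h *.
move: (expR _) e0 h (normr_ge0 x) => E e0; move: `|x| c c0 => y C C0 h y0.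
have p1 : 0 <= y ^+ 2 * E by rewrite mulr_ge0 ?sqr_ge0 ?(ltW e0).
have p2 : 0 <= (1 - y) ^+ 2 * E by rewrite mulr_ge0 ?sqr_ge0 ?(ltW e0).
have h1 : (1 + y) * E <= 2 by lra.
have h2 : y * E <= 2 by lra.
have h4 : 0 <= y * E by rewrite mulr_ge0// ltW.
have h3 : 0 <= (1 + y) * E by rewrite mulr_ge0 ?addr_ge0 ?(ltW e0).
have h5 : (1 + y) * E * (y * E) <= 2 * 2 by rewrite ler_pM.
have -> : (1 + y) * (C * (E * E)) * y = C * ((1 + y) * E * (y * E)) by ring.
by rewrite mulrC ler_pM2r//; lra.
Qed.

Lemma Rintegrable_std_normal (f : R -> R) a : measurable_fun setT f ->
  (forall x, `|f x| <= a * (1 + x ^+ 2)) -> Rintegrable nu f.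
Proof.
move=> mf fa; apply: Rintegrable_normal => //.
apply: (@le_Rintegrable _ _ _ mu _ (fun x => a * ((1 + x ^+ 2) * phi x))).
- by apply: measurable_funM => //; exact: measurable_normal_pdf.
- move=> x; rewrite normrM (ger0_norm (normal_pdf_ge0 _ _ _)) mulrA.
  by rewrite ler_wpM2r// normal_pdf_ge0.
- by apply: RintegrableZl; exact: Rintegrable_sqr_pdf.
Qed.

Lemma is_derive_std_normal_pdf x : is_derive x (1 : R) phi (- x * phi x).
Proof.
have -> : phi = (fun x => c * expR (- (x ^+ 2 / 2))).
  by apply/funext => y; rewrite std_normal_pdfE.
apply: is_derive_eq.
by rewrite /GRing.scale/=; field.
Qed.

Let cvg_tail : (8 * c / n.+1%:R) @[n --> \oo] --> (0 : R).
Proof.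
rewrite -[X in _ --> X](mulr0 (8 * c)); apply: cvgM; first exact: cvg_cst.
exact: cvg_harmonic.
Qed.

(** Stein's identity: the derivative of [u * phi] is [(u' - x * u) * phi], and its integral is 0. *)
Lemma std_normal_ibp (u u' : R -> R) a :
  (forall x, is_derive x (1 : R) u (u' x)) -> continuous u' ->
  (forall x, `|u x| <= a * (1 + `|x|)) -> (forall x, `|u' x| <= a) ->
  \int[nu]_x (x * u x) = \int[nu]_x u' x.
Proof.
move=> du cu' ua u'a.
have a0 : 0 <= a by rewrite (le_trans _ (u'a 0)).
have cu : continuous u.
  by move=> x; apply/differentiable_continuous/derivable1_diffP; case: (du x).
have cphi : continuous phi by apply: continuous_normal_pdf; exact: oner_neq0.
have mu_ : measurable_fun setT u by exact: continuous_measurable_fun.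
have mu'_ : measurable_fun setT u' by exact: continuous_measurable_fun.
have i1 : Rintegrable nu (fun x => x * u x).
  apply: (@Rintegrable_std_normal _ (2 * a)); first exact: measurable_funM.
  move=> x; rewrite normrM; apply: (@le_trans _ _ (`|x| * (a * (1 + `|x|)))).
    by rewrite ler_wpM2l.
  rewrite -(real_normK (num_real x)); move: `|x| (normr_ge0 x) => y y0.
  rewrite mulrCA -mulrA [2 * (a * _)]mulrCA ler_wpM2l//.
  by have := sqr_ge0 (y - 1); lra.
have i2 : Rintegrable nu u'.
  apply: (@Rintegrable_std_normal _ a) => // x; apply: (le_trans (u'a x)).
  by rewrite ler_peMr// lerDl sqr_ge0.
apply/eqP; rewrite eq_sym -subr_eq0; apply/eqP.
rewrite -RintegralB//.
have i3 := RintegrableB i2 i1.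
rewrite Rintegral_normal ?oner_neq0//.
have tail x : `|x| * `|u x * phi x| <= a * (8 * c).
  rewrite normrM (ger0_norm (normal_pdf_ge0 _ _ _)).
  apply: (@le_trans _ _ (a * ((1 + `|x|) * phi x * `|x|))); last by rewrite ler_wpM2l// std_normal_tail.
  by rewrite mulrC 2!mulrA ler_wpM2r// ler_wpM2r ?normal_pdf_ge0//.
apply: (@Rintegral_derivative_eq0 _ (fun x => u x * phi x) _ (fun n => a * (8 * c / n.+1%:R))).
- move=> x; have h := is_deriveM (du x) (is_derive_std_normal_pdf x).
  by apply: is_derive_eq; rewrite /GRing.scale/=; ring.
- move=> x; apply: cvgM; last exact: cphi.
  by apply: cvgB; [exact: cu'|apply: cvgM; [exact: cvg_id|exact: cu]].
- apply: (@le_Rintegrable _ _ _ mu _ (fun x => 3 * a * ((1 + x ^+ 2) * phi x))).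
  + apply: measurable_funM; last exact: measurable_normal_pdf.
    by apply: measurable_funB => //; exact: measurable_funM.
  + move=> x; rewrite normrM (ger0_norm (normal_pdf_ge0 _ _ _)) mulrA.
    rewrite ler_wpM2r ?normal_pdf_ge0// (le_trans (ler_normB _ _))//.
    have := u'a x; have := ua x; rewrite normrM -(real_normK (num_real x)).
    move: `|u x| (normr_ge0 (u x)) `|u' x| => v v0 v' vv vv'.
    move: `|x| (normr_ge0 x) vv => y y0 vv.
    have h1 : y * v <= y * (a * (1 + y)) by rewrite ler_wpM2l.
    have h2 : 0 <= a * (y - 1) ^+ 2 by rewrite mulr_ge0 ?sqr_ge0.
    have h3 : 0 <= a * y ^+ 2 by rewrite mulr_ge0 ?sqr_ge0.
    nra.
  + by apply: RintegrableZl; exact: Rintegrable_sqr_pdf.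
- move=> n; have h := tail n.+1%:R; rewrite ger0_norm// in h.
  by rewrite mulrA ler_pdivlMr ?ltr0n// mulrC.
- move=> n; have h := tail (- n.+1%:R); rewrite normrN ger0_norm// in h.
  by rewrite mulrA ler_pdivlMr ?ltr0n// mulrC.
- rewrite -(mulr0 a); apply: cvgM; [exact: cvg_cst|exact: cvg_tail].
Qed.

Lemma std_normal_sqr : Rintegrable nu (fun x => x ^+ 2) /\ \int[nu]_x (x ^+ 2) = 1.
Proof.
split.
  apply: (@Rintegrable_std_normal _ 1); first exact: measurable_funX.
  by move=> x; rewrite mul1r ger0_norm ?sqr_ge0// lerDr.
rewrite (@std_normal_ibp id (fun=> 1) 1).
- exact: Rintegral_probability_cst.
- by move=> x; exact: cvg_cst.
- by move=> x; rewrite mul1r lerDr.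
- by move=> x; rewrite normr1.
Qed.

(** Differentiating [h] under the integral and applying Stein's identity to [sin (t * x + th)] gives
    [h' = - t * h]. Hence [h t * expR (t ^+ 2 / 2)] is constant, equal to [cos th] at 0. The phase
    [th] covers the real and imaginary parts of the characteristic function together. *)
Lemma std_normal_char (t th : R) :
  \int[nu]_x cos (t * x + th) = expR (- (t ^+ 2 / 2)) * cos th.
Proof.
pose h t := \int[nu]_x cos (t * x + th).
have dcos x s : is_derive s (1 : R) (fun s => cos (s * x + th)) (- x * sin (s * x + th)).
  by apply: is_derive_eq; rewrite /GRing.scale/=; ring.
have dcos2 s x : is_derive x (1 : R) (fun x => sin (s * x + th)) (s * cos (s * x + th)).
  by apply: is_derive_eq; rewrite /GRing.scale/=; ring.
have mlin s : measurable_fun setT (fun x : R => s * x + th).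
  by apply: measurable_funD => //; apply: measurable_funM.
have icos s : Rintegrable nu (fun x => cos (s * x + th)).
  by apply: bmeas_integrable; apply: bmeas_cos; exact: mlin.
have dh s : is_derive s (1 : R) h (- s * h s).
  have I : [set` `]s - 1, s + 1[%R] s by rewrite /= in_itv/= ltrBlDr ltrDl ltr01.
  have d1 x y : partial1of2 (fun t x => cos (t * x + th)) x y = - y * sin (x * y + th).
    by rewrite partial1of2E; apply: (@derive_val _ _ _ _ _ _ _ (dcos y x)).
  have A1 : forall x, [set` `]s - 1, s + 1[%R] x -> Rintegrable nu (fun y => cos (x * y + th)) by [].
  have A2 : forall x y : R, [set` `]s - 1, s + 1[%R] x -> setT y -> derivable (fun z : R^o => cos ((z : R) * y + th) : R^o) x 1.
    by move=> x y _ _; case: (dcos y x).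
  have A3 : forall y : R, 0 <= `|y| by [].
  have A4 : Rintegrable nu (fun x : R => `|x|).
    apply: (@Rintegrable_std_normal _ 1); first exact: measurableT_comp.
    move=> x; rewrite normr_id mul1r -(real_normK (num_real x)).
    by have := sqr_ge0 (`|x| - 1); have := normr_ge0 x; lra.
  have A5 : forall x y : R, [set` `]s - 1, s + 1[%R] x -> setT y ->
      `|partial1of2 (fun t x => cos (t * x + th)) x y| <= `|y|.
    move=> x y _ _; rewrite d1 normrM normrN ler_piMr// ler_norml.
    by rewrite sin_geN1 sin_le1.
  have D := derivable_under_integral measurableT I A1 A2 A3 A4 A5.
  apply: DeriveDef; first exact: D.
  rewrite -derive1E (differentiation_under_integral measurableT I A1 A2 A3 A4 A5).
  under eq_Rintegral do rewrite d1 mulNr.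
  have i1 : Rintegrable nu (fun x => x * sin (s * x + th)).
    apply: (@le_Rintegrable _ _ _ nu _ (fun x => `|x|)) => //.
    - apply: measurable_funM => //; apply: measurableT_comp; last exact: mlin.
      by apply: continuous_measurable_fun; exact: continuous_sin.
    - by move=> x; rewrite normrM ler_piMr// ler_norml sin_geN1 sin_le1.
  rewrite RintegralN// mulNr; congr (- _).
  rewrite (@std_normal_ibp _ (fun x => s * cos (s * x + th)) (1 + `|s|)).
  - by rewrite RintegralZl.
  - move=> x; apply: cvgM; first exact: cvg_cst.
    apply: (@continuous_comp _ _ _ (fun x => s * x + th) cos); last exact: continuous_cos.
    by apply: cvgD; [apply: cvgM; [exact: cvg_cst|exact: cvg_id]|exact: cvg_cst].
  - move=> x; apply: (@le_trans _ _ 1); first by rewrite ler_norml sin_geN1 sin_le1.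
    by have := normr_ge0 s; have := normr_ge0 x; nra.
  - move=> x; rewrite normrM; apply: (@le_trans _ _ `|s|); last by rewrite lerDr.
    by rewrite ler_piMr// ler_norml cos_geN1 cos_le1.
pose q t := h t * expR (t ^+ 2 / 2).
have dq s : is_derive s (1 : R) q 0.
  have d2 : is_derive s (1 : R) (fun t : R => expR (t ^+ 2 / 2)) (s * expR (s ^+ 2 / 2)).
    by apply: is_derive_eq; rewrite /GRing.scale/=; field.
  have := is_deriveM (dh s) d2.
  rewrite (_ : _ + _ = 0)//; by rewrite /GRing.scale/=; ring.
have := is_derive_0_is_cst t 0 dq; rewrite /q expr0n/= mul0r expR0 mulr1.
rewrite {2}/h; under [X in _ = X]eq_Rintegral do rewrite mul0r add0r.
rewrite Rintegral_probability_cst => <-; rewrite mulrC -mulrA -expRD subrr expR0 mulr1//.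
Qed.

End standard_normal.

(** * Normal densities relative to the standard normal law, as mixtures of cosines *)

Section gauss_bump.
Context {R : realType}.
Notation nu := (@normal_prob R 0 1).

(* The density of N(n, d) with respect to the standard normal law. *)
Definition gauss_bump (d n y : R) : R := expR (- (ln d / 2) - (y - n) ^+ 2 / (2 * d) + y ^+ 2 / 2).

Variables (d n : R).
Hypothesis d01 : 0 < d < 1.

(** Completing the square in the exponent of [gauss_bump]: [p] is the maximum point, [C] the maximal
    value, and [kappa] a genuine square root because [d < 1]. *)
Let kappa := Num.sqrt (d^-1 - 1).
Let p := n / (1 - d).
Let C := expR (- (ln d / 2) + n ^+ 2 / (2 * (1 - d))).

Let d0 : 0 < d. Proof. by case/andP : d01. Qed.
Let d1 : 0 < 1 - d. Proof. by case/andP : d01; rewrite subr_gt0. Qed.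
Let kappaE : kappa ^+ 2 = d^-1 - 1.
Proof. by rewrite sqr_sqrtr// subr_ge0 invf_ge1// ltW//; case/andP : d01. Qed.

Let gauss_bumpE y : gauss_bump d n y = C * expR (- ((kappa * (y - p)) ^+ 2 / 2)).
Proof.
rewrite -expRD /gauss_bump; congr expR; rewrite exprMn kappaE /p.
by field; rewrite !gt_eqF.
Qed.

Lemma measurable_gauss_bump : measurable_fun setT (gauss_bump d n).
Proof.
apply: measurableT_comp => //; apply: measurable_funD.
  apply: measurable_funB => //; apply: measurable_funM => //; apply: measurable_funX.
  exact: measurable_funB.
by apply: measurable_funM => //; exact: measurable_funX.
Qed.

Lemma bmeas_gauss_bump : bmeas (gauss_bump d n).
Proof.
split; first exact: measurable_gauss_bump.
exists C => y; rewrite ger0_norm ?expR_ge0// gauss_bumpE ler_piMr ?expR_ge0//.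
by rewrite -expR0 ler_expR oppr_le0 divr_ge0// sqr_ge0.
Qed.

Lemma Rintegral_gauss_bump : \int[nu]_y gauss_bump d n y = 1.
Proof.
rewrite Rintegral_normal//; last by apply: bmeas_integrable; exact: bmeas_gauss_bump.
rewrite /Rintegral -[RHS]/(fine 1%:E) -(integral_normal_pdf n (Num.sqrt d)).
congr fine; apply: eq_integral => y _; congr EFin.
rewrite std_normal_pdfE normal_pdfE ?gt_eqF ?sqrtr_gt0//.
rewrite /normal_peak /normal_fun sqr_sqrtr ?(ltW d0)// expr1n mul1r.
have E : expR (- (ln d / 2)) = (Num.sqrt d)^-1.
  rewrite expRN; congr (_^-1).
  have h : expR (ln d / 2) ^+ 2 = d.
    by rewrite -expRM_natl mulrC divfK// lnK// posrE.
  by rewrite -[in RHS]h sqrtr_sqr ger0_norm// expR_ge0.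
have -> : d * pi *+ 2 = d * (pi *+ 2) by ring.
rewrite [Num.sqrt (d * _)]sqrtrM ?(ltW d0)// invfM -E /gauss_bump.
rewrite mulrCA -expRD [in RHS]mulrAC -[in RHS]expRD [RHS]mulrC; congr (_ * expR _).
by field; rewrite gt_eqF.
Qed.

(** By [std_normal_char] with phase 0, a centered Gaussian function is itself an average of cosines
    over a normal frequency [s]. The second identity is the total mass 1 of the bump, rewritten by
    exchanging the integrals over [y] and [s]. *)
Lemma gauss_bump_mixture : exists c k q : R,
  (forall y, gauss_bump d n y = \int[nu]_s (c * cos (k * (y - q) * s))) /\
  \int[nu]_s (c * (expR (- ((k * s) ^+ 2 / 2)) * cos (k * q * s))) = 1.
Proof.
have E y : gauss_bump d n y = \int[nu]_s (C * cos (kappa * (y - p) * s)).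
  rewrite gauss_bumpE RintegralZl//; last first.
    by apply: bmeas_integrable; apply: bmeas_cos; exact: measurable_funM.
  have := std_normal_char (kappa * (y - p)) 0; rewrite cos0 mulr1 => <-.
  by congr (_ * _); under eq_Rintegral do rewrite addr0.
exists C, kappa, p; split => //.
rewrite -[RHS]Rintegral_gauss_bump; under [in RHS]eq_Rintegral do rewrite E.
have b : bmeas (fun z : R * R => C * cos (kappa * (z.1 - p) * z.2)).
  apply: bmeasM; first exact: bmeas_cst.
  apply: bmeas_cos; apply: measurable_funM => //; apply: measurable_funM => //.
  exact: measurable_funB.
rewrite (Rintegral_swap nu nu b)/=; apply: eq_Rintegral => s _.
rewrite RintegralZl//; last first.
  apply: bmeas_integrable; apply: bmeas_cos.
  apply: measurable_funM => //; apply: measurable_funM => //; exact: measurable_funB.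
congr (_ * _).
rewrite -cosN -(std_normal_char (kappa * s)); apply: eq_Rintegral => y _.
by congr cos; ring.
Qed.

End gauss_bump.

(** * Expectation of a product of relative densities from the characteristic function alone *)

Section gauss_bump_product.
Context d (T : measurableType d) (R : realType) (P : probability T R).
Context (I : finType) (Y : I -> T -> R).
Hypothesis mY : forall i, measurable_fun setT (Y i).
Hypothesis charY : forall (t : I -> R) th,
  \int[P]_w cos (\sum_i t i * Y i w + th) = expR (- (\sum_i t i ^+ 2 / 2)) * cos th.
Context (v n : I -> R).
Hypothesis v01 : forall i, 0 < v i < 1.
Notation nu := (@normal_prob R 0 1).

Let mlin d' (T' : measurableType d') (t : I -> T' -> R) (Z : I -> T' -> R) :
  (forall i, measurable_fun setT (t i)) -> (forall i, measurable_fun setT (Z i)) ->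
  measurable_fun setT (fun w => \sum_i t i w * Z i w).
Proof. by move=> mt mZ; apply: measurable_sum => i; exact: measurable_funM. Qed.

(** The cosine factor makes the induction go through: expanding one bump into cosines shifts the
    frequency in its own direction, where [t] was 0, and the remaining product has the same shape.
    With all bumps expanded, only [charY] is left to use. *)
Let bump_prod_cos (s : seq I) : uniq s -> forall t th, (forall i, i \in s -> t i = 0) ->
  \int[P]_w (\prod_(i <- s) gauss_bump (v i) (n i) (Y i w) * cos (\sum_i t i * Y i w + th)) =
  expR (- (\sum_i t i ^+ 2 / 2)) * cos th.
Proof.
elim: s => [_ t th _|a s IH /= /andP[aNs us] t th t0].
  by rewrite -charY; apply: eq_Rintegral => w _; rewrite big_nil mul1r.
have [c [k [q [bE b1]]]] := gauss_bump_mixture (n a) (v01 a).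
pose t' x i := if i == a then x else t i.
have ta : t a = 0 by apply: t0; rewrite mem_head.
have t'Y x w : \sum_i t' x i * Y i w = \sum_i t i * Y i w + x * Y a w.
  rewrite (bigD1 a)//= [in RHS](bigD1 a)//= ta mul0r add0r addrC /t' eqxx.
  by congr (_ + _); apply: eq_bigr => i /negbTE ->.
have t'2 x : \sum_i t' x i ^+ 2 / 2 = \sum_i t i ^+ 2 / 2 + x ^+ 2 / 2.
  rewrite (bigD1 a)//= [in RHS](bigD1 a)//= ta expr0n/= mul0r add0r addrC /t' eqxx.
  by congr (_ + _); apply: eq_bigr => i /negbTE ->.
pose pr w := \prod_(i <- s) gauss_bump (v i) (n i) (Y i w).
have bpr : bmeas pr.
  by apply: bmeas_prod => i _; apply: bmeas_comp => //; exact: bmeas_gauss_bump.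
pose S w := \sum_i t i * Y i w + th.
have mS : measurable_fun setT S by apply: measurable_funD => //; exact: mlin.
pose g (z : T * R) := c * (pr z.1 * (cos (k * (Y a z.1 - q) * z.2) * cos (S z.1))).
have m1 : measurable_fun setT (fst : T * R -> T) by exact: measurable_fst.
have m2 : measurable_fun setT (snd : T * R -> R) by exact: measurable_snd.
have bg : bmeas g.
  apply: bmeasM; first exact: bmeas_cst.
  apply: bmeasM; first exact: (bmeas_comp m1 bpr).
  apply: bmeasM; apply: bmeas_cos; last exact: (measurableT_comp mS m1).
  apply: measurable_funM => //; apply: measurable_funM => //.
  by apply: measurable_funB => //; exact: measurableT_comp.
have -> : \int[P]_w (\prod_(i <- a :: s) gauss_bump (v i) (n i) (Y i w) * cos (S w)) =
    \int[P]_w \int[nu]_x g (w, x).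
  apply: eq_Rintegral => w _; rewrite big_cons bE /g/=.
  rewrite -mulrA -RintegralZr//; last first.
    apply: bmeas_integrable; apply: bmeasM; first exact: bmeas_cst.
    by apply: bmeas_cos; exact: measurable_funM.
  by apply: eq_Rintegral => x _; rewrite -/(pr w); ring.
rewrite (Rintegral_swap P nu bg).
rewrite -[RHS]mul1r -[X in _ = X * _]b1 -RintegralZr//; last first.
  apply: bmeas_integrable; apply: bmeasM; first exact: bmeas_cst.
  apply: bmeasM; last by apply: bmeas_cos; exact: measurable_funM.
  split.
    apply: measurableT_comp => //; apply: measurable_funN.
    by apply: measurable_funM => //; apply: measurable_funX; exact: measurable_funM.
  exists 1 => x; rewrite ger0_norm ?expR_ge0// -[leRHS]expR0 ler_expR oppr_le0.
  by rewrite divr_ge0 ?sqr_ge0.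
apply: eq_Rintegral => x _; rewrite /g/=.
pose h y th' w := pr w * cos (\sum_i t' y i * Y i w + th').
have bh y th' : bmeas (h y th').
  by apply: bmeasM => //; apply: bmeas_cos; apply: measurable_funD => //; exact: mlin.
(* A product of two cosines is half the sum of the cosines of the sum and the difference; each of
   these is an instance of the induction hypothesis, with frequency [k * x] or its opposite in
   direction [a]. *)
transitivity (\int[P]_w (c / 2 * (h (k * x) (th - k * q * x) w + h (- (k * x)) (th + k * q * x) w))).
  apply: eq_Rintegral => w _; rewrite /h !t'Y.
  have -> : \sum_i t i * Y i w + k * x * Y a w + (th - k * q * x) = S w + k * (Y a w - q) * x.
    by rewrite /S; ring.
  have -> : \sum_i t i * Y i w + - (k * x) * Y a w + (th + k * q * x) = S w - k * (Y a w - q) * x.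
    by rewrite /S; ring.
  by move: (S w) (k * _ * x) => A B; rewrite cosD cosB; field.
rewrite RintegralZl//; last by apply: bmeas_integrable; exact: bmeasD.
rewrite RintegralD//; [|by apply: bmeas_integrable; exact: bh..].
have t'0 y i : i \in s -> t' y i = 0.
  move=> si; rewrite /t'; case: eqP => [ia|_]; first by rewrite -ia si in aNs.
  by apply: t0; rewrite in_cons si orbT.
rewrite !IH//; [|by move=> i; exact: t'0..].
by rewrite !t'2 sqrrN opprD !expRD cosB cosD; field.
Qed.

Lemma Rintegral_gauss_bump_prod : \int[P]_w \prod_i gauss_bump (v i) (n i) (Y i w) = 1.
Proof.
have := @bump_prod_cos (index_enum I) (index_enum_uniq I) (fun=> 0) 0 (fun _ _ => erefl).
rewrite (_ : \sum_i _ = 0); last by rewrite big1// => i _; rewrite expr0n/= mul0r.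
rewrite oppr0 expR0 cos0 mulr1 => E; rewrite -[RHS]E; apply: eq_Rintegral => w _.
by rewrite (_ : \sum_i _ = 0) ?add0r ?cos0 ?mulr1// big1// => i _; rewrite mul0r.
Qed.

End gauss_bump_product.

(** * Growth of the information along the Markov chain *)

(** The tangent of the exponential at [x]; only [x], later the approximant, has to be bounded. *)
Lemma expR_lip (R : realType) (M x y : R) : x <= M -> expR x <= expR y + expR M * `|y - x|.
Proof.
move=> xM; have := expR_ge1Dx (y - x); rewrite expRD expRN => h.
have : expR x * (1 + (y - x)) <= expR x * (expR y * (expR x)^-1) by rewrite ler_pM2l ?expR_gt0.
have -> : expR x * (expR y * (expR x)^-1) = expR y by rewrite mulrCA divff ?mulr1// gt_eqF ?expR_gt0.
have h1 : expR x * (x - y) <= expR M * `|y - x|.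
  apply: (@le_trans _ _ (expR x * `|y - x|)).
    by rewrite ler_wpM2l ?expR_ge0// distrC ler_norm.
  by rewrite ler_wpM2r// ler_expR.
lra.
Qed.

(** Jensen's inequality: the tangent inequalities at the mean [s] are averaged, and their linear
    parts cancel. *)
Lemma expR_convex_sum (R : realType) (I : finType) (a t : I -> R) :
  (forall i, 0 <= a i) -> \sum_i a i = 1 ->
  expR (\sum_i a i * t i) <= \sum_i a i * expR (t i).
Proof.
move=> a0 a1; set s := \sum_i a i * t i.
have -> : expR s = \sum_i a i * (expR s * (1 + (t i - s))).
  under eq_bigr => i _ do rewrite mulrCA mulrDr mulr1 mulrBr.
  rewrite -mulr_sumr big_split/= a1 sumrB -/s -mulr_suml a1 mul1r subrr addr0 mulr1//.
apply: ler_sum => i _; rewrite ler_wpM2l//.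
have := expR_ge1Dx (t i - s); rewrite expRD expRN => h.
have : expR s * (1 + (t i - s)) <= expR s * (expR (t i) * (expR s)^-1) by rewrite ler_pM2l ?expR_gt0.
by rewrite mulrCA divff ?mulr1// gt_eqF ?expR_gt0.
Qed.

(** * Data processing: test functions of the source become test functions of the data *)

Section data_processing.
Context d dX dZ dH dH' (T : measurableType d) (TX : measurableType dX)
  (TZ : measurableType dZ) (TH : measurableType dH) (TH' : measurableType dH')
  (R : realType) (P : probability T R).
Context (X : {mfun T >-> TX}) (Z : {mfun T >-> TZ}) (H : {mfun T >-> TH}) (H' : {mfun T >-> TH'}).
Hypothesis markov : markov_chain P X (fun w => (H w, Z w)) H'.
Variable r : R.
Hypothesis cmi : (cond_mutual_info P Z H' H <= r%:E)%E.
Context (I : finType) (phi : TX -> I) (m : nat) (eta : TH' -> 'I_m).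
Hypotheses (mphi : quantizer phi) (meta : quantizer eta).
Context (b : 'I_m -> TH -> R) (t : I -> 'I_m -> TH -> R).
Hypothesis b01 : forall j x, 0 <= b j x <= 1.
Hypothesis bv : forall j, cond_version P H \1_(H' @^-1` (eta @^-1` [set j])) (b j).
Hypothesis bae : forall j, {ae P, forall w, cond_prob P H (H' @^-1` (eta @^-1` [set j])) w = b j (H w)}.
Hypothesis bt : forall i j, bmeas (t i j).
Hypothesis bt1 : forall i x, \sum_j b j x * expR (t i j x) <= 1.

Let mHZ : measurable_fun setT (fun w => (H w, Z w)).
Proof. by apply: measurable_fun_pair; exact: measurable_funP. Qed.

Let C : {mfun T >-> (TH * TZ)%type} := HB.pack_for {mfun T >-> (TH * TZ)%type}
  (fun w => (H w, Z w)) (isMeasurableFun.Build _ _ _ _ _ mHZ).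

Let ca i := X @^-1` (phi @^-1` [set i]).
Let cb j := H' @^-1` (eta @^-1` [set j]).
Let mca i : measurable (ca i).
Proof. by rewrite -[X in measurable X]setTI; exact: (measurable_funP X). Qed.
Let mcb j : measurable (cb j).
Proof. by rewrite -[X in measurable X]setTI; exact: (measurable_funP H'). Qed.
Let bi (D : set T) : measurable D -> bmeas (\1_D : T -> R).
Proof. exact: bmeas_indic. Qed.
Let mH : measurable_fun setT H. Proof. exact: measurable_funP. Qed.
Let mC : measurable_fun setT C. Proof. exact: measurable_funP. Qed.

(** The function [t] is normalized given [H] by [bt1]. Averaging it over [X] given [(H, Z)] yields
    [s j], a function of [(H, Z)]: the Markov property preserves the expectation and convexity the
    normalization. Then [s] is an admissible test function for the pair [Z], [H'] given [H], up to
    quantizing [Z]. *)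
Lemma data_processing : \int[P]_w t (phi (X w)) (eta (H' w)) (H w) <= r.
Proof.
have /choice[al Hal] := fun i => cond_prob_version P C (mca i).
have /choice[be Hbe] := fun j => cond_prob_version P C (mcb j).
have mcab i j : measurable (ca i `&` cb j) by exact: measurableI.
have /choice[g Hg] := fun ij : I * 'I_m => cond_prob_version P C (mcab ij.1 ij.2).
have alv i : cond_version P C \1_(ca i) (al i) by case: (Hal i).
have bev j : cond_version P C \1_(cb j) (be j) by case: (Hbe j).
have bal i : bmeas (al i) by case: (alv i).
have bbe j : bmeas (be j) by case: (bev j).
have al01 i x : 0 <= al i x <= 1 by case: (Hal i).
have be01 j x : 0 <= be j x <= 1 by case: (Hbe j).
have btC i j : bmeas (fun x : TH * TZ => t i j x.1).
  exact: (bmeas_comp (@measurable_fst _ _ TH TZ) (bt i j)).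
have btH i j : bmeas (fun w => t i j (C w).1) by exact: (bmeas_comp mH (bt i j)).
pose s j (x : TH * TZ) := \sum_i al i x * t i j x.1.
have bs j : bmeas (s j) by apply: bmeas_sum => i _; exact: bmeasM.
have bC (f : TH * TZ -> R) : bmeas f -> bmeas (fun w => f (C w)) by exact: bmeas_comp.
have E1 : \int[P]_w t (phi (X w)) (eta (H' w)) (H w) =
    \sum_j \int[P]_w (\1_(cb j) w * s j (C w)).
  transitivity (\int[P]_w \sum_i \sum_j (\1_(ca i `&` cb j) w * t i j (C w).1)).
    apply: eq_Rintegral => w _.
    exact: (quantizer_sum2 (fun w => phi (X w)) (fun w => eta (H' w)) (fun i j w => t i j (H w))).
  rewrite Rintegral_sum2; last first.
    by move=> i j; apply/bmeas_integrable/bmeasM; [apply: bi; exact: mcab|exact: btH].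
  rewrite exchange_big/=; apply: eq_bigr => j _.
  have [_ ->//] := bev j.
  rewrite -Rintegral_sum; last first.
    move=> i _; apply/bmeas_integrable/bmeasM; [apply: bi; exact: mcab|exact: btH].
  (* Conditional independence is used here: given [(H, Z)] the probability of the joint cell is the
     product of those of the two cells. *)
  have E i : \int[P]_w (\1_(ca i `&` cb j) w * t i j (C w).1) =
      \int[P]_w (be j (C w) * (al i (C w) * t i j (C w).1)).
    have [[bg gE] _ gae] := Hg (i, j).
    rewrite (gE _ (btC i j)); apply: ae_eq_Rintegral.
    - by case: (bmeasM (bC _ bg) (btH i j)).
    - by case: (bmeasM (bC _ (bbe j)) (bmeasM (bC _ (bal i)) (btH i j))).
    - have [_ _ alae] := Hal i; have [_ _ beae] := Hbe j.
      have := markov (mphi i) (meta j).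
      move: gae alae beae => /= gae alae beae mk.
      near=> w.
      rewrite -(near gae w)//; rewrite (near mk w)//.
      rewrite (near alae w)// (near beae w)//; ring.
  transitivity (\sum_i \int[P]_w (\1_(ca i `&` cb j) w * t i j (C w).1)).
    rewrite Rintegral_sum//.
    by move=> i _; apply/bmeas_integrable/bmeasM; [apply: bi; exact: mcab|exact: btH].
  have bac i : bmeas (fun w => be j (C w) * (al i (C w) * t i j (C w).1)).
    by apply: bmeasM; [exact: (bC _ (bbe j))|apply: bmeasM; [exact: (bC _ (bal i))|exact: btH]].
  rewrite (eq_bigr _ (fun i _ => E i)) -Rintegral_sum; last first.
    by move=> i _; exact: (bmeas_integrable P (bac i)).
  by apply: eq_Rintegral => w _; rewrite mulr_sumr.
have ale1 : {ae P, forall w, \sum_i al i (C w) = 1}.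
  apply: (@cond_version_eq _ _ _ _ _ P C (fun=> 1) (fun=> 1) (fun x => \sum_i al i x) (fun=> 1)) => //.
  - exact: bmeas_cst.
  - exact: bmeas_cst.
  - apply: (cond_version_sum (F := fun i => \1_(ca i))) => //.
      by move=> i; exact: bi.
    move=> w; have := quantizer_sum (fun w => phi (X w)) (fun _ _ => 1 : R) w.
    by under eq_bigr do rewrite mulr1.
  - exact: cond_version_cst.
have sle : {ae P, forall w, \sum_j b j (H w) * expR (s j (C w)) <= 1}.
  apply: filterS ale1 => w al1.
  apply: (@le_trans _ _ (\sum_i al i (C w) * \sum_j b j (H w) * expR (t i j (H w)))).
    under [leRHS]eq_bigr do rewrite mulr_sumr.
    rewrite exchange_big/=; apply: ler_sum => j _.
    under eq_bigr do rewrite mulrCA.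
    rewrite -mulr_sumr ler_wpM2l//; first by have /andP[] := b01 j (H w).
    by apply: expR_convex_sum => // i; have /andP[] := al01 i (C w).
  rewrite -[leRHS]al1; apply: ler_sum => i _.
  by rewrite ler_piMr//; have /andP[] := al01 i (C w).
have [M M0 sM] := bmeas_bound_fin bs.
apply/ler_addgt0Pr => e e0.
(* Replacing [s] by [G] costs [m%:R * (e / K)] in the expectation and [expR M] times as much in the
   exponential term; [K] makes the total at most [e], and the last 1 keeps it positive. *)
pose K := m%:R * (1 + expR M) + 1 : R.
have K0 : 0 < K by rewrite ltr_wpDl// mulr_ge0// addr_ge0// expR_ge0.
have [n [q [G [mq bG GM Ge]]]] := quantizer_approx_fin (distribution P C) bs M0 sM (divr_gt0 e0 K0).
have bGC j : bmeas (fun x : TH * TZ => G j (q x.2) x.1).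
  exact: (bmeas_section mq (bG j)).
have bGw j : bmeas (fun w => G j (q (Z w)) (H w)) by exact: (bmeas_comp mC (bGC j)).
have close j : \int[P]_w `|s j (C w) - G j (q (Z w)) (H w)| <= e / K.
  have := Ge j; rewrite Rintegral_distribution//.
  exact: (bmeas_norm (bmeasB (bs j) (bGC j))).
have Ew : \sum_j \int[P]_w (\1_(cb j) w * G j (q (Z w)) (H w)) =
    \int[P]_w G (eta (H' w)) (q (Z w)) (H w).
  rewrite -Rintegral_sum; last first.
    by move=> j _; apply/bmeas_integrable/bmeasM; [exact: bi|exact: bGw].
  apply: eq_Rintegral => w _.
  by rewrite (quantizer_sum (fun w => eta (H' w)) (fun j w => G j (q (Z w)) (H w))).
have gib := quantized_info_gibbs mq meta b01 bv bae (fun i j => bG j i) cmi.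
have step1 : \sum_j \int[P]_w (\1_(cb j) w * s j (C w)) <=
   \int[P]_w G (eta (H' w)) (q (Z w)) (H w) + m%:R * (e / K).
  have -> : m%:R * (e / K) = \sum_(j < m) e / K by rewrite sumr_const card_ord mulr_natl.
  rewrite -Ew -big_split/=; apply: ler_sum => j _.
  have b1 : bmeas (fun w => \1_(cb j) w * s j (C w)) by apply: bmeasM; [exact: bi|exact: bC].
  have b2 : bmeas (fun w => \1_(cb j) w * G j (q (Z w)) (H w)).
    by apply: bmeasM; [exact: bi|exact: bGw].
  have b3 : bmeas (fun w => `|s j (C w) - G j (q (Z w)) (H w)|).
    by apply: bmeas_norm; apply: bmeasB; [exact: bC|exact: bGw].
  apply: (@le_trans _ _ (\int[P]_w (\1_(cb j) w * G j (q (Z w)) (H w)) +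
    \int[P]_w `|s j (C w) - G j (q (Z w)) (H w)|)); last by rewrite lerD2l.
  rewrite -RintegralD//; try exact: bmeas_integrable.
  apply: le_Rintegral => //; try exact: bmeas_integrable.
    by apply: bmeas_integrable; exact: bmeasD.
  move=> w _; rewrite indicE; case: (_ \in _); rewrite ?mul1r ?mul0r ?add0r//.
  by rewrite -lerBlDl ler_norm.
have step2 : \int[P]_w (\sum_j b j (H w) * expR (G j (q (Z w)) (H w))) <=
   1 + m%:R * (expR M * (e / K)).
  have b1 : bmeas (fun w => \sum_j b j (H w) * expR (G j (q (Z w)) (H w))).
    apply: bmeas_sum => j _; apply: bmeasM.
      by apply: (bmeas_comp mH); case: (bv j).
    by apply: bmeas_expR; exact: bGw.
  have b3 j : bmeas (fun w => expR M * `|s j (C w) - G j (q (Z w)) (H w)|).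
    apply: bmeasM; first exact: bmeas_cst.
    by apply: bmeas_norm; apply: bmeasB; [exact: bC|exact: bGw].
  have -> : m%:R * (expR M * (e / K)) = \sum_(j < m) (expR M * (e / K)).
    by rewrite sumr_const card_ord mulr_natl.
  apply: (@le_trans _ _ (1 + \sum_j \int[P]_w (expR M * `|s j (C w) - G j (q (Z w)) (H w)|))); last first.
    rewrite lerD2l; apply: ler_sum => j _; rewrite RintegralZl//; last first.
      apply/bmeas_integrable/bmeas_norm/bmeasB; [exact: bC|exact: bGw].
    by rewrite ler_wpM2l ?expR_ge0.
  rewrite -[X in _ <= X + _](Rintegral_probability_cst P) -Rintegral_sum; last first.
    by move=> j _; exact: bmeas_integrable.
  rewrite -RintegralD//; last 2 first.
  - exact/bmeas_integrable/bmeas_cst.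
  - by apply/bmeas_integrable/bmeas_sum => j _; exact: b3.
  apply: ae_le_Rintegral.
  - exact: bmeas_integrable.
  - apply/bmeas_integrable/bmeasD; first exact: bmeas_cst.
    by apply: bmeas_sum => j _; exact: b3.
  - apply: filterS sle => w h.
    apply: (@le_trans _ _ (\sum_j b j (H w) * expR (s j (C w)) +
      \sum_j expR M * `|s j (C w) - G j (q (Z w)) (H w)|)); last by rewrite lerD2r.
    rewrite -big_split/=; apply: ler_sum => j _.
    have /andP[bj0 bj1] := b01 j (H w).
    have := @expR_lip R M (G j (q (Z w)) (H w)) (s j (C w)) (le_trans (ler_norm _) (GM _ _ _)).
    move=> /(ler_wpM2l bj0)/le_trans; apply; rewrite mulrDr lerD2l.
    by rewrite ler_piMl// mulr_ge0// expR_ge0.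
rewrite E1; apply: (le_trans step1).
apply: (@le_trans _ _ (r + (1 + m%:R * (expR M * (e / K))) - 1 + m%:R * (e / K))).
  by rewrite lerD2r; apply: (le_trans gib); rewrite lerD2r lerD2l.
have -> : r + (1 + m%:R * (expR M * (e / K))) - 1 + m%:R * (e / K) =
  r + (m%:R * (1 + expR M)) / K * e by ring.
rewrite lerD2l ler_piMl ?(ltW e0)// ler_pdivrMr// mul1r /K lerDl//.
Unshelve. all: by end_near. Qed.

End data_processing.

(* The Gibbs variational form of [I(X; H) <= S], tested on functions of [H] and of a
   finite quantization of [X]. *)
Definition dependence_le d dX dH (T : measurableType d) (TX : measurableType dX)
    (TH : measurableType dH) (R : realType) (P : probability T R)
    (X : T -> TX) (H : T -> TH) (S : R) : Prop :=
  forall (I : finType) (phi : TX -> I) (G : I -> TH -> R),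
    quantizer phi -> (forall i, bmeas (G i)) ->
    \int[P]_w G (phi (X w)) (H w) <=
    S + \int[P]_w \int[P]_w' expR (G (phi (X w')) (H w)) - 1.

(** * The Gibbs form for independent variables *)

Section dependence.
Context d dX dH (T : measurableType d) (TX : measurableType dX)
  (TH : measurableType dH) (R : realType) (P : probability T R).
Context (X : {mfun T >-> TX}) (H : {mfun T >-> TH}).

Lemma Rintegral_quantizer (I : finType) (phi : TX -> I) (F : I -> R) : quantizer phi ->
  \int[P]_w F (phi (X w)) = \sum_i fine (P (X @^-1` (phi @^-1` [set i]))) * F i.
Proof.
move=> mphi; have mX : measurable_fun setT X by exact: measurable_funP.
have mca i : measurable (X @^-1` (phi @^-1` [set i])).
  by rewrite -[X in measurable X]setTI; exact: mX.
under eq_Rintegral do rewrite (quantizer_sum (fun w => phi (X w)) (fun i _ => F i)).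
rewrite Rintegral_sum; last first.
  by move=> i _; apply/bmeas_integrable/bmeasM; [exact: bmeas_indic (mca i)|exact: bmeas_cst].
apply: eq_bigr => i _; rewrite RintegralZr//; first by rewrite Rintegral_indic//; exact: mca.
by apply/bmeas_integrable/bmeas_indic; exact: mca.
Qed.

Lemma bmeas_Rintegral_quantizer (I : finType) (phi : TX -> I) (F : I -> TH -> R) :
  quantizer phi -> (forall i, bmeas (F i)) -> bmeas (fun w => \int[P]_w' F (phi (X w')) (H w)).
Proof.
move=> mphi bF; under eq_fun do rewrite (Rintegral_quantizer (F ^~ (H _)) mphi).
apply: bmeas_sum => i _; apply: bmeasM; first exact: bmeas_cst.
by apply: bmeas_comp => //; exact: measurable_funP.
Qed.

(** By independence the constant [p i] is a version of the conditional probability of the cell [i]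
    given [H], so the left side is already an expectation over an independent copy of [X]; it
    remains to use [x <= expR x - 1]. *)
Lemma dependence_le_indep : indep_rv P X H -> dependence_le P X H 0.
Proof.
move=> ind I phi G mphi bG.
have mX : measurable_fun setT X by exact: measurable_funP.
have mH : measurable_fun setT H by exact: measurable_funP.
have mca i : measurable (X @^-1` (phi @^-1` [set i])).
  by rewrite -[X in measurable X]setTI; exact: mX.
set p := fun i => fine (P (X @^-1` (phi @^-1` [set i]))).
have bi i : bmeas (\1_(X @^-1` (phi @^-1` [set i])) : T -> R) by exact: bmeas_indic.
have E i : \int[P]_w (\1_(X @^-1` (phi @^-1` [set i])) w * G i (H w)) =
    \int[P]_w (p i * G i (H w)).
  apply: (@is_cond_exp_mul _ _ _ _ _ P H _ (fun=> p i)) => //.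
    exact: bmeas_integrable.
  split => //; first by apply: (bmeas_integrable P (bmeas_cst _ (p i))).
  move=> B mB; have mHB : measurable (H @^-1` B) by rewrite -[X in measurable X]setTI; exact: mH.
  have mcai := mca i; rewrite integral_cst// integral_indic//.
  by rewrite /p fineK ?fin_num_measure//; exact: ind.
have -> : \int[P]_w G (phi (X w)) (H w) = \int[P]_w \int[P]_w' G (phi (X w')) (H w).
  under [RHS]eq_Rintegral do rewrite (Rintegral_quantizer (G ^~ (H _)) mphi).
  under eq_Rintegral do rewrite (quantizer_sum (fun w => phi (X w)) (fun i w => G i (H w))).
  have bGH i : bmeas (fun w => G i (H w)) by exact: bmeas_comp.
  rewrite !Rintegral_sum.
  - by apply: eq_bigr => i _; exact: E.
  - by move=> i _; apply/bmeas_integrable/bmeasM => //; exact: bmeas_cst.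
  - by move=> i _; apply/bmeas_integrable/bmeasM => //; exact: bi.
have b1 := bmeas_Rintegral_quantizer mphi bG.
have b2 := bmeas_Rintegral_quantizer mphi (fun i => bmeas_expR (bG i)).
rewrite add0r -[X in _ - X](Rintegral_probability_cst P) -RintegralB//; last 2 first.
- exact: bmeas_integrable.
- exact/bmeas_integrable/bmeas_cst.
apply: le_Rintegral => //; [exact: bmeas_integrable| |].
  by apply: bmeas_integrable; apply: bmeasB => //; exact: bmeas_cst.
move=> w _.
have bq (F : I -> TH -> R) : Rintegrable P (fun w' => F (phi (X w')) (H w)).
  apply/bmeas_integrable/(@bmeas_quantizer _ _ _ _ (fun w' => phi (X w')) (fun i _ => F i (H w))).
    exact: quantizer_comp.
  by move=> i; exact: bmeas_cst.
rewrite -[X in _ - X](Rintegral_probability_cst P) -RintegralB//; last 2 first.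
- exact: (bq (fun i x => expR (G i x))).
- exact/bmeas_integrable/bmeas_cst.
apply: le_Rintegral => //.
  apply: RintegrableB; first exact: (bq (fun i x => expR (G i x))).
  exact/bmeas_integrable/bmeas_cst.
by move=> w' _; rewrite lerBrDl expR_ge1Dx.
Qed.

End dependence.

(** * The chain rule in Gibbs form *)

Section dependence_step.
Context d dX dZ dH dH' (T : measurableType d) (TX : measurableType dX)
  (TZ : measurableType dZ) (TH : measurableType dH) (TH' : measurableType dH')
  (R : realType) (P : probability T R).
Context (X : {mfun T >-> TX}) (Z : {mfun T >-> TZ}) (H : {mfun T >-> TH}) (H' : {mfun T >-> TH'}).

Let mX : measurable_fun setT X. Proof. exact: measurable_funP. Qed.
Let mH : measurable_fun setT H. Proof. exact: measurable_funP. Qed.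
Let mH' : measurable_fun setT H'. Proof. exact: measurable_funP. Qed.

(** [V i] is the conditional expectation of [expR (c i (eta H'))] given [H]. The test function [c]
    is the sum of [ln V], bounded by the hypothesis on [H], and of a remainder normalized given [H],
    bounded by [data_processing]. The exponential terms match by the tower property. *)
Let dependence_step_quantized (r S : R) (I : finType) (phi : TX -> I) m (eta : TH' -> 'I_m)
    (c : I -> 'I_m -> R) :
  markov_chain P X (fun w => (H w, Z w)) H' -> (cond_mutual_info P Z H' H <= r%:E)%E ->
  dependence_le P X H S -> quantizer phi -> quantizer eta ->
  \int[P]_w c (phi (X w)) (eta (H' w)) <=
  S + r + \int[P]_w \int[P]_w' expR (c (phi (X w')) (eta (H' w))) - 1.
Proof.
move=> markov cmi dep mphi meta.
have mcb j : measurable (H' @^-1` (eta @^-1` [set j])).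
  by rewrite -[X in measurable X]setTI; exact: mH'.
have bcb j : bmeas (\1_(H' @^-1` (eta @^-1` [set j])) : T -> R) by exact: bmeas_indic.
have /choice[b Hb] := fun j => cond_prob_version P H (mcb j).
have bv j : cond_version P H \1_(H' @^-1` (eta @^-1` [set j])) (b j) by case: (Hb j).
have b01 j x : 0 <= b j x <= 1 by case: (Hb j).
have bb j : bmeas (b j) by case: (bv j).
pose M := \sum_i \sum_j `|c i j|.
have cM i j : - M <= c i j.
  rewrite lerNl; apply: (@le_trans _ _ `|c i j|); first by rewrite -normrN ler_norm.
  rewrite /M (bigD1 i)//= (bigD1 j)//= -addrA lerDl addr_ge0 ?sumr_ge0// => ? _.
  exact: sumr_ge0.
pose V i x := \sum_j b j x * expR (c i j).
(* [V] is at least [expR (- M)] only almost surely, since the [b j] sum to 1 only almost surely. The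
   maximum makes [ln W] bounded and the normalization of [t] valid everywhere. *)
pose W i x := Num.max (expR (- M)) (V i x).
have bV i : bmeas (V i).
  by apply: bmeas_sum => j _; apply: bmeasM => //; exact: bmeas_cst.
have W0 i x : 0 < W i x by rewrite lt_max expR_gt0.
have bW i : bmeas (W i).
  have [mV [N VN]] := bV i; split; first exact: measurable_maxr.
  exists (expR (- M) + N) => x; rewrite ger0_norm ?(ltW (W0 _ _))//; have h := VN x.
  have N0 : 0 <= N by rewrite (le_trans _ h).
  rewrite /W ge_max lerDl N0/= ler_wpDl ?expR_ge0// (le_trans (ler_norm _))//.
have blnW i : bmeas (fun x => ln (W i x)).
  have [mW [N WN]] := bW i; split; first exact: measurableT_comp.
  have N0 (x : TH) : 0 < N by rewrite (lt_le_trans (W0 i x))// (le_trans (ler_norm _) (WN x)).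
  exists (M + `|ln N|) => x; rewrite ler_norml; apply/andP; split.
    rewrite opprD; apply: (@le_trans _ _ (- M)); first by rewrite lerBlDr lerDl.
    by rewrite -[leLHS]expRK ler_ln ?posrE ?expR_gt0// le_max lexx.
  have M0 : 0 <= M by apply: sumr_ge0 => ? _; exact: sumr_ge0.
  apply: (@le_trans _ _ (ln N)); last by rewrite (le_trans (ler_norm _))// lerDr.
  by rewrite ler_ln ?posrE ?(N0 x)// (le_trans (ler_norm _) (WN x)).
have VW : {ae P, forall w i, W i (H w) = V i (H w)}.
  have b1 : {ae P, forall w, \sum_j b j (H w) = 1}.
    apply: (@cond_version_eq _ _ _ _ _ P H (fun=> 1) (fun=> 1) (fun x => \sum_j b j x) (fun=> 1)) => //.
    - exact: bmeas_cst.
    - exact: bmeas_cst.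
    - apply: (cond_version_sum (F := fun j => \1_(H' @^-1` (eta @^-1` [set j])))) => //.
      move=> w; have := quantizer_sum (fun w => eta (H' w)) (fun _ _ => 1 : R) w.
      by under eq_bigr do rewrite mulr1.
    - exact: cond_version_cst.
  apply: filterS b1 => w b1 i; rewrite /W max_r// -[leLHS]mul1r -b1 mulr_suml.
  apply: ler_sum => j _; rewrite ler_wpM2l//; first by have /andP[] := b01 j (H w).
  by rewrite ler_expR.
pose t i j x := c i j - ln (W i x).
have bt i j : bmeas (t i j) by apply: bmeasB => //; exact: bmeas_cst.
have bt1 i x : \sum_j b j x * expR (t i j x) <= 1.
  under eq_bigr do rewrite /t expRD expRN lnK ?posrE// mulrA.
  by rewrite -mulr_suml ler_pdivrMr// mul1r le_max lexx orbT.
have bae j : {ae P, forall w, cond_prob P H (H' @^-1` (eta @^-1` [set j])) w = b j (H w)}.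
  by case: (Hb j).
have dp := data_processing markov cmi mphi meta b01 bv bae bt bt1.
have := dep I phi (fun i x => ln (W i x)) mphi blnW.
have qX : quantizer (fun w => phi (X w)) by exact: quantizer_comp.
have qH : quantizer (fun w => eta (H' w)) by exact: quantizer_comp.
have ilnW : Rintegrable P (fun w => ln (W (phi (X w)) (H w))).
  apply: bmeas_integrable; apply: (bmeas_quantizer (f := fun i w => ln (W i (H w))) qX) => i.
  exact: (bmeas_comp mH (blnW i)).
have ic : Rintegrable P (fun w => c (phi (X w)) (eta (H' w))).
  apply: bmeas_integrable; apply: (bmeas_quantizer (f := fun i w => c i (eta (H' w))) qX) => i.
  by apply: (bmeas_quantizer (f := fun j _ => c i j) qH) => j; exact: bmeas_cst.
have Ec : \int[P]_w c (phi (X w)) (eta (H' w)) =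
    \int[P]_w t (phi (X w)) (eta (H' w)) (H w) + \int[P]_w ln (W (phi (X w)) (H w)).
  rewrite -RintegralD//; last exact: RintegrableB.
  by apply: eq_Rintegral => w _; rewrite /t subrK.
have -> : \int[P]_w \int[P]_w' expR (ln (W (phi (X w')) (H w))) =
    \int[P]_w \int[P]_w' expR (c (phi (X w')) (eta (H' w))).
  set p := fun i => fine (P (X @^-1` (phi @^-1` [set i]))).
  pose k j := \sum_i p i * expR (c i j).
  under eq_Rintegral do rewrite (Rintegral_quantizer P X (fun i => expR (ln (W i (H _)))) mphi).
  under [RHS]eq_Rintegral do rewrite (Rintegral_quantizer P X (fun i => expR (c i (eta (H' _)))) mphi).
  transitivity (\int[P]_w \sum_j b j (H w) * k j).
    apply: ae_eq_Rintegral.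
    - apply: measurable_sum => i; apply: measurable_funM => //.
      apply: measurableT_comp => //; have [m1 _] := blnW i; exact: (measurableT_comp m1 mH).
    - apply: measurable_sum => j; apply: measurable_funM => //.
      by have [m1 _] := bb j; exact: (measurableT_comp m1 mH).
    - apply: filterS VW => w WV.
      under eq_bigr do rewrite lnK ?posrE// WV /V mulr_sumr.
      rewrite exchange_big/=; apply: eq_bigr => j _; rewrite /k mulr_sumr.
      by apply: eq_bigr => i _; rewrite mulrCA.
  have bbH j : bmeas (fun w => b j (H w)) by exact: (bmeas_comp mH (bb j)).
  rewrite Rintegral_sum; last first.
    by move=> j _; apply/bmeas_integrable/bmeasM => //; exact: bmeas_cst.
  transitivity (\sum_j \int[P]_w (\1_(H' @^-1` (eta @^-1` [set j])) w * k j)).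
    apply: eq_bigr => j _; have [_ E] := bv j.
    by rewrite (E (fun=> k j) (bmeas_cst _ _)).
  rewrite -Rintegral_sum; last first.
    by move=> j _; apply/bmeas_integrable/bmeasM; [exact: bcb|exact: bmeas_cst].
  apply: eq_Rintegral => w _.
  by rewrite -(quantizer_sum (fun w => eta (H' w)) (fun j _ => k j)).
rewrite Ec; lra.
Qed.

(** The functions [G i] are approximated from below: the left side loses at most [e], and the
    exponential term on the right only decreases. *)
Lemma dependence_le_step (r S : R) :
  markov_chain P X (fun w => (H w, Z w)) H' -> (cond_mutual_info P Z H' H <= r%:E)%E ->
  dependence_le P X H S -> dependence_le P X H' (S + r).
Proof.
move=> markov cmi dep I phi G mphi bG; apply/ler_addgt0Pr => e e0.
have [M M0 GM] := bmeas_bound_fin bG.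
have [N [c cP]] := bounded_quantize M e0.
have /choice[q qP] := fun i => cP _ _ (G i) (bG i).1 (GM i).
(* A single label of [H'] records the levels of all the functions [G i]. *)
pose eta x := enum_rank [ffun i => q i x].
pose c' (i : I) (j : 'I_#|{: {ffun I -> 'I_N.+1}}|) := c ((enum_val j : {ffun I -> 'I_N.+1}) i).
have meta : quantizer eta.
  by apply: quantizer_rank; apply: quantizer_ffun => i; case: (qP i).
have c'E i x : c' i (eta x) <= G i x <= c' i (eta x) + e.
  by rewrite /c' /eta enum_rankK ffunE; case: (qP i).
have h0 := dependence_step_quantized c' markov cmi dep mphi meta.
have qX : quantizer (fun w => phi (X w)) by exact: quantizer_comp.
have qH : quantizer (fun w => eta (H' w)) by exact: quantizer_comp.
have bGH i : bmeas (fun w => G i (H' w)) by exact: (bmeas_comp mH' (bG i)).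
have bcH i : bmeas (fun w => c' i (eta (H' w))).
  by apply: (bmeas_quantizer (f := fun j _ => c' i j) qH) => j; exact: bmeas_cst.
have b1 : bmeas (fun w => G (phi (X w)) (H' w)).
  exact: (bmeas_quantizer (f := fun i w => G i (H' w)) qX).
have b2 : bmeas (fun w => c' (phi (X w)) (eta (H' w))).
  exact: (bmeas_quantizer (f := fun i w => c' i (eta (H' w))) qX).
have h1 : \int[P]_w G (phi (X w)) (H' w) <= \int[P]_w c' (phi (X w)) (eta (H' w)) + e.
  rewrite -[X in _ <= _ + X](Rintegral_probability_cst P) -RintegralD//; last 2 first.
  - exact: bmeas_integrable.
  - exact/bmeas_integrable/bmeas_cst.
  apply: le_Rintegral => //; first exact: bmeas_integrable.
  - by apply: bmeas_integrable; apply: (bmeasD b2); exact: bmeas_cst.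
  - by move=> w _; have /andP[] := c'E (phi (X w)) (H' w).
have h2 : \int[P]_w \int[P]_w' expR (c' (phi (X w')) (eta (H' w))) <=
    \int[P]_w \int[P]_w' expR (G (phi (X w')) (H' w)).
  have bc' i : bmeas (fun x => c' i (eta x)).
    by apply: (bmeas_quantizer (f := fun j _ => c' i j) meta) => j; exact: bmeas_cst.
  apply: le_Rintegral => //.
  - apply: bmeas_integrable.
    exact: (bmeas_Rintegral_quantizer P X H' (F := fun i x => expR (c' i (eta x))) mphi (fun i => bmeas_expR (bc' i))).
  - apply: bmeas_integrable.
    exact: (bmeas_Rintegral_quantizer P X H' (F := fun i x => expR (G i x)) mphi (fun i => bmeas_expR (bG i))).
  move=> w _; rewrite (Rintegral_quantizer P X (fun i => expR (c' i (eta (H' w)))) mphi).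
  rewrite (Rintegral_quantizer P X (fun i => expR (G i (H' w))) mphi).
  apply: ler_sum => i _; rewrite ler_wpM2l ?fine_ge0// ler_expR.
  by have /andP[] := c'E i (H' w).
apply: (le_trans h1).
apply: (@le_trans _ _ (S + r + \int[P]_w \int[P]_w' expR (c' (phi (X w')) (eta (H' w))) - 1 + e)).
  by rewrite lerD2r.
rewrite lerD2r lerD2r lerD2l; exact: h2.
Qed.

End dependence_step.

(** * From quantized to bounded and integrable test functions *)

Section sum_of_probabilities.
Context d (T : measurableType d) (R : realType) (P Q : probability T R).

Let mu := measure_add P Q.

Let mu_fin : fin_num_fun mu.
Proof.
move=> A mA; rewrite /mu measure_addE fin_numD.
by rewrite (fin_num_measure P A mA) (fin_num_measure Q A mA).
Qed.

HB.instance Definition _ := Measure.on mu.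
HB.instance Definition _ := Measure_isFinite.Build _ T R mu mu_fin.

(** L1 approximation for the sum is simultaneous approximation for both laws, here the joint law of
    [(H, X)] and the product of its marginals. *)
Definition probability_sum : {finite_measure set T -> \bar R} := mu.

Lemma Rintegral_probability_sum (f : T -> R) : bmeas f ->
  \int[probability_sum]_x f x = \int[P]_x f x + \int[Q]_x f x.
Proof.
move=> bf; have iP := bmeas_integrable P bf; have iQ := bmeas_integrable Q bf.
rewrite /Rintegral (integral_measure_add measurableT iP iQ).
by rewrite fineD//; exact: integrable_fin_num.
Qed.

End sum_of_probabilities.

Section dependence_bounded.
Context d dX dH (T : measurableType d) (TX : measurableType dX)
  (TH : measurableType dH) (R : realType) (P : probability T R).
Context (X : {mfun T >-> TX}) (H : {mfun T >-> TH}).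

Let mX : measurable_fun setT X. Proof. exact: measurable_funP. Qed.
Let mH : measurable_fun setT H. Proof. exact: measurable_funP. Qed.

Let mHX : measurable_fun setT (fun w => (H w, X w)).
Proof. exact: measurable_fun_pair. Qed.

Let C : {mfun T >-> (TH * TX)%type} := HB.pack_for {mfun T >-> (TH * TX)%type}
  (fun w => (H w, X w)) (isMeasurableFun.Build _ _ _ _ _ mHX).

Let mpair : measurable_fun setT (fun z : T * T => (H z.1, X z.2)).
Proof.
by apply: measurable_fun_pair; [exact: (measurableT_comp mH)|exact: (measurableT_comp mX)].
Qed.

Let C2 : {mfun (T * T)%type >-> (TH * TX)%type} := HB.pack_for {mfun (T * T)%type >-> (TH * TX)%type}
  (fun z : T * T => (H z.1, X z.2)) (isMeasurableFun.Build _ _ _ _ _ mpair).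

Let PP : probability (T * T)%type R := (P \x P)%E.

Let Rintegral_C2 (f : TH * TX -> R) : bmeas f ->
  \int[distribution PP C2]_z f z = \int[P]_w \int[P]_w' f (H w, X w').
Proof.
move=> bf; rewrite Rintegral_distribution//.
exact: (Rintegral_prod P P (f := fun z : T * T => f (H z.1, X z.2)) (bmeas_comp mpair bf)).
Qed.

Let lin (S e x1 x2 x3 x4 x5 x6 : R) : x2 <= x1 + x4 -> x1 <= S + x5 - 1 -> x5 <= x6 + x3 ->
  x4 + x3 <= e -> x2 <= S + x6 - 1 + e.
Proof. lra. Qed.

(** The two sides of the inequality live under different laws, joint and product, so the quantized
    approximant must be close to [f] under both. *)
Lemma dependence_le_bounded (S : R) (f : TH * TX -> R) : dependence_le P X H S -> bmeas f ->
  \int[P]_w f (H w, X w) <= S + \int[P]_w \int[P]_w' expR (f (H w, X w')) - 1.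
Proof.
move=> dep bf; apply/ler_addgt0Pr => e e0.
have [_ [M0 fM0]] := bf.
have [M M0' fM] : exists2 M, 0 <= M & forall z, `|f z| <= M.
  by exists `|M0| => // z; rewrite (le_trans (fM0 z))// ler_norm.
(* The error under the joint law has weight 1, the one under the product law has weight [expR M]
   from [expR_lip]. *)
pose K := 1 + expR M; have K0 : 0 < K by rewrite ltr_wpDr// expR_ge0.
have [I [q [G [mq bG GM Ge]]]] := quantizer_approx
  (probability_sum (distribution P C) (distribution PP C2)) bf M0' fM (divr_gt0 e0 K0).
have bg : bmeas (fun z : TH * TX => G (q z.2) z.1) by exact: (bmeas_section mq bG).
have bd : bmeas (fun z : TH * TX => `|f z - G (q z.2) z.1|) by exact/bmeas_norm/bmeasB.
move: Ge; rewrite Rintegral_probability_sum// Rintegral_distribution// Rintegral_C2//=.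
set D1 := \int[P]_x _; set D2 := \int[P]_x _ => D12.
have bfC : bmeas (fun w => f (H w, X w)) by exact: (bmeas_comp mHX bf).
have bgC : bmeas (fun w => G (q (X w)) (H w)) by exact: (bmeas_comp mHX bg).
have bdC : bmeas (fun w => `|f (H w, X w) - G (q (X w)) (H w)|) by exact: (bmeas_comp mHX bd).
have h1 : \int[P]_w f (H w, X w) <= \int[P]_w G (q (X w)) (H w) + D1.
  rewrite -RintegralD//; try exact: bmeas_integrable.
  apply: le_Rintegral => //; try exact: bmeas_integrable.
    by apply: bmeas_integrable; exact: bmeasD.
  by move=> w _; rewrite -lerBlDl ler_norm.
have h2 := dep I q G mq bG.
have bef : bmeas (fun z : T * T => expR (f (H z.1, X z.2))).
  exact: (bmeas_expR (bmeas_comp mpair bf)).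
have beg : bmeas (fun z : T * T => expR (G (q (X z.2)) (H z.1))).
  exact: (bmeas_expR (bmeas_comp mpair bg)).
have bd2 : bmeas (fun z : T * T => `|f (H z.1, X z.2) - G (q (X z.2)) (H z.1)|).
  exact: (bmeas_comp mpair bd).
have h3 : \int[P]_w \int[P]_w' expR (G (q (X w')) (H w)) <=
    \int[P]_w \int[P]_w' expR (f (H w, X w')) + expR M * D2.
  rewrite -(Rintegral_prod P P (f := fun z : T * T => expR (G (q (X z.2)) (H z.1))))//.
  rewrite -(Rintegral_prod P P (f := fun z : T * T => expR (f (H z.1, X z.2))))//.
  rewrite /D2 -(Rintegral_prod P P (f := fun z : T * T => `|f (H z.1, X z.2) - G (q (X z.2)) (H z.1)|))//.
  have i1 := bmeas_integrable PP beg; have i2 := bmeas_integrable PP bef.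
  have i3 := bmeas_integrable PP bd2.
  rewrite -[X in _ + X](RintegralZl (mu := PP))// -(RintegralD (mu := PP))//; last exact: RintegrableZl.
  apply: (@le_Rintegral _ _ _ PP) => //; first by apply: RintegrableD => //; exact: RintegrableZl.
  move=> z _; apply: expR_lip; rewrite (le_trans (ler_norm _))//.
have D20 : 0 <= D2.
  by apply: Rintegral_ge0 => w _; apply: Rintegral_ge0.
have D10 : 0 <= D1 by apply: Rintegral_ge0.
have h4 : D1 + expR M * D2 <= e.
  apply: (@le_trans _ _ (K * (D1 + D2))).
    rewrite mulrDr lerD//.
      by rewrite ler_peMl// /K lerDl expR_ge0.
    by rewrite ler_wpM2r// /K lerDr.
  by rewrite mulrC -ler_pdivlMr.
exact: lin h1 h2 h3 h4.
Qed.

(** Truncation of [f] at [n] and [-n]: cutting from above lowers the exponential, cutting from below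
    adds at most [expR (- n%:R)], and the expectations converge by domination. *)
Lemma dependence_le_integrable (S : R) (f : TH * TX -> R) : dependence_le P X H S ->
  measurable_fun setT f -> Rintegrable P (fun w => f (H w, X w)) ->
  (forall w, Rintegrable P (fun w' => expR (f (H w, X w')))) ->
  (forall w, \int[P]_w' expR (f (H w, X w')) <= 1) ->
  \int[P]_w f (H w, X w) <= S.
Proof.
move=> dep mf intf iexp exp1.
pose g n z := Num.max (- n%:R) (Num.min (f z) n%:R).
have bg n : bmeas (g n).
  split; first by apply: measurable_maxr => //; exact: measurable_minr.
  by exists n%:R => z; exact: clamp_le.
have bgC n : bmeas (fun w => g n (H w, X w)) by exact: (bmeas_comp mHX (bg n)).
have gle n z : `|g n z| <= `|f z|.
  rewrite /g maxEle minEle; have n0 : 0 <= n%:R :> R by [].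
  have [h|h] := leP (f z) n%:R; have [h'|h'] := leP (- n%:R) _ => //.
  - by rewrite !ler0_norm; lra.
  - by rewrite !ger0_norm; lra.
  - by lra.
have E n : \int[P]_w g n (H w, X w) <= S + expR (- n%:R).
  apply: (le_trans (dependence_le_bounded dep (bg n))).
  rewrite -addrA lerD2l lerBlDr.
  rewrite -[leRHS](Rintegral_probability_cst P); apply: le_Rintegral => //.
  - apply: bmeas_integrable.
    apply: (@bmeas_Rintegral _ _ _ P _ _ P (fun z : T * T => expR (g n (H z.1, X z.2)))).
    exact: (bmeas_expR (bmeas_comp mpair (bg n))).
  - exact/bmeas_integrable/bmeas_cst.
  move=> w _.
  apply: (@le_trans _ _ (\int[P]_w' (expR (f (H w, X w')) + expR (- n%:R)))).
    apply: le_Rintegral => //.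
    - apply: bmeas_integrable.
      exact: (bmeas_pair1 (bmeas_expR (bmeas_comp mpair (bg n))) w).
    - by apply: RintegrableD => //; exact/bmeas_integrable/bmeas_cst.
    move=> w' _; rewrite /g maxEle minEle.
    have [h|h] := leP (f _) n%:R; have [h'|h'] := leP (- n%:R) _.
    + by rewrite lerDl expR_ge0.
    + by rewrite lerDr expR_ge0.
    + by rewrite ler_wpDr ?expR_ge0// ler_expR ltW.
    + by rewrite lerDr expR_ge0.
  rewrite RintegralD//; last exact/bmeas_integrable/bmeas_cst.
  by rewrite Rintegral_probability_cst addrC lerD2l.
have cvg1 : \int[P]_w g n (H w, X w) @[n --> \oo] --> \int[P]_w f (H w, X w).
  have [||||| _ _ DC] := @dominated_convergence _ _ R P setT measurableT
    (fun n w => (g n (H w, X w))%:E) (fun w => (f (H w, X w))%:E) (fun w => `|(f (H w, X w))%:E|%E).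
  - by move=> n; apply/measurable_EFinP; case: (bgC n).
  - exact: (measurable_int _ intf).
  - apply: aeW => w _; apply: cvg_near_cst; near=> n.
    have : `|f (H w, X w)| <= n%:R.
      near: n; exists (Num.truncn `|f (H w, X w)|).+1 => // n /= xn.
      by rewrite (le_trans (ltW (truncnS_gt _)))// ler_nat.
    rewrite ler_norml => /andP[l1 l2].
    by rewrite /g min_l// max_r.
  - exact: (integrable_abse intf).
  - by apply: aeW => w n _; rewrite lee_fin.
  suff /fine_cvg : (\int[P]_w g n (H w, X w))%:E @[n --> \oo] --> (\int[P]_w f (H w, X w))%:E by [].
  rewrite {2}/Rintegral fineK; last exact: (integrable_fin_num measurableT intf).
  apply: cvg_trans DC; apply: near_eq_cvg; near=> n; rewrite /= /Rintegral fineK//.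
  exact: (integrable_fin_num measurableT (bmeas_integrable P (bgC n))).
have cvg2 : (S + expR (- n%:R)) @[n --> \oo] --> S.
  rewrite -[X in _ --> X]addr0; apply: cvgD; first exact: cvg_cst.
  exact: cvgn_expR.
apply: (ler_cvg_to cvg1 cvg2); near=> n; exact: E.
Unshelve. all: by end_near. Qed.

End dependence_bounded.

(** * Mean square errors *)

Section cond_exp_L2.
Context d d' (T : measurableType d) (T' : measurableType d') (R : realType)
  (P : probability T R).
Variables (U : {mfun T >-> T'}) (V : T -> R) (g : T' -> R).
Hypotheses (mV : measurable_fun setT V) (V2 : Rintegrable P (fun w => V w ^+ 2)).
Hypothesis mg : measurable_fun setT g.
Hypothesis gE : forall h : T' -> R, bmeas h ->
  \int[P]_w (V w * h (U w)) = \int[P]_w (g (U w) * h (U w)).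

Let mU : measurable_fun setT U. Proof. exact: measurable_funP. Qed.
Let D n := g @^-1` `[- n%:R, n%:R]%classic.
Let mD n : measurable (D n).
Proof. by rewrite -[X in measurable X]setTI; apply: mg => //; exact: measurable_itv. Qed.
Let gn n x := g x * \1_(D n) x.

Let bgn n : bmeas (gn n).
Proof.
split; first by apply: measurable_funM => //; exact: measurable_indic.
exists n%:R => x; rewrite /gn indicE; case: (boolP (x \in D n)) => [/set_mem|_].
  by rewrite /D/= in_itv/= mulr1 ler_norml.
by rewrite mulr0 normr0.
Qed.

Let iV : Rintegrable P V.
Proof.
apply: (@le_Rintegrable _ _ _ P _ (fun w => 1 + V w ^+ 2)) => //.
  move=> w; rewrite -(real_normK (num_real (V w))); have := normr_ge0 (V w).
  by have := sqr_ge0 (`|V w| - 1); lra.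
by apply: RintegrableD => //; exact/bmeas_integrable/bmeas_cst.
Qed.

Let iVgn n : Rintegrable P (fun w => (V w - gn n (U w)) ^+ 2).
Proof.
have bG : bmeas (fun w => gn n (U w)) by exact: (bmeas_comp mU (bgn n)).
have -> : (fun w => (V w - gn n (U w)) ^+ 2) =
    (fun w => V w ^+ 2 - (2 * (gn n (U w) * V w) - gn n (U w) * gn n (U w))).
  by apply/funext => w; ring.
apply: RintegrableB => //; apply: RintegrableB; last exact/bmeas_integrable/bmeasM.
by apply: RintegrableZl; exact: RintegrableM.
Qed.

Let trunc_le n : \int[P]_w (V w - gn n (U w)) ^+ 2 <= \int[P]_w V w ^+ 2.
Proof.
have bG : bmeas (fun w => gn n (U w)) by exact: (bmeas_comp mU (bgn n)).
have iVg : Rintegrable P (fun w => V w * gn n (U w)).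
  by under eq_fun do rewrite mulrC; exact: RintegrableM.
have ig2 := bmeas_integrable P (bmeasM bG bG).
have E : \int[P]_w (V w * gn n (U w)) = \int[P]_w (gn n (U w) * gn n (U w)).
  rewrite gE//; apply: eq_Rintegral => w _; rewrite /gn indicE.
  by case: (_ \in _); rewrite ?mulr1 ?mulr0.
under eq_Rintegral => w _.
  have -> : (V w - gn n (U w)) ^+ 2 = V w ^+ 2 - (2 * (V w * gn n (U w)) - gn n (U w) * gn n (U w)) by ring.
  over.
have i3 : Rintegrable P (fun w => 2 * (V w * gn n (U w)) - gn n (U w) * gn n (U w)).
  by apply: RintegrableB => //; exact: RintegrableZl.
rewrite RintegralB// RintegralB//; last exact: RintegrableZl.
rewrite RintegralZl// E gerBl mulr_natl mulr2n addrK.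
by apply: Rintegral_ge0 => w _; rewrite -expr2 sqr_ge0.
Qed.

(** The identity [gE] only admits bounded test functions, and [g] is not yet known to be square
    integrable. For the truncation [gn n], testing against itself gives the mean square error as the
    second moment of [V] minus that of [gn n]; monotone convergence over the events [D n]
    concludes. *)
Lemma cond_exp_L2 : Rintegrable P (fun w => (V w - g (U w)) ^+ 2) /\
  \int[P]_w (V w - g (U w)) ^+ 2 <= \int[P]_w V w ^+ 2.
Proof.
pose f n w := ((V w - g (U w)) ^+ 2 * \1_(D n) (U w))%:E.
have mf0 : measurable_fun setT (fun w => (V w - g (U w)) ^+ 2).
  by apply: measurable_funX; apply: measurable_funB => //; exact: measurableT_comp.
have mDU n : measurable_fun setT (fun w => \1_(D n) (U w) : R).
  by apply: measurableT_comp => //; exact: measurable_indic.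
have mf n : measurable_fun setT (f n).
  by apply/measurable_EFinP; exact: measurable_funM.
have fle n : (\int[P]_w f n w <= (\int[P]_w V w ^+ 2)%:E)%E.
  rewrite /Rintegral fineK; last exact: (integrable_fin_num measurableT V2).
  apply: (@le_trans _ _ (\int[P]_w (((V w - gn n (U w)) ^+ 2)%:E))%E).
    apply: ge0_le_integral => //.
    - by move=> w _; rewrite lee_fin mulr_ge0// sqr_ge0.
    - apply/measurable_EFinP/measurable_funX/measurable_funB => //.
      by case: (bmeas_comp mU (bgn n)).
    - move=> w _; rewrite lee_fin /gn indicE; case: (_ \in _); rewrite ?mulr1 ?mulr0//.
      exact: sqr_ge0.
  have := trunc_le n; rewrite -lee_fin /Rintegral !fineK//.
    exact: (integrable_fin_num measurableT V2).
  exact: (integrable_fin_num measurableT (iVgn n)).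
have f0 n w : setT w -> (0 <= f n w)%E by move=> _; rewrite lee_fin mulr_ge0// sqr_ge0.
have fnd w : setT w -> {homo f^~ w : a b / (a <= b)%N >-> (a <= b)%E}.
  move=> _ a b ab; rewrite lee_fin ler_wpM2l ?sqr_ge0// !indicE ler_nat.
  case: (boolP (_ \in D a)) => // /set_mem h; rewrite mem_set//.
  move: h; rewrite /D/= !in_itv/= => /andP[h1 h2].
  have nab : a%:R <= b%:R :> R by rewrite ler_nat.
  by rewrite (le_trans _ h1) ?lerN2//= (le_trans h2).
have flim w : limn (f^~ w) = ((V w - g (U w)) ^+ 2)%:E.
  apply/cvg_lim => //; apply: cvg_near_cst; near=> n.
  rewrite /f indicE mem_set ?mulr1// /D/= in_itv/= -ler_norml.
  near: n; exists (Num.truncn `|g (U w)|).+1 => // n /= xn.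
  by rewrite (le_trans (ltW (truncnS_gt _)))// ler_nat.
have H := @cvg_monotone_convergence _ _ _ P _ measurableT _ mf f0 fnd.
have le : (\int[P]_w ((V w - g (U w)) ^+ 2)%:E <= (\int[P]_w V w ^+ 2)%:E)%E.
  under eq_integral do rewrite -flim.
  by rewrite -(cvg_lim _ H)//; apply: lime_le; [apply/cvg_ex; eexists; exact: H|exact: nearW].
have int : Rintegrable P (fun w => (V w - g (U w)) ^+ 2).
  apply/integrableP; split; first exact/measurable_EFinP.
  under eq_integral do rewrite /= ger0_norm ?sqr_ge0//.
  by rewrite (le_lt_trans le)// ltry.
split=> //; rewrite -lee_fin {1}/Rintegral fineK//.
exact: (integrable_fin_num measurableT int).
Unshelve. all: by end_near. Qed.

End cond_exp_L2.

(** * Simultaneous diagonalization *)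

Section pencil.
Context {R : realType}.

Let continuous_sum (T : topologicalType) (I : Type) (s : seq I) (f : I -> T -> R) :
  (forall i, continuous (f i)) -> continuous (fun x => \sum_(i <- s) f i x).
Proof.
move=> cf; elim: s => [|i s IH].
  by under eq_fun do rewrite big_nil; move=> x; exact: cvg_cst.
under eq_fun do rewrite big_cons; move=> x; apply: cvgD; [exact: cf|exact: IH].
Qed.

Definition qform n (M : 'M[R]_n) (a : 'rV[R]_n) : R := (a *m M *m a^T) 0 0.

Lemma qform_continuous n (M : 'M[R]_n) : continuous (qform M).
Proof.
rewrite /qform.
have -> : (fun a : 'rV[R]_n => (a *m M *m a^T) 0 0) =
    (fun a => \sum_j (\sum_i a 0 i * M i j) * a 0 j).
  by apply/funext => b; rewrite mxE; apply: eq_bigr => j _; rewrite !mxE.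
have c1 j : continuous (fun a : 'rV[R]_n => \sum_i a 0 i * M i j).
  apply: (@continuous_sum _ _ _ (fun i (a : 'rV[R]_n) => a 0 i * M i j)) => i a.
  apply: (@continuousM R _ (fun a : 'rV[R]_n => a 0 i) (fun=> M i j)); last first. exact: cst_continuous.
  exact: (@coord_continuous R 1 n 0 i a).
apply: (@continuous_sum _ _ _ (fun j (a : 'rV[R]_n) => (\sum_i a 0 i * M i j) * a 0 j)) => j a.
apply: (@continuousM R _ (fun a : 'rV[R]_n => \sum_i a 0 i * M i j) (fun a => a 0 j)); first exact: c1.
exact: (@coord_continuous R 1 n 0 j a).
Qed.

Lemma qformZ n (M : 'M[R]_n) c a : qform M (c *: a) = c ^+ 2 * qform M a.
Proof. by rewrite /qform linearZ/= -!scalemxAl -scalemxAr !mxE expr2 mulrA. Qed.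

Lemma qformD n (M : 'M[R]_n) a c : qform M (a + c) =
  qform M a + qform M c + (a *m M *m c^T) 0 0 + (c *m M *m a^T) 0 0.
Proof. by rewrite /qform linearD/= !mulmxDl !mulmxDr !mxE; ring. Qed.

Lemma qform_swap n (M : 'M[R]_n) (a c : 'rV[R]_n) : M^T = M ->
  (a *m M *m c^T) 0 0 = (c *m M *m a^T) 0 0.
Proof.
move=> sM.
have -> : c *m M *m a^T = (a *m M *m c^T)^T by rewrite !trmx_mul trmxK sM mulmxA.
by rewrite [RHS]mxE.
Qed.

(** The form is minimal at [v], so its first variation vanishes there. Along [z = v *m Q] it varies
    by [2 * t * N + t ^+ 2 * qform Q z], where [N] is the squared Euclidean norm of [z]. *)
Lemma psd_kernel n (Q : 'M[R]_n) (v : 'rV[R]_n) : Q^T = Q -> (forall a, 0 <= qform Q a) ->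
  qform Q v = 0 -> v *m Q = 0.
Proof.
move=> sQ Q0 v0; set z := v *m Q; pose N := (z *m z^T) 0 0.
have zz t : 0 <= 2 * t * N + t ^+ 2 * qform Q z.
  have := Q0 (v + t *: z); rewrite qformD qformZ v0 (qform_swap _ v sQ) add0r.
  have -> : (v *m Q *m (t *: z)^T) 0 0 = t * N by rewrite linearZ/= -scalemxAr [LHS]mxE.
  by move=> h; apply: (le_trans h); rewrite le_eqVlt; apply/orP; left; apply/eqP; ring.
have NE : N = \sum_i z 0 i ^+ 2.
  by rewrite /N mxE; apply: eq_bigr => i _; rewrite [z^T _ _]mxE expr2.
have N0 : 0 <= N by rewrite NE; apply: sumr_ge0 => i _; exact: sqr_ge0.
have N00 : N = 0.
  apply/eqP; rewrite eq_le N0 andbT leNgt; apply/negP => Np.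
  (* This [t] makes the variation negative if [N > 0]; the added 1 avoids a division by 0 when
     [qform Q z] vanishes. *)
  have := zz (- N / (qform Q z + 1)); have := Q0 z; move: (qform Q z) => q q0.
  have q1 : 0 < q + 1 by rewrite ltr_wpDl.
  have -> : 2 * (- N / (q + 1)) * N + (- N / (q + 1)) ^+ 2 * q =
    - (N ^+ 2 * (q + 2) / (q + 1) ^+ 2) by field; rewrite gt_eqF.
  by rewrite leNgt oppr_lt0 divr_gt0 ?mulr_gt0 ?exprn_gt0// ltr_wpDl.
apply/rowP => i; rewrite [RHS]mxE; apply/eqP; rewrite -sqrf_eq0; apply/eqP.
rewrite NE in N00.
by apply: (psumr_eq0P _ N00) => // j _; exact: sqr_ge0.
Qed.

(** [v] maximizes the Rayleigh quotient of [K] by [S] on the unit sphere. The quotient is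
    homogeneous of degree 0, so the choice of norm does not matter. At the maximal value,
    [f v *: S - K] is positive semidefinite and its form vanishes at [v]. *)
Lemma pencil_eigenvector n (S K : 'M[R]_n.+1) : S^T = S -> K^T = K ->
  (forall a, a != 0 -> 0 < qform S a) ->
  exists (l : R) (v : 'rV[R]_n.+1), v != 0 /\ v *m K = l *: (v *m S).
Proof.
move=> sS sK S0.
pose A : set 'rV[R]_n.+1 := [set v | `|v| = 1].
have A0 a : A a -> a != 0.
  by move=> /= a1; rewrite -normr_eq0 a1 oner_eq0.
have nA (a : 'rV[R]_n.+1) : a != 0 -> A (`|a|^-1 *: a).
  by move=> a0; rewrite /A/= normrZ normfV normr_id mulVf// normr_eq0.
have cA : compact A.
  apply: bounded_closed_compact.
    by exists 1; split; [exact: num_real|move=> x x1 a /= ->; exact: ltW].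
  apply: (@closed_comp _ _ (fun v : 'rV[R]_n.+1 => `|v|) [set 1]); last exact: closed_eq.
  by move=> a _; exact: norm_continuous.
have neA : A !=set0.
  exists (`|delta_mx 0 0 : 'rV[R]_n.+1|^-1 *: delta_mx 0 0); apply: nA.
  by apply/eqP => /rowP /(_ 0) /eqP; rewrite !mxE eqxx oner_eq0.
pose f a := qform K a / qform S a.
have cf : {within A, continuous f}.
  apply: continuous_in_subspaceT => a /set_mem Aa.
  apply: (@continuousM R _ (qform K) (fun a => (qform S a)^-1)); first exact: qform_continuous.
  apply: continuousV; last exact: qform_continuous.
  by rewrite gt_eqF// S0// A0.
have [v /set_mem Av vmax] := EVT_max_rV neA cA cf.
have v0 := A0 _ Av.
exists (f v), v; split => //.
pose Q := f v *: S - K.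
have QE a : qform Q a = f v * qform S a - qform K a.
  by rewrite /qform /Q mulmxBr mulmxBl -scalemxAr -scalemxAl !mxE.
suff : v *m Q = 0.
  by rewrite /Q mulmxBr -scalemxAr => /eqP; rewrite subr_eq0 eq_sym => /eqP.
apply: psd_kernel.
- by rewrite /Q linearB/= linearZ/= sS sK.
- move=> a; have [->|a0] := eqVneq a 0.
    by rewrite /qform mul0mx mul0mx mxE.
  have Sa := S0 _ a0.
  have := vmax _ (mem_set (nA _ a0)).
  rewrite {1}/f !qformZ -mulf_div divff ?mul1r; last by rewrite sqrf_eq0 invr_eq0 normr_eq0.
  by rewrite ler_pdivrMr// QE subr_ge0.
- by rewrite QE /f divfK ?subrr// gt_eqF// S0.
Qed.

(** Induction on the dimension: a generalized eigenvector [v] is split off, and both forms are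
    restricted to its orthogonal complement for [S]. That complement is also orthogonal to [v] for
    [K], as [v *m K] is a multiple of [v *m S]. *)
Lemma simultaneous_diagonalization n (S K : 'M[R]_n) : S^T = S -> K^T = K ->
  (forall a, a != 0 -> 0 < qform S a) ->
  exists B : 'M[R]_n, B *m S *m B^T = 1%:M /\ is_diag_mx (B *m K *m B^T).
Proof.
elim: n S K => [|n IH] S K sS sK S0.
  by exists 1%:M; split; [apply/matrixP => -[]|apply/is_diag_mxP => -[]].
have [l [u [u0 uE]]] := pencil_eigenvector sS sK S0.
pose c := Num.sqrt (qform S u); have c0 : 0 < c by rewrite sqrtr_gt0 S0.
pose v := c^-1 *: u.
have vS : v *m S *m v^T = 1%:M.
  apply/matrixP => i j; rewrite !ord1 -/(qform S v) qformZ.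
  rewrite -[X in _ * X](sqr_sqrtr (ltW (S0 _ u0))) -/c -exprMn mulVf ?gt_eqF// expr1n mxE eqxx//.
have vK : v *m K = l *: (v *m S) by rewrite -!scalemxAl uE !scalerA mulrC.
(* The rows of [C] are a basis of the orthogonal complement of [v] for [S], the kernel of the
   nonzero column [S *m v^T]. *)
have [C [fC CE]] : exists C : 'M[R]_(n, n.+1), row_free C /\ C *m (S *m v^T) = 0.
  set w := S *m v^T; have w0 : w != 0.
    apply/eqP => w0; move: vS; rewrite -mulmxA -/w w0 mulmx0 => /matrixP/(_ 0 0)/eqP.
    by rewrite !mxE eq_sym oner_eq0.
  have rk : \rank (kermx w) = n.
    rewrite mxrank_ker; have -> : \rank w = 1%N; last by rewrite subn1.
    by apply/eqP; rewrite eqn_leq rank_leq_col lt0n mxrank_eq0.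
  have rw : row_base (kermx w) *m w = 0 by apply/sub_kermxP; rewrite eq_row_base.
  move: (row_base _) (row_base_free (kermx w)) rw; rewrite rk => C fC Cw.
  by exists C.
have sS' : (C *m S *m C^T)^T = C *m S *m C^T by rewrite !trmx_mul trmxK sS mulmxA.
have sK' : (C *m K *m C^T)^T = C *m K *m C^T by rewrite !trmx_mul trmxK sK mulmxA.
have [|B [BS BK]] := IH _ _ sS' sK'.
  move=> a a0; have aC0 : a *m C != 0 by rewrite mulmx_free_eq0.
  have := S0 _ aC0; rewrite /qform trmx_mul !mulmxA//.
have vSC : v *m S *m C^T = 0.
  by apply/trmx_inj; rewrite !trmx_mul trmxK trmx0 sS.
have CSv : C *m S *m v^T = 0 by rewrite -mulmxA.
have block (M : 'M[R]_n.+1) : (col_mx v (B *m C) : 'M[R]_(1 + n)) *m M *m (col_mx v (B *m C))^T =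
    block_mx (v *m M *m v^T) (v *m M *m C^T *m B^T) (B *m (C *m M *m v^T)) (B *m (C *m M *m C^T) *m B^T).
  by rewrite tr_col_mx mul_col_mx mul_col_row trmx_mul !mulmxA.
have vKv : v *m K *m C^T = 0 by rewrite vK -scalemxAl vSC scaler0.
have CKv : C *m K *m v^T = 0.
  by apply/trmx_inj; rewrite !trmx_mul trmxK trmx0 sK mulmxA.
exists (col_mx v (B *m C) : 'M[R]_(1 + n)); rewrite !block; split.
  by rewrite vS vSC CSv BS mul0mx mulmx0 -scalar_mx_block.
rewrite vKv CKv mul0mx mulmx0.
apply: etrans (@is_diag_block_mx _ 1 n 1 n (v *m K *m v^T) 0 0 _ erefl) _.
by rewrite !eqxx/= BK andbT; exact: mx11_is_diag.
Qed.

End pencil.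

(** * Linear combinations of a Gaussian vector *)

Section gaussian_vector.
Context d (T : measurableType d) (R : realType) (P : probability T R) (k : nat).
Context (X : {RV P >-> k.-tuple R}) (Sigma : 'M[R]_k).
Hypotheses (pS : posdefmx Sigma) (gX : gaussian_vector P X 0 Sigma).
Notation nu := (@normal_prob R 0 1).

Definition lincomb (a : 'rV[R]_k) (w : T) : R := \sum_(i < k) a 0 i * tnth (X w) i.

Lemma measurable_lincomb a : measurable_fun setT (lincomb a).
Proof.
apply: measurable_sum => i; apply: measurable_funM => //.
apply: (measurableT_comp (measurable_tnth i)); exact: measurable_funP.
Qed.

Lemma lincombZ c a w : lincomb (c *: a) w = c * lincomb a w.
Proof. by rewrite /lincomb mulr_sumr; apply: eq_bigr => i _; rewrite mxE mulrA. Qed.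

Let std_neq0 a : qform Sigma a = 1 -> a != 0.
Proof.
move=> a1; apply/eqP => a0; move: a1; rewrite a0 /qform !mul0mx mxE => /eqP.
by rewrite eq_sym oner_eq0.
Qed.

Let mY a : measurable_fun setT (lincomb a : T -> measurableTypeR R).
Proof. exact: measurable_lincomb. Qed.

Let Y a : {RV P >-> measurableTypeR R} := HB.pack_for {RV P >-> measurableTypeR R} (lincomb a)
  (isMeasurableFun.Build _ _ _ _ _ (mY a)).

Let std_distribution a : qform Sigma a = 1 ->
  forall A, measurable A -> distribution P (Y a) A = nu A.
Proof.
move=> a1 A mA; have := gX (std_neq0 a1) mA.
by rewrite mulmx0 mxE -/(qform Sigma a) a1 sqrtr1.
Qed.

Let ge0_integral_lincomb a (f : R -> \bar R) : qform Sigma a = 1 -> (forall x, 0 <= f x)%E ->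
  measurable_fun setT f -> (\int[P]_w f (lincomb a w) = \int[nu]_x f x)%E.
Proof.
move=> a1 f0 mf; rewrite -(ge0_integral_distribution (Y a) mf f0).
by apply: eq_measure_integral => A mA _; exact: std_distribution.
Qed.

Lemma gaussian_lincomb a (f : R -> R) : qform Sigma a = 1 -> Rintegrable nu f ->
  Rintegrable P (fun w => f (lincomb a w)) /\ \int[P]_w f (lincomb a w) = \int[nu]_x f x.
Proof.
move=> a1 intf; have mf := Rintegrable_meas intf.
have intfa : Rintegrable P (fun w => f (lincomb a w)).
  apply/integrableP; split.
    by apply/measurable_EFinP; apply: measurableT_comp => //; exact: measurable_lincomb.
  have := @ge0_integral_lincomb a (fun x => `|(f x)%:E|%E) a1.
  move=> /(_ _ _)/= ->//.
  - by case/integrableP : intf.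
  - by apply/measurable_EFinP; exact: measurableT_comp.
split => //; rewrite /Rintegral; congr fine.
rewrite -[LHS](integral_distribution (X := Y a) (f := EFin \o f))//; last exact/measurable_EFinP.
by apply: eq_measure_integral => A mA _; exact: std_distribution.
Qed.

(** [gaussian_vector] is silent about [a = 0], which is treated apart; any other [a] is rescaled to
    unit variance. *)
Lemma lincomb_sqr a : Rintegrable P (fun w => lincomb a w ^+ 2).
Proof.
have [a0|a0] := eqVneq a 0.
  have -> : (fun w => lincomb a w ^+ 2) = (fun=> 0).
    apply/funext => w; rewrite /lincomb big1 ?expr0n// => i _.
    by rewrite a0 mxE mul0r.
  exact: Rintegrable0.
have q0 : 0 < qform Sigma a by exact: pS.2.
pose c := Num.sqrt (qform Sigma a); have c0 : 0 < c by rewrite sqrtr_gt0.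
have a1 : qform Sigma (c^-1 *: a) = 1.
  by rewrite qformZ -[X in _ * X](sqr_sqrtr (ltW q0)) -/c -exprMn mulVf ?gt_eqF// expr1n.
have -> : (fun w => lincomb a w ^+ 2) = (fun w => c ^+ 2 * lincomb (c^-1 *: a) w ^+ 2).
  by apply/funext => w; rewrite lincombZ -exprMn mulrA divff ?mul1r// gt_eqF.
apply: RintegrableZl.
exact: (gaussian_lincomb a1 std_normal_sqr.1).1.
Qed.

Lemma lincomb_char a th : \int[P]_w cos (lincomb a w + th) = expR (- (qform Sigma a / 2)) * cos th.
Proof.
have [a0|a0] := eqVneq a 0.
  have l0 w : lincomb a w = 0 by rewrite /lincomb big1// => i _; rewrite a0 mxE mul0r.
  under eq_Rintegral do rewrite l0 add0r.
  rewrite Rintegral_probability_cst (_ : qform _ _ = 0) ?mul0r ?oppr0 ?expR0 ?mul1r//.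
  by rewrite a0 /qform !mul0mx mxE.
have q0 : 0 < qform Sigma a by exact: pS.2.
pose c := Num.sqrt (qform Sigma a); have c0 : 0 < c by rewrite sqrtr_gt0.
have a1 : qform Sigma (c^-1 *: a) = 1.
  by rewrite qformZ -[X in _ * X](sqr_sqrtr (ltW q0)) -/c -exprMn mulVf ?gt_eqF// expr1n.
rewrite -(sqr_sqrtr (ltW q0)) -/c -std_normal_char.
have ic : Rintegrable nu (fun x => cos (c * x + th)).
  have mlin : measurable_fun setT (fun x : R => c * x + th).
    by apply: measurable_funD => //; apply: measurable_funM.
  by apply: bmeas_integrable; apply: bmeas_cos; exact: mlin.
rewrite -(gaussian_lincomb a1 ic).2; apply: eq_Rintegral => w _.
by rewrite lincombZ mulrA divff ?mul1r// gt_eqF.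
Qed.

End gaussian_vector.

(** * The determinant of the error covariance *)

Lemma qform_row (R : realType) k (M B : 'M[R]_k) i : qform M (row i B) = (B *m M *m B^T) i i.
Proof.
rewrite /qform -row_mul tr_row [LHS]mxE [RHS]mxE.
by apply: eq_bigr => j _; rewrite [row _ _ _ _]mxE [col _ _ _ _]mxE.
Qed.

Section product_limit.
Context {R : realType}.

Let cvg_prod (I : Type) (s : seq I) (f : I -> nat -> R) (a : I -> R) :
  (forall i, f i @ \oo --> a i) ->
  \prod_(i <- s) f i n @[n --> \oo] --> \prod_(i <- s) a i.
Proof.
move=> fa; elim: s => [|i s IH].
  by rewrite big_nil; under eq_fun do rewrite big_nil; exact: cvg_cst.
by rewrite big_cons; under eq_fun do rewrite big_cons; apply: cvgM.
Qed.

(* The bound is tested at [v = (1 - e) D + e / 2], which lies in the open unit interval and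
   has [D / v <= 1 / (1 - e)]; then [e] tends to [0]. *)
Lemma prod_lower_bound k (D : 'I_k -> R) (S : R) : (forall i, 0 <= D i <= 1) ->
  (forall v : 'I_k -> R, (forall i, 0 < v i < 1) ->
    \sum_i (- (ln (v i) / 2) - D i / (2 * v i) + 1 / 2) <= S) ->
  expR (- (2 * S)) <= \prod_i D i.
Proof.
move=> D01 hv.
pose h (m : nat) : R := m.+1%:R^-1.
have h01 m : 0 < h m <= 1 by rewrite /h invr_gt0 ltr0n/= invf_le1// ler1n.
pose v m i := (1 - h m / 2) * D i + h m / 2 / 2.
have v01 m i : 0 < v m i < 1.
  have /andP[h0 h1] := h01 m; have /andP[d0 d1] := D01 i; rewrite /v.
  have p0 : 0 <= (1 - h m / 2) * D i by rewrite mulr_ge0//; lra.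
  have p1 : (1 - h m / 2) * D i <= 1 - h m / 2 by rewrite ler_piMr//; lra.
  by apply/andP; split; lra.
have E m : expR (- (2 * S) - k%:R * h m) <= \prod_i v m i.
  have -> : \prod_i v m i = expR (\sum_i ln (v m i)).
    rewrite expR_sum; apply: eq_bigr => i _; rewrite lnK// posrE.
    by have /andP[] := v01 m i.
  rewrite ler_expR.
  have -> : k%:R * h m = \sum_(i < k) h m by rewrite sumr_const card_ord mulr_natl.
  have := hv _ (v01 m).
  have H : \sum_i (- (ln (v m i) / 2) - h m / 2) <= \sum_i (- (ln (v m i) / 2) - D i / (2 * v m i) + 1 / 2).
    apply: ler_sum => i _; rewrite -addrA lerD2l.
    have /andP[h0 h1] := h01 m; have /andP[d0 d1] := D01 i; have /andP[v0 v1] := v01 m i.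
    have vD : (1 - h m / 2) * D i <= v m i by rewrite /v lerDl; lra.
    (* For [h] between 0 and 1, [(1 + h) * (1 - h / 2)] is at least 1, as it exceeds 1 by
       [h * (1 - h) / 2]. *)
    have q : D i / v m i <= 1 + h m.
      rewrite ler_pdivrMr//.
      apply: (@le_trans _ _ ((1 + h m) * ((1 - h m / 2) * D i))); last by rewrite ler_wpM2l//; lra.
      rewrite mulrA ler_peMl//.
      have : 0 <= h m * (1 - h m) by rewrite mulr_ge0//; lra.
      by lra.
    have -> : D i / (2 * v m i) = D i / v m i / 2 by field; rewrite gt_eqF.
    by lra.
  move=> /(le_trans H); rewrite sumrB sumrN -!mulr_suml; lra.
have c1 : h m @[m --> \oo] --> (0 : R) by exact: cvg_harmonic.
have c2 : expR (- (2 * S) - k%:R * h m) @[m --> \oo] --> expR (- (2 * S)).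
  apply: continuous_cvg; first exact: continuous_expR.
  rewrite -[X in _ --> X]subr0; apply: cvgB; first exact: cvg_cst.
  by rewrite -(mulr0 k%:R); apply: cvgM => //; exact: cvg_cst.
have c3 : \prod_i v m i @[m --> \oo] --> \prod_i D i.
  apply: cvg_prod => i.
  rewrite -[X in _ --> X]addr0; apply: cvgD.
    rewrite -[X in _ --> X]mul1r; apply: cvgM; last exact: cvg_cst.
    rewrite -[X in _ --> X]subr0; apply: cvgB; first exact: cvg_cst.
    by rewrite -(mul0r (2^-1)); apply: cvgM => //; exact: cvg_cst.
  rewrite -(mul0r (2^-1)); apply: cvgM; last exact: cvg_cst.
  by rewrite -(mul0r (2^-1)); apply: cvgM => //; exact: cvg_cst.
by apply: (ler_cvg_to c2 c3); near=> m; exact: E.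
Unshelve. all: by end_near. Qed.

End product_limit.

(** * Lower bound on the determinant of the error covariance by the information *)

Section mmse.
Context d dH (T : measurableType d) (TH : measurableType dH) (R : realType)
  (P : probability T R) (k : nat).
Context (X : {RV P >-> k.-tuple R}) (Sigma : 'M[R]_k) (H : {RV P >-> TH}).
Hypotheses (pS : posdefmx Sigma) (gX : gaussian_vector P X 0 Sigma).

Let K := mmse_cov P X H.
Let mH : measurable_fun setT H. Proof. exact: measurable_funP. Qed.

Let Xj j := fun w => tnth (X w) j.

Let XjE j w : Xj j w = lincomb X (delta_mx 0 j) w.
Proof.
rewrite /lincomb (bigD1 j)//= mxE !eqxx mul1r big1 ?addr0// => i ij.
by rewrite mxE (negbTE ij) andbF mul0r.
Qed.

Let Xj2 j : Rintegrable P (fun w => Xj j w ^+ 2).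
Proof.
have := lincomb_sqr pS gX (delta_mx 0 j).
by under eq_fun do rewrite -XjE.
Qed.

Let mXj j : measurable_fun setT (Xj j).
Proof. by apply: (measurableT_comp (measurable_tnth j)); exact: measurable_funP. Qed.

Lemma Rintegrable_sqr (V : T -> R) : measurable_fun setT V ->
  Rintegrable P (fun w => V w ^+ 2) -> Rintegrable P V.
Proof.
move=> mV V2; apply: (@le_Rintegrable _ _ _ P _ (fun w => 1 + V w ^+ 2)) => //.
  move=> w; rewrite -(real_normK (num_real (V w))); have := normr_ge0 (V w).
  by have := sqr_ge0 (`|V w| - 1); lra.
by apply: RintegrableD => //; exact/bmeas_integrable/bmeas_cst.
Qed.

Lemma Rintegrable_mul (V W : T -> R) : measurable_fun setT V -> measurable_fun setT W ->
  Rintegrable P (fun w => V w ^+ 2) -> Rintegrable P (fun w => W w ^+ 2) ->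
  Rintegrable P (fun w => V w * W w).
Proof.
move=> mV mW V2 W2; apply: (@le_Rintegrable _ _ _ P _ (fun w => V w ^+ 2 + W w ^+ 2)) => //.
- exact: measurable_funM.
- move=> w; rewrite normrM -(real_normK (num_real (V w))) -(real_normK (num_real (W w))).
  have := sqr_ge0 (`|V w| - `|W w|); have := sqr_ge0 (`|V w|); have := sqr_ge0 (`|W w|); lra.
- exact: RintegrableD.
Qed.

Let iXj j : Rintegrable P (Xj j). Proof. exact: Rintegrable_sqr. Qed.

Let err j w := Xj j w - cond_exp P H (Xj j) w.

Let KE i j : K i j = \int[P]_w (err i w * err j w).
Proof. by rewrite mxE unlock. Qed.

Let regression : exists g : 'I_k -> TH -> R,
  [/\ forall j, measurable_fun setT (g j),
      forall j, Rintegrable P (fun w => g j (H w)),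
      forall j h, bmeas h -> \int[P]_w (Xj j w * h (H w)) = \int[P]_w (g j (H w) * h (H w)) &
      forall j w, err j w = Xj j w - g j (H w)].
Proof.
have /choice[g gP] : forall j, exists g, is_cond_exp P H (Xj j) g /\ cond_exp P H (Xj j) = g \o H.
  by move=> j; have [g g1 g2] := cond_expP H (iXj j); exists g.
exists g; split.
- by move=> j; have [[]] := gP j.
- by move=> j; have [[]] := gP j.
- by move=> j h bh; apply: is_cond_exp_mul => //; case: (gP j).
- by move=> j w; rewrite /err; have [_ ->] := gP j.
Qed.

(** In the coordinates given by [B], [Y] is standard normal, [n] is its conditional mean given [H],
    and [D i] are the error variances. Since [\det B ^+ 2] normalizes [\det Sigma] to 1 and turns
    [\det K] into the product of the [D i], only a lower bound on this product is needed. *)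
Lemma mmse_det_lower_bound (S : R) : dependence_le P X H S ->
  \det Sigma * expR (- (2 * S)) <= \det K /\ 0 < \det Sigma.
Proof.
move=> dep; have [g [mg ig gE errE]] := regression.
have merr j : measurable_fun setT (err j).
  rewrite (_ : err j = (fun w => Xj j w - g j (H w))); last exact/funext/errE.
  by apply: measurable_funB => //; exact: (measurableT_comp (mg j)).
have err2 j : Rintegrable P (fun w => err j w ^+ 2).
  under eq_fun do rewrite errE.
  by have [] := cond_exp_L2 (mXj j) (Xj2 j) (mg j) (gE j).
have ierr i j : Rintegrable P (fun w => err i w * err j w) by exact: Rintegrable_mul.
have sK : K^T = K.
  by apply/matrixP => i j; rewrite mxE !KE; apply: eq_Rintegral => w _; rewrite mulrC.
have [B [BS BK]] := simultaneous_diagonalization pS.1 sK pS.2.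
pose Y i w := lincomb X (row i B) w.
pose n i x := \sum_j B i j * g j x.
have YE i w : Y i w = \sum_j B i j * Xj j w.
  by apply: eq_bigr => j _; rewrite mxE.
have q1 i : qform Sigma (row i B) = 1 by rewrite qform_row BS mxE eqxx.
have mY i : measurable_fun setT (Y i) by exact: measurable_lincomb.
have mn i : measurable_fun setT (n i).
  by apply: measurable_sum => j; exact: measurable_funM.
have Y2 i : Rintegrable P (fun w => Y i w ^+ 2) by exact: lincomb_sqr pS gX _.
have Y21 i : \int[P]_w Y i w ^+ 2 = 1.
  have [_ ->] := gaussian_lincomb gX (q1 i) std_normal_sqr.1.
  exact: std_normal_sqr.2.
have nE i h : bmeas h -> \int[P]_w (Y i w * h (H w)) = \int[P]_w (n i (H w) * h (H w)).
  move=> bh; have bhH := bmeas_comp mH bh.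
  have iM (V : T -> R) : Rintegrable P V -> Rintegrable P (fun w => V w * h (H w)).
    by move=> iV; under eq_fun do rewrite mulrC; exact: RintegrableM.
  under eq_Rintegral do rewrite YE mulr_suml.
  under [RHS]eq_Rintegral do rewrite mulr_suml.
  rewrite !Rintegral_sum; last 2 first.
  - by move=> j _; apply: iM; exact: RintegrableZl.
  - by move=> j _; apply: iM; exact: RintegrableZl.
  apply: eq_bigr => j _.
  under eq_Rintegral do rewrite -mulrA.
  under [RHS]eq_Rintegral do rewrite -mulrA.
  rewrite !RintegralZl ?gE//; exact: iM.
have L2 i := cond_exp_L2 (mY i) (Y2 i) (mn i) (nE i).
pose D i := \int[P]_w (Y i w - n i (H w)) ^+ 2.
have DE i : (B *m K *m B^T) i i = D i.
  rewrite mxE; under eq_bigr do rewrite mxE mulr_suml.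
  rewrite exchange_big/=.
  transitivity (\int[P]_w \sum_j \sum_l (B i j * B i l * (err j w * err l w))).
    rewrite Rintegral_sum2; last by move=> j l; exact: RintegrableZl.
    apply: eq_bigr => j _; apply: eq_bigr => l _.
    by rewrite RintegralZl// -KE [B^T _ _]mxE mulrAC.
  apply: eq_Rintegral => w _.
  have -> : Y i w - n i (H w) = \sum_j B i j * err j w.
    by rewrite YE -sumrB; apply: eq_bigr => j _; rewrite errE mulrBr.
  rewrite expr2 mulr_suml; apply: eq_bigr => j _; rewrite mulr_sumr.
  by apply: eq_bigr => l _; ring.
(* Estimating [Y i] from [H] cannot do worse than estimating it by 0, whose error is its variance
   1. *)
have D01 i : 0 <= D i <= 1.
  by rewrite (Rintegral_ge0 _ (fun w _ => sqr_ge0 _))/= -(Y21 i); case: (L2 i).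
have detS : \det B ^+ 2 * \det Sigma = 1.
  by have := congr1 determinant BS; rewrite !det_mulmx det_tr det1 => <-; ring.
have detK : \det B ^+ 2 * \det K = \prod_i D i.
  transitivity (\det (B *m K *m B^T)); first by rewrite !det_mulmx det_tr; ring.
  rewrite det_trig ?is_diag_mx_is_trig//.
  by apply: eq_bigr => i _; exact: DE.
have prodD : expR (- (2 * S)) <= \prod_i D i.
  apply: prod_lower_bound => // v v01.
  pose y i (x : k.-tuple R) := \sum_j B i j * tnth x j.
  have my i : measurable_fun setT (y i).
    by apply: measurable_sum => j; apply: measurable_funM => //; exact: measurable_tnth.
  have yX i w : y i (X w) = Y i w by rewrite YE.
  (* [F i a b] is the logarithm of [gauss_bump (v i) a b], so [f] is the log-density of a product of
     normal laws centered at the conditional means. *)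
  pose F i a b := - (ln (v i) / 2) - (b - a) ^+ 2 / (2 * v i) + b ^+ 2 / 2.
  pose f (z : TH * k.-tuple R) := \sum_i F i (n i z.1) (y i z.2).
  have mf : measurable_fun setT f.
    apply: measurable_sum => i.
    have m2 : measurable_fun setT (fun z : TH * k.-tuple R => y i z.2).
      exact: (measurableT_comp (my i) measurable_snd).
    have m1 : measurable_fun setT (fun z : TH * k.-tuple R => n i z.1).
      exact: (measurableT_comp (mn i) measurable_fst).
    apply: measurable_funD; last by apply: measurable_funM => //; exact: measurable_funX.
    apply: measurable_funB => //; apply: measurable_funM => //; apply: measurable_funX.
    exact: measurable_funB.
  have fX w : f (H w, X w) = \sum_i F i (n i (H w)) (Y i w).
    by apply: eq_bigr => i _; rewrite yX.
  have iF i : Rintegrable P (fun w => F i (n i (H w)) (Y i w)).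
    apply: RintegrableD; last by under eq_fun do rewrite mulrC; exact: RintegrableZl.
    apply: RintegrableB; first exact/bmeas_integrable/bmeas_cst.
    by under eq_fun do rewrite mulrC; apply: RintegrableZl; case: (L2 i).
  have charY (t : 'I_k -> R) th : \int[P]_w cos (\sum_i t i * Y i w + th) =
      expR (- (\sum_i t i ^+ 2 / 2)) * cos th.
    pose a := \row_i t i.
    have aY w : \sum_i t i * Y i w = lincomb X (a *m B) w.
      rewrite /lincomb; under eq_bigr do rewrite YE mulr_sumr.
      rewrite exchange_big/=; apply: eq_bigr => j _; rewrite mxE mulr_suml.
      by apply: eq_bigr => i _; rewrite mxE mulrA.
    under eq_Rintegral do rewrite aY.
    rewrite (lincomb_char pS gX); congr (expR (- _) * _).
    have -> : qform Sigma (a *m B) = (a *m (B *m Sigma *m B^T) *m a^T) 0 0.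
      by rewrite /qform trmx_mul !mulmxA.
    rewrite BS mulmx1 mxE mulr_suml; apply: eq_bigr => i _.
    by rewrite [a^T _ _]mxE mxE expr2.
  have expf w w' : expR (f (H w, X w')) = \prod_i gauss_bump (v i) (n i (H w)) (Y i w').
    by rewrite expR_sum; apply: eq_bigr => i _; rewrite yX.
  have := @dependence_le_integrable _ _ _ _ _ _ _ P X H S f dep mf.
  have if_ : Rintegrable P (fun w => f (H w, X w)).
    by under eq_fun do rewrite fX; exact: Rintegrable_sum.
  (* Only second moments enter the expectation of [f]: those of the errors give [D i], and those of
     the standard coordinates give the terms [1 / 2]. *)
  move=> /(_ if_); rewrite (_ : \int[P]_w f (H w, X w) = \sum_i (- (ln (v i) / 2) - D i / (2 * v i) + 1 / 2)).
    apply.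
    - move=> w; under eq_fun do rewrite expf.
      apply/bmeas_integrable/bmeas_prod => i _.
      exact: (bmeas_comp (mY i) (bmeas_gauss_bump (n i (H w)) (v01 i))).
    (* With [H] frozen at [H w], the test density has mass exactly 1 under the law of [X]. *)
    - move=> w; under eq_Rintegral do rewrite expf.
      by rewrite (Rintegral_gauss_bump_prod mY charY (fun i => n i (H w)) v01).
  under eq_Rintegral do rewrite fX.
  rewrite Rintegral_sum//; apply: eq_bigr => i _; rewrite /F.
  have i1 : Rintegrable P (fun w => (Y i w - n i (H w)) ^+ 2 / (2 * v i)).
    by under eq_fun do rewrite mulrC; apply: RintegrableZl; case: (L2 i).
  have i2 : Rintegrable P (fun w => Y i w ^+ 2 / 2).
    by under eq_fun do rewrite mulrC; exact: RintegrableZl.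
  have i0 : Rintegrable P (fun=> - (ln (v i) / 2)) by exact/bmeas_integrable/bmeas_cst.
  rewrite RintegralD//; last exact: RintegrableB.
  rewrite RintegralB// Rintegral_probability_cst.
  rewrite RintegralZr//; last by case: (L2 i).
  by rewrite RintegralZr// Y21.
have b0 : \det B != 0.
  by apply/eqP => b0; move: detS; rewrite b0 expr0n mul0r => /eqP; rewrite eq_sym oner_eq0.
have b2 : 0 < \det B ^+ 2 by rewrite exprn_even_gt0.
have S0 : 0 < \det Sigma by rewrite -(pmulr_rgt0 _ b2) detS.
split => //; rewrite -(ler_pM2l b2) mulrA detS mul1r detK//.
Qed.

End mmse.

(** * Accumulation of the rates along the chain *)

Theorem theorem6 (R : realType)
  (d dZ : measure_display) (T : measurableType d) (P : probability T R)
  (k : nat) (X : {RV P >-> k.-tuple R}) (Sigma : 'M[R]_k)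
  (TZ : measurableType dZ) (Z : {RV P >-> TZ})
  (dH : nat -> measure_display) (TH : forall l : nat, measurableType (dH l))
  (H : forall l : nat, {RV P >-> TH l})
  (L : nat) (r : nat -> R) :
  posdefmx Sigma ->
  gaussian_vector P X 0 Sigma ->
  indep_rv P X (H 0%N) ->
  mmse_cov P X (H 0%N) = Sigma ->
  (forall l, (l < L)%N ->
    exists p : R.-pker (TH l * TZ) ~> TH l.+1,
      generated_by P p (fun w => (H l w, Z w)) (H l.+1)) ->
  (forall l, (l < L)%N ->
    markov_chain P X (fun w => (H l w, Z w)) (H l.+1)) ->
  (forall l, (l < L)%N ->
    (cond_mutual_info P Z (H l.+1) (H l) <= (r l)%:E)%E) ->
  (lne (\det Sigma)%:E - (2 * \sum_(l < L) r l)%R%:E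
     <= lne (\det (mmse_cov P X (H L)))%:E)%E.
Proof.
move=> pS gX ind _ _ markov cmi.
have dep l : (l <= L)%N -> dependence_le P X (H l) (\sum_(i < l) r i).
  elim: l => [_|l IH lL]; first by rewrite big_ord0; exact: dependence_le_indep.
  rewrite big_ord_recr/=; apply: dependence_le_step (markov _ lL) (cmi _ lL) _.
  exact/IH/ltnW.
have [detK detS] := mmse_det_lower_bound pS gX (dep L (leqnn L)).
set S := \sum_(i < L) r i in detK *; set K := mmse_cov P X (H L) in detK *.
(* Positivity of both determinants turns the extended-real [lne] into the real logarithm. *)
have K0 : 0 < \det K by apply: lt_le_trans detK; rewrite mulr_gt0// expR_gt0.
rewrite !lne_EFin// lee_fin.
have -> : ln (\det Sigma) - 2 * S = ln (\det Sigma * expR (- (2 * S))).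
  by rewrite lnM ?posrE ?expR_gt0// expRK.
by rewrite ler_ln// posrE mulr_gt0// expR_gt0.
Qed.
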